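(* In the elliptic quantum algebra ${\cal A}_{q,p}(\widehat{sl}(N)_c)$, the operators ${\mathfrak T}(z)$ defined by $${\mathfrak T}(z) \equiv L^+(q^{\frac{c}{2}}z)\, L^-(z)^{-1}$$ satisfy the exchange relation $$\widehat R_{12}(z/w)\,{\mathfrak T}_1(z)\,\widehat R_{21}(q^{c}w/z)\,{\mathfrak T}_2(w) = {\mathfrak T}_2(w)\,\widehat R_{12}(q^{c}z/w)\,{\mathfrak T}_1(z)\,\widehat R_{21}(w/z).$$
   Context: Parameters. $N\ge 2$ is an integer; $q,p,c$ are generic complex parameters for which the expressions below make sense (for the infinite products: $|q|<1$, $|p|<1$), with fixed logarithms so that fractional powers are defined. Put $p^*=pq^{-2c}$ and $(p^* )^{1/2}=p^{1/2}q^{-c}$. Notation: $(x;a)_\infty=\prod_{m\ge0}(1-xa^m)$, $(x;a,b)_\infty=\prod_{m,l\ge0}(1-xa^mb^l)$, $\Theta_a(x)=(x;a)_\infty(ax^{-1};a)_\infty(a;a)_\infty$. $R$-matrix. Write $z=e^{i\pi\xi}$, $q=e^{i\pi\zeta}$, $p=e^{2i\pi\tau}$, $\omega=e^{2i\pi/N}$, $\vartheta\left[{\gamma_1\atop\gamma_2}\right](\xi,\tau)=\sum_{m\in\mathbb Z}\exp\big(i\pi(m+\gamma_1)^2\tau+2i\pi(m+\gamma_1)(\xi+\gamma_2)\big)$. Let $g,h$ be the $N\times N$ matrices $g_{ij}=\omega^i\delta_{ij}$, $h_{ij}=\delta_{i+1,j}$ (indices mod $N$), $I_{(\alpha_1,\alpha_2)}=g^{\alpha_2}h^{\alpha_1}$,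 $g^{1/2}$ a fixed diagonal square root of $g$, and $$W_{(\alpha_1,\alpha_2)}(\xi,\zeta,\tau)=\frac1N\,\frac{\vartheta\left[{1/2+\alpha_1/N\atop 1/2+\alpha_2/N}\right](\xi+\zeta/N,\tau)}{\vartheta\left[{1/2+\alpha_1/N\atop 1/2+\alpha_2/N}\right](\zeta/N,\tau)},$$ $$\frac1{\kappa(z^2)}=\frac{(q^{2N}z^{-2};p,q^{2N})_\infty(q^2z^2;p,q^{2N})_\infty(pz^{-2};p,q^{2N})_\infty(pq^{2N-2}z^2;p,q^{2N})_\infty}{(q^{2N}z^2;p,q^{2N})_\infty(q^2z^{-2};p,q^{2N})_\infty(pz^2;p,q^{2N})_\infty(pq^{2N-2}z^{-2};p,q^{2N})_\infty},$$ $$\widetilde R(z,q,p)=z^{2/N-2}\frac1{\kappa(z^2)}\frac{\vartheta\left[{1/2\atop1/2}\right](\zeta,\tau)}{\vartheta\left[{1/2\atop1/2}\right](\xi+\zeta,\tau)}\sum_{\alpha_1,\alpha_2\in\mathbb Z_N}W_{(\alpha_1,\alpha_2)}(\xi,\zeta,\tau)\,I_{(\alpha_1,\alpha_2)}\otimes I_{(\alpha_1,\alpha_2)}^{-1},$$ $R(z)=R(z,q,p)=(g^{1/2}\otimes g^{1/2})\widetilde R(z,q,p)(g^{-1/2}\otimes g^{-1/2})$. Further $\tau_N(z)=z^{2/N-2}\Theta_{q^{2N}}(qz^2)/\Theta_{q^{2N}}(qz^{-2})$ (it satisfies $\tau_N(q^Nz)=\tau_N(z)$, $\tau_N(z^{-1})=\tau_N(z)^{-1}$),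 $\widehat R_{12}(x)=\tau_N(q^{1/2}x^{-1})R_{12}(x)$, $\widehat R^*_{12}(x)=\widehat R_{12}(x,q,p^* )$. Subscripts denote the tensor factors of copies of $\mathbb C^N$ acted on ($R_{21}$ is $R_{12}$ with the two spaces exchanged) and $t_i$ denotes transposition in space $i$. Known properties (with $a=g^{1/2}hg^{1/2}$): $R_{12}(z)R_{13}(w)R_{23}(w/z)=R_{23}(w/z)R_{13}(w)R_{12}(z)$; $R_{12}(z)R_{21}(z^{-1})=1$; $R_{12}(z)^{t_2}R_{21}(q^{-N}z^{-1})^{t_2}=1$; $R_{12}(-z)=\omega(g^{-1}\otimes 1)R_{12}(z)(g\otimes1)$; $\widehat R_{12}(-p^{1/2}z)=(a\otimes1)^{-1}\widehat R_{21}(z^{-1})^{-1}(a\otimes1)$. Algebra. ${\cal A}_{q,p}(\widehat{gl}(N)_c)$ is the algebra generated by the entries (modes) of $L(z)=(L_{ij}(z))_{1\le i,j\le N}$, $L_{ij}(z)=\sum_{n\in\mathbb Z}L_{ij}(n)z^n$, with relations $\widehat R_{12}(z/w)L_1(z)L_2(w)=L_2(w)L_1(z)\widehat R^*_{12}(z/w)$, where $L_1=L\otimes 1$, $L_2=1\otimes L$; ${\cal A}_{q,p}(\widehat{sl}(N)_c)$ is its quotient by $q\text{-}\det L(z)=q^{c/2}$, where $q\text{-}\det L(z)=\sum_{\sigma\in{\mathfrak S}_N}\varepsilon(\sigma)\prod_{i=1}^NL_{i,\sigma(i)}(zq^{i-N-1})$ is central. The relations are understood as analytic (not merely formal series) relations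 in the spectral parameters. Derived operators. $L^+(z)=L(q^{c/2}z)$, $L^-(z)=a\,L(-p^{1/2}z)\,a^{-1}$ (assumed invertible). As usual ${\mathfrak T}_1(z)={\mathfrak T}(z)\otimes 1$, ${\mathfrak T}_2(w)=1\otimes{\mathfrak T}(w)$. *)

(* Defs.v *)
(* MathComp / MathComp-Analysis, over the complex numbers [R[i]], [R : realType] *)
From HB Require Import structures.
From mathcomp Require Import all_boot all_order all_algebra perm.
From mathcomp Require Import complex mxtens.
From mathcomp Require Import all_classical all_reals all_analysis.

Set Implicit Arguments.
Unset Strict Implicit.
Unset Printing Implicit Defensive.

Import Order.TTheory GRing.Theory Num.Theory.
Import numFieldNormedType.Exports.

Local Open Scope classical_set_scope.
Local Open Scope ring_scope.
Local Open Scope complex_scope.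

(* Multiplicative parameters are represented by fixed logarithms:
     z = e^{i pi xi},  q = e^{i pi zeta},  p = e^{2 i pi tau},
   so that a fractional power such as z^{2/N-2} is [epi ((2/N-2) xi)].
   Functions of z are functions of xi, and multiplicative operations on z are
   additive on xi:  q^s z is [xi + s zeta],  z/w is [xi - eta],  and
   -p^{1/2} z is [xi + 1 + tau]  (with log(-1) = i pi). *)

Section SpecialFunctions.
Variable R : realType.
Local Notation C := R[i].

Definition cexp (z : C) : C :=
  (expR (complex.Re z))%:C * (cos (complex.Im z) +i* sin (complex.Im z)).

Definition epi (x : C) : C := cexp ((0 +i* (pi : R)) * x).

Definition clim (u : nat -> C) : C := lim ((u : nat -> C^o) @ \oo).

(* (x; a)_oo *)
Definition pochhammer (x a : C) : C :=
  clim (fun n => \prod_(m < n) (1 - x * a ^+ m)).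

(* (x; a, b)_oo ; absolutely convergent for |a|, |b| < 1, so square partial
   products may be used *)
Definition pochhammer2 (x a b : C) : C :=
  clim (fun n => \prod_(m < n) \prod_(l < n) (1 - x * a ^+ m * b ^+ l)).

(* Theta_a(x) *)
Definition Theta (a x : C) : C :=
  pochhammer x a * pochhammer (a / x) a * pochhammer a a.

(* vartheta[g1; g2](x, t), the series over m in Z being summed as
   lim_n sum_{-n <= m <= n} (it converges absolutely for Im t > 0) *)
Definition theta_char (g1 g2 x t : C) : C :=
  clim (fun n => \sum_(k < n.*2.+1)
    let m := (k%:Z - n%:Z)%:~R : C in
    epi ((m + g1) ^+ 2 * t + 2 * (m + g1) * (x + g2))).

End SpecialFunctions.

Section RMatrix.
Variables (R : realType) (N : nat).
Local Notation C := R[i].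
Implicit Types zeta tau xi : C.

(* Row k : 'I_N of a matrix is the row labelled i = k + 1 in 1, .., N. *)
Definition gmx : 'M[C]_N := \matrix_(i, j) (epi (2 / N%:R) ^+ i.+1 *+ (i == j)).

Definition hmx : 'M[C]_N := \matrix_(i, j) ((i.+1 %% N)%N == j)%:R.

Definition Imx (a1 a2 : nat) : 'M[C]_N := gmx ^+ a2 *m hmx ^+ a1.

(* W is periodic mod N in a1 and a2, so 'I_N may serve as Z_N *)
Definition W zeta tau xi (a1 a2 : nat) : C :=
  let th := theta_char (1 / 2 + a1%:R / N%:R) (1 / 2 + a2%:R / N%:R) in
  N%:R^-1 * (th (xi + zeta / N%:R) tau / th (zeta / N%:R) tau).

(* 1 / kappa(z^2) *)
Definition kappa_inv zeta tau xi : C :=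
  let p := epi (2 * tau) in
  let q2 := epi (2 * zeta) in
  let q2N := epi (2 * N%:R * zeta) in
  let z2 := epi (2 * xi) in
  let P x := pochhammer2 x p q2N in
  (P (q2N / z2) * P (q2 * z2) * P (p / z2) * P (p * q2N / q2 * z2)) /
  (P (q2N * z2) * P (q2 / z2) * P (p * z2) * P (p * q2N / q2 / z2)).

Definition Rtilde zeta tau xi : 'M[C]_(N * N) :=
  (epi ((2 / N%:R - 2) * xi) * kappa_inv zeta tau xi *
   (theta_char (1 / 2) (1 / 2) zeta tau /
    theta_char (1 / 2) (1 / 2) (xi + zeta) tau)) *:
  \sum_(a1 < N) \sum_(a2 < N)
    W zeta tau xi a1 a2 *: (Imx a1 a2 *t invmx (Imx a1 a2)).

(* [ghalf] stands for the chosen diagonal square root g^{1/2}. *)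
Definition Rmx (ghalf : 'M[C]_N) zeta tau xi : 'M[C]_(N * N) :=
  (ghalf *t ghalf) *m Rtilde zeta tau xi *m (invmx ghalf *t invmx ghalf).

Definition tauN zeta xi : C :=
  let q2N := epi (2 * N%:R * zeta) in
  epi ((2 / N%:R - 2) * xi) *
  (Theta q2N (epi (zeta + 2 * xi)) / Theta q2N (epi (zeta - 2 * xi))).

(* \widehat R_{12}(z, q, p) *)
Definition Rhat (ghalf : 'M[C]_N) zeta tau xi : 'M[C]_(N * N) :=
  tauN zeta (zeta / 2 - xi) *: Rmx ghalf zeta tau xi.

Definition amx (ghalf : 'M[C]_N) : 'M[C]_N := ghalf *m hmx *m ghalf.

(* The theta constants in the denominators of W do not vanish. *)
Definition W_defined zeta tau : Prop :=
  forall a1 a2 : 'I_N,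
    theta_char (1 / 2 + a1%:R / N%:R) (1 / 2 + a2%:R / N%:R) (zeta / N%:R) tau
      != 0.

End RMatrix.

Section TensorLegs.
Variables (K : pzRingType) (N : nat).

Definition swap_legs (k : 'I_(N * N)) : 'I_(N * N) :=
  mxtens_index ((mxtens_unindex k).2, (mxtens_unindex k).1).

(* X_{12} |-> X_{21} *)
Definition flip (X : 'M[K]_(N * N)) : 'M[K]_(N * N) :=
  \matrix_(i, j) X (swap_legs i) (swap_legs j).

Definition leg1 (X : 'M[K]_N) : 'M[K]_(N * N) := X *t 1%:M.
Definition leg2 (X : 'M[K]_N) : 'M[K]_(N * N) := 1%:M *t X.

End TensorLegs.

(* Equalities of meromorphic functions are required at generic points only:
   outside a countable set of values of each spectral parameter and of their
   difference.  A family that is analytic in the spectral parameters satisfies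
   such an equality generically iff it satisfies it wherever both sides are
   regular.  The exchange relations cannot be required at every pair of points:
   e.g. \widehat R(x) vanishes at x = -p^{1/2} whereas \widehat R^*(x) does not
   (for generic c), so that L_1(z) L_2(w) has a pole at z/w = -p^{1/2}. *)
Section Generic.
Variable R : realType.
Local Notation C := R[i].

Definition generic1 (P : C -> Prop) : Prop :=
  exists2 D : set C, countable D & forall xi, ~ D xi -> P xi.

Definition generic2 (P : C -> C -> Prop) : Prop :=
  exists D E : set C, [/\ countable D, countable E &
    forall xi eta, ~ D xi -> ~ D eta -> ~ E (xi - eta) -> P xi eta].

End Generic.

Section EllipticAlgebra.
Variables (R : realType) (N : nat) (ghalf : 'M[R[i]]_N).
Variables (zeta tau c : R[i]) (A : algType R[i]).
Local Notation C := R[i].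
Implicit Types (L Linv : C -> 'M[A]_N) (xi eta : C).

(* complex matrices seen as matrices over A *)
Definition inA m n (X : 'M[C]_(m, n)) : 'M[A]_(m, n) := map_mx (in_alg A) X.

(* p^* = p q^{-2c} *)
Definition taustar : C := tau - c * zeta.

Definition Rh12 xi : 'M[A]_(N * N) := inA (Rhat ghalf zeta tau xi).
Definition Rh21 xi : 'M[A]_(N * N) := inA (flip (Rhat ghalf zeta tau xi)).
Definition Rhstar12 xi : 'M[A]_(N * N) := inA (Rhat ghalf zeta taustar xi).

(* The elliptic algebra of gl(N) is universal among the algebras A carrying a
   family L with this property.  L is a function of the logarithm xi, and
   L(xi + 2) = L(xi), i.e. a Laurent expansion L(z) = sum_n L(n) z^n, is allowed
   but not imposed: \widehat R itself is multivalued in z for N >= 3. *)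
Definition gl_relation L : Prop :=
  generic2 (fun xi eta =>
    Rh12 (xi - eta) *m leg1 (L xi) *m leg2 (L eta) =
    leg2 (L eta) *m leg1 (L xi) *m Rhstar12 (xi - eta)).

(* q-det L(z) = sum_s eps(s) prod_i L_{i, s(i)}(z q^{i-N-1}).  The entries do
   not commute; the factors are written with i decreasing from left to right,
   i = N - k for k = 0, .., N - 1, the order for which q-det L(z) is central
   (for N = 2: \widehat R(q^{-1}) is proportional to the antisymmetriser, and
   q-det L(q^2 z) is read off the relation at w = q z, from the antisymmetriser
   multiplied on the left by L_2(q z) L_1(z)). *)
Definition qdet L xi : A :=
  \sum_(s : 'S_N) (-1) ^+ s *
    \prod_(k < N) L (xi - k.+1%:R * zeta) (rev_ord k) (s (rev_ord k)).

Definition sl_relations L : Prop :=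
  gl_relation L /\ generic1 (fun xi => qdet L xi = (epi (c / 2 * zeta))%:A).

Definition Lplus L xi : 'M[A]_N := L (xi + c / 2 * zeta).

Definition Lminus L xi : 'M[A]_N :=
  inA (amx ghalf) *m L (xi + 1 + tau) *m inA (invmx (amx ghalf)).

Definition is_inverse_of (X Y : 'M[A]_N) : Prop :=
  X *m Y = 1%:M /\ Y *m X = 1%:M.

(* [Linv] stands for xi |-> L^-(xi)^{-1}. *)
Definition frakT L Linv xi : 'M[A]_N := Lplus L (xi + c / 2 * zeta) *m Linv xi.

End EllipticAlgebra.

(* Main.v *)
(* Write P = L^+(q^{c/2} z) and M = L^-(z).  Substituting shifted arguments in
   the relation for L gives relations of type P P and M M; with z replaced by
   -p^{1/2} z in the first factor only, the quasi-periodicity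
     a_1 R(-p^{1/2} x) a_1^{-1} = R_21(x^{-1})^{-1}        (R = \widehat R)
   for both p and p^* turns it into R_21(q^c w/z) P_2 M_1 = M_1 P_2 R^*_21(w/z).
   The exchange relation for P M^{-1} is then formal.

   Quasi-periodicity follows from that of the theta functions, from functional
   equations of the infinite products, and from the unitarity of Belavin's
   matrix, i.e. from sums over the N-torsion points of quotients of products of
   theta functions.  These rest on the three-term identity, a consequence of
   th(x+y) th(x-y) = A(x) B(y) - B(x) A(y).  Off the diagonal, the three-term
   identity expresses Q(x) - Q(x + d) as a multiple of P(x) - P(x + c), with P
   and Q elliptic and c, d torsion points, so the twisted sum of Q vanishes.  On
   the diagonal, the sum is a combination of A(xi) and B(xi), determined by its
   values at 0 and at -zeta; it vanishes at the latter by the partial fraction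
   identity for theta functions.  The zeros of theta come from the Jacobi triple
   product. *)
Require Import Defs.
From mathcomp Require Import all_boot all_order all_algebra.
From mathcomp Require Import complex mxtens.
From mathcomp Require Import all_classical all_reals all_analysis.
From mathcomp Require Import ring lra zify.
Import Order.TTheory GRing.Theory Num.Theory.
Import numFieldNormedType.Exports.
Set Implicit Arguments.
Unset Strict Implicit.
Unset Printing Implicit Defensive.
Local Open Scope ring_scope.
Local Open Scope complex_scope.

(** * Complex sequences and the exponential *)

(** Quasi-periodicity is used in the form a_1 R(-p^{1/2} x) a_1^{-1} R_21(x^{-1}) = 1. The
    quasi-periods of theta only bring a_1 R(-p^{1/2} x) a_1^{-1} back to a scalar multiple of R(x);
    unitarity then identifies R(x) with the inverse of R_21(x^{-1}) up to a scalar, and the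
    normalisation by tau_N and kappa makes the total scalar equal to 1. This is where the asymmetric
    q^c comes from. Theta identities are usually obtained from Liouville's theorem and from counting
    zeros with contour integrals. Here they all come from rearranging absolutely convergent series
    and from limits of finite products. The scalar identities may fail where a denominator vanishes;
    these are countably many points, absorbed by the generic quantifiers. *)

Section ComplexSequences.
Variable R : realType.
Local Notation C := R[i].
Implicit Types (u v : nat -> C) (x y z l : C).

(** The norm of [R[i]] is [R[i]]-valued; a real-valued modulus makes the order lemmas of [R] and
    [lra], [nra] usable. *)
Definition nrm (x : C) : R := Normc.normc x.

Lemma nrmE x : `|x| = (nrm x)%:C. Proof. by case: x. Qed.
Lemma nrm_ge0 x : 0 <= nrm x. Proof. by rewrite -ler0c -nrmE. Qed.
Lemma nrm0 : nrm 0 = 0. Proof. exact: Normc.normc0. Qed.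
Lemma nrm1 : nrm 1 = 1. Proof. exact: Normc.normc1. Qed.
Lemma nrmM x y : nrm (x * y) = nrm x * nrm y. Proof. exact: Normc.normcM. Qed.
Lemma nrmV x : nrm x^-1 = (nrm x)^-1. Proof. exact: Normc.normcV. Qed.
Lemma nrmD x y : nrm (x + y) <= nrm x + nrm y. Proof. exact: le_normcD. Qed.
Lemma nrmN x : nrm (- x) = nrm x. Proof. exact: normcN. Qed.
Lemma nrmB x y : nrm (x - y) <= nrm x + nrm y.
Proof. by rewrite -(nrmN y) nrmD. Qed.
Lemma nrmBC x y : nrm (x - y) = nrm (y - x). Proof. by rewrite -nrmN opprB. Qed.
Lemma nrmM_le x y (a b : R) : nrm x <= a -> nrm y <= b -> nrm (x * y) <= a * b.
Proof. by move=> ha hb; rewrite nrmM ler_pM ?nrm_ge0. Qed.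
Lemma nrmX x n : nrm (x ^+ n) = nrm x ^+ n.
Proof. by elim: n => [|n IH]; rewrite ?nrm1 // !exprS nrmM IH. Qed.
Lemma nrm_eq0 x : (nrm x == 0) = (x == 0).
Proof. by apply/eqP/eqP => [/Normc.eq0_normc//|->]; rewrite nrm0. Qed.
Lemma nrm_gt0 x : (0 < nrm x) = (x != 0).
Proof. by rewrite lt_def nrm_eq0 nrm_ge0 andbT. Qed.
Lemma nrm_sum (I : Type) (s : seq I) (P : pred I) (F : I -> C) :
  nrm (\sum_(i <- s | P i) F i) <= \sum_(i <- s | P i) nrm (F i).
Proof.
elim/big_ind2: _ => [|x1 x2 y1 y2 h1 h2|//]; first by rewrite nrm0.
exact: le_trans (nrmD _ _) (lerD h1 h2).
Qed.
Lemma nrm_Re x : `|complex.Re x| <= nrm x.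
Proof.
by case: x => a b /=; rewrite -(sqrtr_sqr a) ler_sqrt ?addr_ge0 ?sqr_ge0// lerDl sqr_ge0.
Qed.
Lemma nrm_Im x : `|complex.Im x| <= nrm x.
Proof.
by case: x => a b /=; rewrite -(sqrtr_sqr b) ler_sqrt ?addr_ge0 ?sqr_ge0// lerDr sqr_ge0.
Qed.
Lemma nrm_real (a : R) : nrm a%:C = `|a|.
Proof. by rewrite /nrm /= expr0n /= addr0 sqrtr_sqr. Qed.

Lemma nrm_le x : nrm x <= `|complex.Re x| + `|complex.Im x|.
Proof.
rewrite {1}[x]complexE; apply: le_trans (nrmD _ _) _.
rewrite nrm_real lerD2l nrmM nrm_real /nrm /= expr0n /= add0r expr1n sqrtr1 mul1r.
by [].
Qed.

(** [clim] takes limits in [C^o]; the wrapper confines that structure, so that later statements are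
    about plain sequences of [C]. *)
Variant cvgC u l : Prop := CvgC of ((u : nat -> C^o) @ \oo --> (l : C^o))%classic.

Lemma cvgCP u l : cvgC u l <->
  forall e : R, 0 < e -> exists n0, forall n, (n0 <= n)%N -> nrm (u n - l) < e.
Proof.
split=> [[/(@cvgrPdistC_lt C C^o) h]|h].
  move=> e e0; have /h[n0 _ hn] : 0 < e%:C by rewrite ltcR.
  by exists n0 => n /hn /=; rewrite -ltcR -nrmE.
split; apply/(@cvgrPdistC_lt C C^o) => e e0; have [e1 he1] : exists k, e = k%:C.
  by apply/complex_realP/gtr0_real.
have [|n0 hn] := h e1; first by rewrite -ltcR -he1.
by exists n0 => // n /hn /=; rewrite -ltcR -nrmE -he1.
Qed.

Lemma cvgC_lim u l : cvgC u l -> clim u = l.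
Proof. by case=> h; apply: (@cvg_lim C^o) => //; apply: norm_hausdorff. Qed.

Lemma cvgC_unique u l l' : cvgC u l -> cvgC u l' -> l = l'.
Proof. by move=> /cvgC_lim <- /cvgC_lim <-. Qed.

Lemma cvgC_cst x : cvgC (fun=> x) x.
Proof. by split; exact: (@cvg_cst C^o). Qed.

Lemma cvgCD u v l l' : cvgC u l -> cvgC v l' -> cvgC (fun n => u n + v n) (l + l').
Proof. by case=> h [h']; split; move: h h'; exact: (@cvgD C C^o). Qed.

Lemma cvgCN u l : cvgC u l -> cvgC (fun n => - u n) (- l).
Proof. by case=> h; split; move: h; exact: (@cvgN C C^o). Qed.

Lemma cvgCB u v l l' : cvgC u l -> cvgC v l' -> cvgC (fun n => u n - v n) (l - l').
Proof. by move=> hu hv; apply: cvgCD hu (cvgCN hv). Qed.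

Lemma cvgCM u v l l' : cvgC u l -> cvgC v l' -> cvgC (fun n => u n * v n) (l * l').
Proof. by case=> h [h']; split; move: h h'; exact: (@cvgM C). Qed.

Lemma cvgCZ x u l : cvgC u l -> cvgC (fun n => x * u n) (x * l).
Proof. exact: cvgCM (cvgC_cst x). Qed.

Lemma eq_cvgC u v l : u =1 v -> cvgC u l -> cvgC v l.
Proof. by move=> /funext ->. Qed.

Lemma cvgC_shift u l : cvgC (fun n => u n.+1) l <-> cvgC u l.
Proof.
split=> /cvgCP h; apply/cvgCP => e /h[n0 hn].
  by exists n0.+1 => -[|n] // /hn.
by exists n0 => n hle; apply: hn; apply: leqW.
Qed.

Lemma exp_small (rho B e : R) : 0 <= rho < 1 -> 0 < e ->
  exists n0, forall n, (n0 <= n)%N -> B * rho ^+ n < e.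
Proof.
move=> /andP[r0 r1] e0.
have h : ((fun n => B * rho ^+ n) @ \oo --> (0 : R))%classic.
  rewrite -[0](mulr0 B); apply: cvgM; first exact: cvg_cst.
  by apply: cvg_expr; rewrite ger0_norm.
have /cvgrPdistC_lt/(_ e e0)[n0 _ hn] := h.
by exists n0 => n /hn /=; rewrite subr0; apply: le_lt_trans; apply: ler_norm.
Qed.

Lemma cvgC_sqz u v l (rho B : R) : 0 <= rho < 1 ->
  (forall n, nrm (v n - u n) <= B * rho ^+ n) -> cvgC u l -> cvgC v l.
Proof.
move=> hr huv hu; suff h : cvgC (fun n => v n - u n) 0.
  by have := cvgCD h hu; rewrite add0r; apply: eq_cvgC => n /=; rewrite subrK.
apply/cvgCP => e /(exp_small B hr)[n0 hn]; exists n0 => n /hn.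
by rewrite subr0; apply: le_lt_trans.
Qed.

(** Real and imaginary parts are telescoped into series dominated by a geometric one. *)
Lemma cvgC_geo u (rho B : R) : 0 <= rho < 1 ->
  (forall n, nrm (u n.+1 - u n) <= B * rho ^+ n) -> exists l, cvgC u l.
Proof.
move=> hr hu.
have B0 : 0 <= B by have := hu 0%N; rewrite expr0 mulr1; apply: le_trans (nrm_ge0 _).
have key (f : nat -> R) : (forall n, `|f n.+1 - f n| <= B * rho ^+ n) ->
    exists l : R, (f @ \oo --> l)%classic.
  move=> hf; have hs : cvgn (series (telescope f)).
    apply: normed_cvg; apply: (@series_le_cvg _ _ (fun n => B * rho ^+ n)) => //.
    - move=> n; exact: normr_ge0.
    - by move=> n; rewrite mulr_ge0 // exprn_ge0 //; case/andP: hr.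
    - apply: is_cvg_geometric_series; case/andP: hr => ? ?; by rewrite ger0_norm.
  move/cvg_ex: hs => [l hl]; exists (f 0%N + l).
  apply/cvgrPdistC_lt => e e0; move/cvgrPdistC_lt/(_ e e0): hl.
  apply: filterS => n; rewrite (eq_sum_telescope f n).
  by rewrite (_ : f 0%N + _ - (f 0%N + l) = series (telescope f) n - l) //; ring.
have [n|a ha] := key (fun n => complex.Re (u n)).
  apply: le_trans (hu n); apply: le_trans (nrm_Re _).
  by case: (u n.+1) (u n) => ? ? [].
have [n|b hb] := key (fun n => complex.Im (u n)).
  apply: le_trans (hu n); apply: le_trans (nrm_Im _).
  by case: (u n.+1) (u n) => ? ? [].
exists (a +i* b); apply/cvgCP => e e0.
have e2 : 0 < e / 2 by rewrite divr_gt0.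
have /cvgrPdistC_lt/(_ _ e2)[n0 _ h0] := ha.
have /cvgrPdistC_lt/(_ _ e2)[n1 _ h1] := hb.
exists (maxn n0 n1) => n; rewrite geq_max => /andP[/h0 k0 /h1 k1].
apply: le_lt_trans (nrm_le _) _; rewrite [e]splitr.
by case: (u n) k0 k1 => c d /= k0 k1; apply: ltrD.
Qed.

Lemma le_cvgC u l x (e : R) : cvgC u l -> (forall n, nrm (u n - x) <= e) ->
  nrm (l - x) <= e.
Proof.
move=> /cvgCP hu h; apply/ler_addgt0Pr => d /hu[n0 hn].
have -> : l - x = (u n0 - x) - (u n0 - l) by ring.
apply: le_trans (nrmB _ _) (lerD (h _) (ltW (hn _ _))); exact: leqnn.
Qed.

End ComplexSequences.

Section Exponential.
Variable R : realType.
Local Notation C := R[i].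
Implicit Types (x y z : C).

Lemma cexpD x y : cexp (x + y) = cexp x * cexp y.
Proof.
case: x y => a b [c d]; rewrite /cexp /= expRD cosD sinD.
by apply/eqP; rewrite eq_complex /=; apply/andP; split; apply/eqP; ring.
Qed.

Lemma nrm_cexp x : nrm (cexp x) = expR (complex.Re x).
Proof.
rewrite /cexp nrmM nrm_real ger0_norm ?expR_ge0 // /nrm /=.
by rewrite cos2Dsin2 sqrtr1 mulr1.
Qed.

Lemma epiD x y : epi (x + y) = epi x * epi y.
Proof. by rewrite /epi mulrDr cexpD. Qed.
Lemma epi0 : epi 0 = 1 :> C.
Proof.
rewrite /epi mulr0 /cexp /= expR0 cos0 sin0.
by apply/eqP; rewrite eq_complex /=; apply/andP; split; apply/eqP; ring.
Qed.
Lemma epi1 : epi 1 = - 1 :> C.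
Proof.
rewrite /epi mulr1 /cexp /= expR0 cospi sinpi.
by apply/eqP; rewrite eq_complex /=; apply/andP; split; apply/eqP; ring.
Qed.
Lemma epi2 : epi 2 = 1 :> C.
Proof. by rewrite -[2]/(1 + 1) epiD epi1 mulrNN mulr1. Qed.
Lemma epiN x : epi (- x) = (epi x)^-1.
Proof.
have h : epi x * epi (- x) = 1 by rewrite -epiD subrr epi0.
have h0 : epi x != 0 by apply: contra_eq_neq h => ->; rewrite mul0r eq_sym oner_eq0.
by apply: (mulfI h0); rewrite h divff.
Qed.
Lemma epi_neq0 x : epi x != 0.
Proof.
have h : epi x * epi (- x) = 1 by rewrite -epiD subrr epi0.
by apply: contra_eq_neq h => ->; rewrite mul0r eq_sym oner_eq0.
Qed.
Lemma epiB x y : epi (x - y) = epi x / epi y.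
Proof. by rewrite epiD epiN. Qed.
Lemma epiMn x n : epi (n%:R * x) = epi x ^+ n.
Proof.
elim: n => [|n IH]; first by rewrite mul0r epi0.
by rewrite -natr1 mulrDl mul1r epiD IH exprSr.
Qed.
Lemma epi2n n : epi (2 * n%:R) = 1 :> C.
Proof. by rewrite mulrC epiMn epi2 expr1n. Qed.
Lemma epi2z (k : int) : epi (2 * k%:~R) = 1 :> C.
Proof. by case: k => n; rewrite ?NegzE ?mulrNz ?mulrN ?epiN epi2n ?invr1. Qed.

Lemma epiDz (k : int) x : epi (x + 2 * k%:~R) = epi x.
Proof. by rewrite epiD epi2z mulr1. Qed.

Lemma nrm_epi x : nrm (epi x) = expR (- (pi * complex.Im x)).
Proof. by rewrite /epi nrm_cexp; case: x => a b /=; rewrite mul0r add0r mulrC. Qed.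

Lemma epi_lt1 x : 0 < complex.Im x -> nrm (epi x) < 1.
Proof. by move=> h; rewrite nrm_epi expR_lt1 oppr_lt0 mulr_gt0 // pi_gt0. Qed.

Lemma mul2C (a b : R) : 2 * (a +i* b) = (2 * a) +i* (2 * b) :> C.
Proof.
rewrite mulr2n mulrDl mul1r; apply/eqP; rewrite eq_complex /=.
by apply/andP; split; apply/eqP; ring.
Qed.

Lemma epi_eq1 x : epi (2 * x) = 1 -> exists k : int, x = k%:~R.
Proof.
move=> h; have pi0 := pi_gt0 R.
have hI : complex.Im x = 0.
  have := congr1 (@nrm R) h; rewrite nrm_epi nrm1 -expR0 => /expR_inj.
  case: (x) => a b; rewrite mul2C /= => /eqP.
  by rewrite oppr_eq0 !mulf_eq0 gt_eqF //= pnatr_eq0 /= => /eqP.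
case: x h hI => a b h /= b0; subst b.
have hc : cos (2 * a * pi) = 1.
  move: h; rewrite mul2C /epi /cexp /= => /eqP; rewrite eq_complex /= => /andP[/eqP + _].
  rewrite !(mulr0, mul0r, subr0, sub0r, addr0, oppr0, expR0, mul1r).
  by rewrite add0r mulrC.
exists (Num.floor a).
have [f0 f1] : 0 <= a - (Num.floor a)%:~R /\ a - (Num.floor a)%:~R < 1.
  by have := Num.Theory.floorD1_gt a; have := Num.Theory.floor_le a; rewrite intrD; lra.
move: (Num.floor a) f0 f1 => k f0 f1.
have per (m : int) (t : R) : cos (t + 2 * m%:~R * pi) = cos t.
  have pern (n : nat) (s : R) : cos (s + 2 * n%:R * pi) = cos s.
    elim: n s => [|n IH] s; first by rewrite mulr0 mul0r addr0.
    rewrite -(IH s) -[RHS]cosD2pi; congr cos; rewrite -natr1; ring.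
  case: m => n; rewrite ?NegzE ?mulrNz; first exact: pern.
  by rewrite -(pern n.+1); congr cos; ring.
have hf : cos (2 * (a - k%:~R) * pi) = 1.
  by rewrite -(per k) -[RHS]hc; congr cos; ring.
suff f00 : a - k%:~R = 0.
  by apply/eqP; rewrite eq_complex /= -[k%:~R]/(k%:~R) raddfMz /= raddfMz /= mul0rz eqxx andbT -subr_eq0 f00.
move: (a - k%:~R) f0 f1 hf => f f0 f1 hf.
(* [cos] is injective on [[0, pi]] only. For [f > 1/2] the angle is reflected to [2 * (1 - f) * pi],
   which would force [f = 1]. *)
have [le|gt] := lerP f (1/2).
  have : 2 * f * pi = 0.
    apply: cos_inj; rewrite ?hf ?cos0 // in_itv /= ?lexx ?(ltW pi0) //.
    by rewrite !mulr_ge0 ?(ltW pi0) //= ler_piMl ?(ltW pi0) //; lra.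
  by move/eqP; rewrite !mulf_eq0 (gt_eqF pi0) pnatr_eq0 orbF /= => /eqP.
have : 2 * (1 - f) * pi = 0.
  apply: cos_inj; rewrite ?cos0 // ?in_itv /= ?lexx ?(ltW pi0) //.
    rewrite !mulr_ge0 ?(ltW pi0) //=; last lra.
    by rewrite ler_piMl ?(ltW pi0) //; lra.
  by rewrite -[RHS]hf -[RHS]cosN -[RHS](per 1); congr cos; rewrite [1%:~R]/=; ring.
by move/eqP; rewrite !mulf_eq0 (gt_eqF pi0) pnatr_eq0 orbF /= => /eqP; lra.
Qed.

End Exponential.

(** * Infinite products *)

Section InfiniteProducts.
Variable R : realType.
Local Notation C := R[i].
Implicit Types (u v : nat -> C) (x y a b : C).

(** Expanding the product, the left side is at most the product of the [1 + nrm (t i)], minus 1. *)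
Lemma prod_near1 (I : Type) (s : seq I) (t : I -> C) :
  nrm (\prod_(i <- s) (1 - t i) - 1) <= expR (\sum_(i <- s) nrm (t i)) - 1.
Proof.
elim: s => [|i s IH]; first by rewrite !big_nil subrr nrm0 expR0 subrr.
rewrite !big_cons expRD.
set p := \prod_(_ <- _) _ in IH *; set S := \sum_(_ <- _) _ in IH *.
have -> : (1 - t i) * p - 1 = (p - 1) - t i * (p - 1) - t i by ring.
have h1 := expR_ge1Dx (nrm (t i)); have h2 : 1 <= expR S.
  by rewrite -expR0 ler_expR sumr_ge0 // => j _; apply: nrm_ge0.
have h3 := nrm_ge0 (t i).
have h4 : nrm (p - 1 - t i * (p - 1) - t i) <= nrm (p - 1) + nrm (t i) * nrm (p - 1) + nrm (t i).
  by apply: le_trans (nrmB _ _) _; rewrite lerD2r -nrmM; apply: nrmB.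
nra.
Qed.

Lemma expR_sub1_le (s c : R) : 0 <= s -> s <= c -> expR s - 1 <= s * expR c.
Proof.
move=> s0 sc; have h1 := expR_ge1Dx (- s); have h2 : expR s <= expR c by rewrite ler_expR.
have h3 : expR (- s) * expR s = 1 by rewrite -expRD addNr expR0.
have h4 := expR_ge0 s; nra.
Qed.

Lemma geo_sum_le (r : R) n : 0 <= r < 1 -> \sum_(i < n) r ^+ i <= (1 - r)^-1.
Proof.
move=> /andP[r0 r1]; have h : 0 < 1 - r by lra.
suff -> : \sum_(i < n) r ^+ i = (1 - r ^+ n) * (1 - r)^-1.
  by rewrite ler_piMl ?invr_ge0 ?(ltW h) // gerBl exprn_ge0.
elim: n => [|n IH]; first by rewrite big_ord0 expr0 subrr mul0r.
by rewrite big_ord_recr /= IH exprS; field; rewrite gt_eqF.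
Qed.

Lemma nrm_lt1 a : nrm a < 1 -> 0 <= nrm a < 1.
Proof. by rewrite nrm_ge0. Qed.

Lemma cvgC_rate u l (rho B : R) : 0 <= rho < 1 ->
  (forall n, nrm (u n.+1 - u n) <= B * rho ^+ n) -> cvgC u l ->
  forall n, nrm (u n - l) <= B / (1 - rho) * rho ^+ n.
Proof.
move=> hr hu hl n; have B0 : 0 <= B.
  by have := hu 0%N; rewrite expr0 mulr1; apply: le_trans (nrm_ge0 _).
have /andP[r0 r1] := hr.
rewrite nrmBC; apply: (@le_cvgC _ (fun k => u (n + k)%N)).
  move/cvgCP: hl => hl; apply/cvgCP => e /hl[m hm]; exists m => k hk.
  by apply: hm; apply: leq_trans hk (leq_addl _ _).
move=> k; have -> : u (n + k)%N - u n = \sum_(i < k) (u (n + i).+1 - u (n + i)%N).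
  elim: k => [|k IH]; first by rewrite big_ord0 addn0 subrr.
  by rewrite big_ord_recr /= -IH addnS; ring.
apply: le_trans (nrm_sum _ _ _) _.
apply: le_trans (_ : \sum_(i < k) B * rho ^+ n * rho ^+ i <= _).
  by apply: ler_sum => i _; rewrite -mulrA -exprD.
by rewrite -mulr_sumr [leRHS]mulrAC ler_wpM2l ?geo_sum_le // mulr_ge0 // exprn_ge0.
Qed.

(** Common source of convergence, rate and non-vanishing for the infinite products below: the
    partial products are bounded by [prod_near1], so their increments decay like [rho ^+ n]. *)
Lemma cvg_prod u v (rho B : R) : 0 <= rho < 1 ->
  (forall n, u n.+1 = u n * v n) -> (forall n, nrm (v n - 1) <= B * rho ^+ n) ->
  exists l, [/\ cvgC u l, (exists D, forall n, nrm (u n - l) <= D * rho ^+ n) &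
    (forall n, v n != 0) -> u 0 != 0 -> l != 0].
Proof.
move=> hr hu hv; have B0 : 0 <= B.
  by have := hv 0%N; rewrite expr0 mulr1; apply: le_trans (nrm_ge0 _).
have /andP[r0 r1] := hr; have r1' : 0 < (1 - rho)^-1 by rewrite invr_gt0 subr_gt0.
have tail n k : u (n + k)%N = u n * \prod_(i <- index_iota 0 k) (1 - (1 - v (n + i)%N)).
  elim: k => [|k IH]; first by rewrite addn0 big_geq // mulr1.
  by rewrite addnS hu IH big_nat_recr //= mulrA; congr (_ * _); ring.
have tailS n k : \sum_(i <- index_iota 0 k) nrm (1 - v (n + i)%N) <= B * rho ^+ n / (1 - rho).
  apply: le_trans (_ : \sum_(i < k) B * rho ^+ n * rho ^+ i <= _).
    by rewrite big_mkord; apply: ler_sum => i _; rewrite nrmBC -mulrA -exprD.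
  by rewrite -mulr_sumr ler_wpM2l ?geo_sum_le // mulr_ge0 // exprn_ge0.
pose c := B / (1 - rho).
have ub n : nrm (u n) <= nrm (u 0) * expR c.
  rewrite -[n]add0n tail nrmM ler_wpM2l ?nrm_ge0 //.
  have := prod_near1 (index_iota 0 n) (fun i => 1 - v (0 + i)%N).
  have : expR (\sum_(i <- index_iota 0 n) nrm (1 - v (0 + i)%N)) <= expR c.
    by rewrite ler_expR; have := tailS 0%N n; rewrite expr0 mulr1.
  set p := \prod_(_ <- _) _ => h1 h2.
  have := nrmD (p - 1) 1; rewrite subrK nrm1; lra.
have hdu n : nrm (u n.+1 - u n) <= nrm (u 0) * expR c * B * rho ^+ n.
  have -> : u n.+1 - u n = u n * (v n - 1) by rewrite hu; ring.
  by rewrite nrmM -mulrA; apply: ler_pM; rewrite ?nrm_ge0.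
have [l hl] := cvgC_geo hr hdu.
exists l; split => //; first by eexists; apply: cvgC_rate hr hdu hl.
(* With a tail sum of at most [1/4], later partial products differ from [u n0] by at most
   [(expR (1/4) - 1) * nrm (u n0)], less than half of [nrm (u n0)]; this keeps the limit away from
   0. *)
move=> hv0 hu0; have [n0 hn] := exp_small (B / (1 - rho)) hr (divr_gt0 ltr01 (ltr0Sn R 3)).
have un0 : u n0 != 0.
  by elim: (n0) => // n IH; rewrite hu mulf_neq0.
have {}hn := hn n0 (leqnn _).
apply/eqP => l0.
have : nrm (l - u n0) <= nrm (u n0) / 2.
  apply: (@le_cvgC _ (fun k => u (k + n0)%N)).
    move/cvgCP: hl => hl; apply/cvgCP => e /hl[m hm]; exists m => k hk.
    by apply: hm; apply: leq_trans hk (leq_addr _ _).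
  move=> k; rewrite addnC tail -{2}[u n0]mulr1 -mulrBr nrmM ler_wpM2l ?nrm_ge0 //.
  apply: le_trans (prod_near1 _ _) _.
  set S := \sum_(_ <- _) _; have S0 : 0 <= S by apply: sumr_ge0 => j _; apply: nrm_ge0.
  have S1 : S <= 1 / 4.
    by apply: le_trans (tailS n0 k) _; apply: ltW; rewrite mulrAC.
  have h1 := expR_ge1Dx (- S).
  have h3 : expR (- S) * expR S = 1 by rewrite -expRD addNr expR0.
  have h4 := expR_ge0 S; nra.
rewrite l0 sub0r nrmN; have : 0 < nrm (u n0) by rewrite nrm_gt0.
by lra.
Qed.

Lemma poch_cvg x a : nrm a < 1 ->
  cvgC (fun n => \prod_(m < n) (1 - x * a ^+ m)) (pochhammer x a).
Proof.
move=> a1; have [||l [hl _ _]] := @cvg_prod (fun n => \prod_(m < n) (1 - x * a ^+ m))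
  (fun n => 1 - x * a ^+ n) (nrm a) (nrm x) (nrm_lt1 a1).
- by move=> n; rewrite big_ord_recr.
- by move=> n; rewrite -nrmX -nrmM -nrmN opprB opprB addrC subrK.
- by rewrite /pochhammer (cvgC_lim hl).
Qed.

Lemma poch_neq0 x a : nrm a < 1 -> (forall m, 1 - x * a ^+ m != 0) ->
  pochhammer x a != 0.
Proof.
move=> a1 h; have [||l [hl _ +]] := @cvg_prod (fun n => \prod_(m < n) (1 - x * a ^+ m))
  (fun n => 1 - x * a ^+ n) (nrm a) (nrm x) (nrm_lt1 a1).
- by move=> n; rewrite big_ord_recr.
- by move=> n; rewrite -nrmX -nrmM -nrmN opprB opprB addrC subrK.
- by rewrite /pochhammer (cvgC_lim hl); apply => //; rewrite big_ord0 oner_eq0.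
Qed.

Lemma geo_prod_near1 y a n : nrm a < 1 ->
  nrm (\prod_(m < n) (1 - y * a ^+ m) - 1) <= expR (nrm y / (1 - nrm a)) - 1.
Proof.
move=> a1; apply: le_trans (prod_near1 _ _) _; rewrite lerD2r ler_expR.
under eq_bigr do rewrite nrmM nrmX.
by rewrite -mulr_sumr ler_wpM2l ?nrm_ge0 // geo_sum_le // nrm_lt1.
Qed.

Lemma geo_prod_small x a b n k : nrm a < 1 -> nrm b < 1 ->
  nrm (\prod_(m < k) (1 - x * b ^+ n * a ^+ m) - 1) <=
    nrm x / (1 - nrm a) * expR (nrm x / (1 - nrm a)) * nrm b ^+ n.
Proof.
move=> a1 b1; apply: le_trans (geo_prod_near1 _ _ a1) _.
have a0 : 0 <= (1 - nrm a)^-1 by rewrite invr_ge0 subr_ge0 ltW.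
have hb : nrm b ^+ n <= 1 by rewrite exprn_ile1 ?nrm_ge0 // ltW.
apply: le_trans (@expR_sub1_le _ (nrm x / (1 - nrm a)) _ _) _.
- by rewrite mulr_ge0 ?nrm_ge0.
- by rewrite ler_wpM2r // nrmM nrmX ler_piMr ?nrm_ge0.
- by rewrite nrmM nrmX (mulrAC (nrm x)) (mulrAC _ (nrm b ^+ n)).
Qed.

Lemma poch2_cvg_neq0 x a b : nrm a < 1 -> nrm b < 1 ->
  cvgC (fun n => \prod_(m < n) \prod_(l < n) (1 - x * a ^+ m * b ^+ l))
    (pochhammer2 x a b) /\
  ((forall m l, 1 - x * a ^+ m * b ^+ l != 0) -> pochhammer2 x a b != 0).
Proof.
move=> a1 b1.
pose r := Num.max (nrm a) (nrm b).
(* Enlarging the square from side [n] to [n + 1] adds the factors [P n] with [l = n], [m < n], and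
   the factors [Q n] with [m = n], corner included. *)
pose P n := \prod_(m < n) (1 - x * b ^+ n * a ^+ m).
pose Q n := \prod_(l < n.+1) (1 - x * a ^+ n * b ^+ l).
have ra : nrm a <= r by rewrite le_max lexx.
have rb : nrm b <= r by rewrite le_max lexx orbT.
have hr : 0 <= r < 1 by rewrite (le_trans (nrm_ge0 a) ra) gt_max a1 b1.
pose ca := nrm x / (1 - nrm a) * expR (nrm x / (1 - nrm a)).
pose cb := nrm x / (1 - nrm b) * expR (nrm x / (1 - nrm b)).
have pos (c : C) : nrm c < 1 -> 0 <= nrm x / (1 - nrm c) * expR (nrm x / (1 - nrm c)).
  by move=> c1; rewrite !mulr_ge0 ?expR_ge0 ?nrm_ge0 // invr_ge0 subr_ge0 ltW.
have hP n : nrm (P n - 1) <= ca * r ^+ n.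
  apply: le_trans (geo_prod_small _ _ _ a1 b1) _; rewrite ler_wpM2l ?pos //.
  by rewrite lerXn2r // ?nnegrE ?nrm_ge0 //; case/andP: hr.
have hQ n : nrm (Q n - 1) <= cb * r ^+ n.
  apply: le_trans (geo_prod_small _ _ _ b1 a1) _; rewrite ler_wpM2l ?pos //.
  by rewrite lerXn2r // ?nnegrE ?nrm_ge0 //; case/andP: hr.
have [||l [hl _ hl0]] := @cvg_prod
    (fun n => \prod_(m < n) \prod_(l < n) (1 - x * a ^+ m * b ^+ l))
    (fun n => P n * Q n) r (ca + cb + ca * cb) hr.
- move=> n; rewrite big_ord_recr /= mulrA; congr (_ * _).
  rewrite -big_split; apply: eq_bigr => i _; rewrite big_ord_recr /=.
  by rewrite (mulrAC x).
- move=> n; have -> : P n * Q n - 1 = (P n - 1) + (Q n - 1) + (P n - 1) * (Q n - 1) by ring.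
  apply: le_trans (nrmD _ _) _; apply: le_trans (lerD (nrmD _ _) (lexx _)) _.
  rewrite nrmM; have hp := hP n; have hq := hQ n.
  have p0 := nrm_ge0 (P n - 1); have q0 := nrm_ge0 (Q n - 1).
  have rn : 0 <= r ^+ n <= 1.
    by case/andP: hr => r0 r1; rewrite exprn_ge0 // exprn_ile1 // ltW.
  have ca0 : 0 <= ca := pos _ a1; have cb0 : 0 <= cb := pos _ b1.
  have h1 : nrm (P n - 1) * nrm (Q n - 1) <= (ca * r ^+ n) * (cb * r ^+ n) by apply: ler_pM.
  have h2 : (ca * r ^+ n) * (cb * r ^+ n) <= (ca * cb) * r ^+ n.
    case/andP: rn => rn0 rn1; rewrite mulrACA ler_wpM2l ?ler_piMl //.
    exact: mulr_ge0.
  lra.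
split; first by rewrite /pochhammer2 (cvgC_lim hl).
rewrite /pochhammer2 (cvgC_lim hl) => h; apply: hl0; last by rewrite big_ord0 oner_eq0.
move=> n; apply: mulf_neq0; apply/prodf_neq0 => i _ //.
by rewrite mulrAC.
Qed.

Lemma poch2_rec x a b : nrm a < 1 -> nrm b < 1 ->
  pochhammer2 x a b = pochhammer x b * pochhammer2 (x * a) a b.
Proof.
move=> a1 b1.
have [h1 _] := poch2_cvg_neq0 x a1 b1; have [h2 _] := poch2_cvg_neq0 (x * a) a1 b1.
have h3 := poch_cvg x b1.
have {}h1 := (cvgC_shift _ _).2 h1; have {}h3 := (cvgC_shift _ _).2 h3.
apply: cvgC_unique h1 _; rewrite -[pochhammer2 _ _ _]mulr1.
(* Without its row [m = 0], the square of side [n + 1] is a square of side [n] for [x * a] together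
   with one more column, whose product tends to 1. *)
have h4 : cvgC (fun n => \prod_(m < n) (1 - x * a * b ^+ n * a ^+ m)) 1.
  apply: cvgC_sqz (cvgC_cst 1); first exact: nrm_lt1 b1.
  by move=> n; apply: geo_prod_small.
apply: eq_cvgC (cvgCM h3 (cvgCM h2 h4)) => n /=.
rewrite [RHS]big_ord_recl; congr (_ * _).
  by apply: eq_bigr => i _; rewrite expr0 mulr1.
rewrite -big_split; apply: eq_bigr => i _ /=; rewrite big_ord_recr /=.
rewrite !exprS !mulrA; congr (_ * (1 - _)); last by ring.
Qed.

(** [kappa_inv] in multiplicative variables: [Q] is q^{2N}, [q2] is q^2, and [z] stands for the
    square of the spectral parameter. *)
Definition kap (p Q q2 z : C) :=
  let P x := pochhammer2 x p Q in
  (P (Q / z) * P (q2 * z) * P (p / z) * P (p * Q / q2 * z)) /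
  (P (Q * z) * P (q2 / z) * P (p * z) * P (p * Q / q2 / z)).

(* (x; p, Q) = (x; Q) (x p; p, Q) moves every double product from p z to z; the
   remaining simple products are those of the theta functions. *)
Lemma kap_shift (p Q q2 z : C) : nrm p < 1 -> nrm Q < 1 ->
  p != 0 -> q2 != 0 -> z != 0 ->
  pochhammer Q Q != 0 ->
  (forall x, x \in [:: Q / (p * z); q2 * z; z^-1; p * Q / q2 * z; Q * z;
                     q2 / (p * z); p * z; Q / q2 / z] ->
     pochhammer x Q != 0 /\ pochhammer2 x p Q != 0) ->
  kap p Q q2 (p * z) * kap p Q q2 z^-1 *
  (Theta Q (q2 / (p * z)) * Theta Q (q2 * z) / (Theta Q (p * z) * Theta Q z^-1)) = 1.
Proof.
move=> p1 Q1 p0 q0 z0 hQ h.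
have r := fun x => poch2_rec x p1 Q1.
have {}h x : x \in [:: Q / (p * z); q2 * z; z^-1; p * Q / q2 * z; Q * z;
                     q2 / (p * z); p * z; Q / q2 / z] ->
    (pochhammer x Q != 0) * (pochhammer2 (x * p) p Q != 0).
  by move=> /h[h1]; rewrite r mulf_eq0 negb_or => /andP[].
rewrite /kap /Theta.
have e1 : Q / (p * z) * p = Q / z by field; rewrite p0 z0.
have e2 : q2 * z * p = q2 * (p * z) by ring.
have e3 : z^-1 * p = p / z by rewrite mulrC.
have e3' : p / (p * z) = z^-1 by field; rewrite p0 z0.
have e4 : p * Q / q2 * z * p = p * Q / q2 * (p * z) by ring.
have e5 : Q * z * p = Q * (p * z) by ring.
have e6 : q2 / (p * z) * p = q2 / z by field; rewrite p0 z0.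
have e7 : p * z * p = p * (p * z) by ring.
have e8 : Q / q2 / z * p = p * Q / q2 / z by field; rewrite q0 z0.
have e8' : p * Q / q2 / (p * z) = Q / q2 / z by field; rewrite p0 z0 q0.
have e9 : Q / (q2 / (p * z)) = p * Q / q2 * z by field; rewrite p0 z0 q0.
have e10 : Q / (q2 * z) = Q / q2 / z by field; rewrite z0 q0.
rewrite invrK e3' e8' e9 e10.
have := h (Q / (p * z)); have := h (q2 * z); have := h z^-1.
have := h (p * Q / q2 * z); have := h (Q * z); have := h (q2 / (p * z)).
have := h (p * z); have := h (Q / q2 / z).
rewrite !inE !eqxx !orbT /= => /(_ isT) h8 /(_ isT) h7 /(_ isT) h6 /(_ isT) h5
  /(_ isT) h4 /(_ isT) h3 /(_ isT) h2 /(_ isT) h1.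
rewrite (r (Q / (p * z))) (r (q2 * z)) (r z^-1) (r (p * Q / q2 * z)) (r (Q * z)).
rewrite (r (q2 / (p * z))) (r (p * z)) (r (Q / q2 / z)).
move: h1 h2 h3 h4 h5 h6 h7 h8; rewrite e1 e2 e3 e4 e5 e6 e7 e8.
move=> h1 h2 h3 h4 h5 h6 h7 h8.
field; by rewrite hQ !(h1, h2, h3, h4, h5, h6, h7, h8).
Qed.

End InfiniteProducts.

(** * Absolutely summable families *)

Section AbsoluteSummation.
Variable R : realType.
Local Notation C := R[i].

Lemma eq_sum_support (I : eqType) (V : nmodType) (G : I -> V) (s1 s2 : seq I) :
  uniq s1 -> uniq s2 -> (forall i, G i != 0 -> (i \in s1) = (i \in s2)) ->
  \sum_(i <- s1) G i = \sum_(i <- s2) G i.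
Proof.
move=> u1 u2 h.
have aux s : \sum_(i <- s) G i = \sum_(i <- [seq i <- s | G i != 0]) G i.
  rewrite big_filter [RHS]big_mkcond; apply: eq_bigr => i _.
  by case: eqP => //= ->.
rewrite aux [RHS]aux; apply: perm_big; apply: uniq_perm; rewrite ?filter_uniq //.
move=> i; rewrite !mem_filter; case: eqP => //= /eqP; exact: h.
Qed.

(** Summability without an order on the indices. A bound by [(1/4)^w] is split in two: one factor
    [(1/2)^w] is summed, with bound [M], and the other gives the tail factor [(1/2)^K]. *)
Definition tame (I : eqType) (w : I -> nat) (M : R) :=
  forall s : seq I, uniq s -> \sum_(i <- s) (1 / 2) ^+ w i <= M.

Definition dominated (I : eqType) (w : I -> nat) (B : R) (G : I -> C) :=
  forall i, nrm (G i) <= B * (1 / 4) ^+ w i.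

Lemma tail_le (I : eqType) (w : I -> nat) M B (G : I -> C) (K : nat) s :
  tame w M -> dominated w B G -> uniq s -> {in s, forall i, K <= w i}%N -> 0 <= B ->
  nrm (\sum_(i <- s) G i) <= B * M * (1 / 2) ^+ K.
Proof.
move=> hM hG us hs B0; apply: le_trans (nrm_sum _ _ _) _.
apply: le_trans (_ : \sum_(i <- s) B * (1 / 2) ^+ K * (1 / 2) ^+ w i <= _).
  rewrite big_seq [leRHS]big_seq; apply: ler_sum => i /hs hi.
  apply: le_trans (hG i) _; rewrite -mulrA ler_wpM2l //.
  have -> : (1 / 4 : R) = (1 / 2) * (1 / 2) by field.
  rewrite exprMn ler_wpM2r // ?exprn_ge0 ?divr_ge0 ?ler01 //.
  rewrite ler_wiXn2l //; lra.
rewrite -mulr_sumr mulrAC ler_wpM2r ?exprn_ge0 ?divr_ge0 ?ler01 //.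
by rewrite ler_wpM2l ?hM.
Qed.

(** Finite sums that exhaust the indices of weight below [K] agree up to a multiple of [2^-K]. This
    serves both for reindexing a series and for the product of two theta series. *)
Lemma sum_compare (I : eqType) (w : I -> nat) M B (G : I -> C) (K : nat) s1 s2 :
  tame w M -> dominated w B G -> 0 <= B -> uniq s1 -> uniq s2 ->
  (forall i, (w i < K)%N -> G i != 0 -> i \in s1) ->
  (forall i, (w i < K)%N -> G i != 0 -> i \in s2) ->
  nrm (\sum_(i <- s1) G i - \sum_(i <- s2) G i) <= B * M *+ 2 * (1 / 2) ^+ K.
Proof.
move=> hM hG B0 u1 u2 h1 h2.
have split s : \sum_(i <- s) G i = \sum_(i <- [seq i <- s | (w i < K)%N]) G i +
    \sum_(i <- [seq i <- s | ~~ (w i < K)%N]) G i.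
  by rewrite !big_filter (bigID (fun i => (w i < K)%N)).
rewrite (split s1) (split s2).
have -> : \sum_(i <- [seq i <- s1 | (w i < K)%N]) G i =
          \sum_(i <- [seq i <- s2 | (w i < K)%N]) G i.
  apply: eq_sum_support; rewrite ?filter_uniq // => i Gi.
  by rewrite !mem_filter; case: ltnP => //= hi; rewrite h1 ?h2.
rewrite opprD addrACA subrr add0r mulr2n mulrDl; apply: le_trans (nrmB _ _) _.
by apply: lerD; apply: tail_le hG _ _ B0; rewrite ?filter_uniq // => i;
  rewrite mem_filter -leqNgt => /andP[].
Qed.

Definition box (n : nat) : seq int := [seq k%:Z - n%:Z | k <- iota 0 n.*2.+1].

Lemma mem_box n m : (m \in box n) = (absz m <= n)%N.
Proof.
apply/mapP/idP => [[k]|h]; first by rewrite mem_iota => hk ->; lia.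
by exists (absz (m + n%:Z)); rewrite ?mem_iota; lia.
Qed.

Lemma uniq_box n : uniq (box n).
Proof. by rewrite map_inj_uniq ?iota_uniq // => i j; lia. Qed.

Definition bsum (V : nmodType) (f : int -> V) n := \sum_(m <- box n) f m.

Lemma bsumE (V : nmodType) (f : int -> V) n :
  bsum f n = \sum_(k < n.*2.+1) f (k%:Z - n%:Z).
Proof. by rewrite /bsum /box big_map -(big_mkord xpredT (fun k : nat => f (k%:Z - n%:Z))) /index_iota subn0. Qed.

Lemma bsumS (V : nmodType) (f : int -> V) n :
  bsum f n.+1 = bsum f n + (f n.+1%:Z + f (- n.+1%:Z)).
Proof.
rewrite !bsumE doubleS big_ord_recl big_ord_recr /= addrC -addrA.
congr (_ + _).
  by apply: eq_bigr => i _; congr f; rewrite /bump; lia.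
by congr (f _ + f _); rewrite /bump; lia.
Qed.

(** The bound is the sum of [2^-|m|] over all integers. *)
Lemma tame_int : tame absz 3.
Proof.
move=> s us; pose n := (\max_(m <- s) absz m)%N.
have hs m : m \in s -> (absz m <= n)%N.
  by move=> hm; rewrite /n (big_rem m) //= leq_maxl.
apply: le_trans (_ : bsum (fun m => (1 / 2) ^+ absz m) n <= _); last first.
  suff -> : bsum (fun m => (1 / 2) ^+ absz m : R) n = 3 - 2 * (1 / 2) ^+ n.
    by rewrite gerBl mulr_ge0 // exprn_ge0 ?divr_ge0.
  elim: n {hs} => [|n IH]; first by rewrite bsumE big_ord1 /= !expr0; lra.
  by rewrite bsumS IH abszN /= !exprS; lra.
have h : perm_eq s [seq m <- box n | m \in s].
  apply: uniq_perm; rewrite ?filter_uniq ?uniq_box // => m.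
  by rewrite mem_filter mem_box; case: (boolP (m \in s)) => // /hs ->.
rewrite (perm_big _ h) big_filter big_mkcond; apply: ler_sum => m _.
by case: ifP => // _; rewrite exprn_ge0 ?divr_ge0.
Qed.

Definition w2 (k : int * int) := (absz k.1 + absz k.2)%N.

Lemma tame_int2 : tame w2 9.
Proof.
move=> s us; pose n := (\max_(k <- s) w2 k)%N.
have hs k : k \in s -> (w2 k <= n)%N.
  by move=> hk; rewrite /n (big_rem k) //= leq_maxl.
pose b2 := [seq (u, v) | u <- box n, v <- box n].
have ub : uniq b2 by apply: allpairs_uniq; rewrite ?uniq_box // => -[? ?] [].
have h : perm_eq s [seq k <- b2 | k \in s].
  apply: uniq_perm; rewrite ?filter_uniq // => k.
  rewrite mem_filter; case: (boolP (k \in s)) => // /hs; case: k => u v /= hk.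
  by apply/esym/allpairsP; exists (u, v); rewrite !mem_box /w2 /= in hk *; split => //; lia.
rewrite (perm_big _ h) big_filter big_mkcond.
apply: le_trans (_ : \sum_(k <- b2) (1 / 2) ^+ w2 k <= _).
  by apply: ler_sum => k _; case: ifP => // _; rewrite exprn_ge0 ?divr_ge0.
have -> : \sum_(k <- b2) (1 / 2 : R) ^+ w2 k =
    (\sum_(u <- box n) (1 / 2) ^+ absz u) * (\sum_(v <- box n) (1 / 2) ^+ absz v).
  rewrite big_distrlr big_allpairs; apply: eq_bigr => u _; apply: eq_bigr => v _.
  by rewrite /= -exprD.
have -> : (9 : R) = 3 * 3 by lra.
by apply: ler_pM; rewrite ?tame_int ?uniq_box // sumr_ge0 // => i _; rewrite exprn_ge0 ?divr_ge0.
Qed.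

Lemma bsum_cvg B (f : int -> C) : 0 <= B -> dominated absz B f ->
  cvgC (bsum f) (clim (bsum f)).
Proof.
move=> B0 hf; have [||l hl] := @cvgC_geo _ (bsum f) (1 / 4) (B * 2).
- by lra.
- move=> n; rewrite bsumS (addrC (bsum f n)) addrK; apply: le_trans (nrmD _ _) _.
  apply: le_trans (lerD (hf _) (hf _)) _; rewrite abszN /=.
  rewrite -mulrDr -mulrA ler_wpM2l // exprS.
  have : 0 <= (1 / 4 : R) ^+ n by rewrite exprn_ge0 ?divr_ge0.
  by move: (_ ^+ _) => t; lra.
- by rewrite (cvgC_lim hl).
Qed.

(** The image of the box of radius [n] contains the box of radius [n - c], so [sum_compare] applies
    with [K = n + 1 - c]; the loss is the constant factor [2 ^+ c]. *)
Lemma clim_reindex B (f : int -> C) (s : int -> int) (c : nat) : 0 <= B ->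
  dominated absz B f -> injective s ->
  (forall m, exists2 m', m = s m' & (absz m' <= absz m + c)%N) ->
  clim (bsum (f \o s)) = clim (bsum f).
Proof.
move=> B0 hf injs hs; have h := bsum_cvg B0 hf.
apply: cvgC_lim.
apply: (@cvgC_sqz _ (bsum f) _ _ (1 / 2)
  (B * 3 *+ 2 * (2 ^+ c))) => //; first lra.
move=> n; have -> : bsum (f \o s) n = \sum_(m <- map s (box n)) f m by rewrite big_map.
have k0 : 0 <= B * 3 *+ 2 by rewrite mulrn_wge0 ?mulr_ge0.
apply: le_trans (@sum_compare _ absz 3 B f (n.+1 - c) _ _ tame_int hf B0 _ _ _ _) _.
- by rewrite map_inj_uniq ?uniq_box.
- exact: uniq_box.
- move=> m hm _; have [m' em hm'] := hs m; rewrite em map_f // mem_box; lia.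
- by move=> m hm _; rewrite mem_box; lia.
rewrite -mulrA ler_wpM2l //.
have e (k : nat) : (1 / 2 : R) ^+ k = (2 ^+ k)^-1 by rewrite mul1r exprVn.
rewrite !e ler_pdivlMr ?exprn_gt0 // mulrC ler_pdivrMr ?exprn_gt0 // -exprD.
by rewrite ler_eXn2l ?ltr1n //; lia.
Qed.

End AbsoluteSummation.

Section GaussianDomination.
Variable R : realType.
Local Notation C := R[i].

Lemma gauss_dominated (t c d : C) : 0 < complex.Im t ->
  exists2 B, 0 <= B & dominated absz B
    (fun m : int => epi (m%:~R ^+ 2 * t + m%:~R * c + d)).
Proof.
move=> ht; pose t' := complex.Im t; pose c' := complex.Im c; pose d' := complex.Im d.
(* [(1/4)^|m|] is written as [expR (- L |m|)]. The terms linear in [k = |m|] then have slope at most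
   [s], and [D] is the maximum of [s k - pi t' k^2]. *)
pose L : R := ln 4; pose s := pi * `|c'| + L; have pi0 := pi_gt0 R.
have L4 : expR (- L) = 1 / 4 by rewrite expRN lnK ?posrE // mul1r.
pose D := s ^+ 2 / (4 * (pi * t')).
exists (expR (D - pi * d')) => [|m]; first exact: expR_ge0.
rewrite nrm_epi -L4 -expRM_natl -expRD ler_expR.
have -> : complex.Im (m%:~R ^+ 2 * t + m%:~R * c + d) = m%:~R ^+ 2 * t' + m%:~R * c' + d'.
  rewrite /t' /c' /d'; case: (t) (c) (d) => [a1 b1] [a2 b2] [a3 b3].
  have -> : (m%:~R : C) = (m%:~R +i* 0) by rewrite -[_ +i* 0]/(_%:C) rmorph_int.
  by rewrite /=; ring.
have em : ((absz m)%:R : R) = `|m%:~R| by rewrite -intr_norm -abszE.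
rewrite -mulr_natl em.
have e2 : (m%:~R : R) ^+ 2 = `|m%:~R| ^+ 2 by rewrite real_normK ?num_real.
have ec : - ((m%:~R : R) * c') <= `|m%:~R| * `|c'|.
  by rewrite -normrM -normrN ler_norm.
rewrite e2; move: (`|m%:~R|) ec => k ec.
suff : s * k - pi * t' * k ^+ 2 <= D by rewrite /s; move: (m%:~R * c') ec => u; nra.
rewrite /D ler_pdivlMr ?mulr_gt0 //; have := sqr_ge0 (s - 2 * (pi * t') * k).
move: (pi * t') => v; nra.
Qed.

End GaussianDomination.

(** * Theta functions *)

Section Theta.
Variable R : realType.
Local Notation C := R[i].
Variable tau : C.
Hypothesis tau_gt0 : 0 < complex.Im tau.
Implicit Types (x y : C) (m : int).

(** The odd theta function of Jacobi ([theta_1] up to sign); the other characteristics reduce to it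
    by [theta_char_th]. *)
Definition th x : C := theta_char (1 / 2) (1 / 2) x tau.

Definition tht x m : C :=
  epi ((m%:~R + 1 / 2) ^+ 2 * tau + 2 * (m%:~R + 1 / 2) * (x + 1 / 2)).

Lemma thE x : th x = clim (bsum (tht x)).
Proof. by congr clim; apply/funext => n; rewrite bsumE. Qed.

Lemma tht_dominated x : exists2 B, 0 <= B & dominated absz B (tht x).
Proof.
have [B B0 hB] := gauss_dominated (tau + (2 * x + 1)) (tau / 4 + x + 1 / 2) tau_gt0.
exists B => // m; apply: le_trans (hB m); rewrite le_eqVlt; apply/orP; left.
by apply/eqP; congr (nrm (epi _)); field.
Qed.

Lemma th_cvg x : cvgC (bsum (tht x)) (th x).
Proof. by have [B B0 hB] := tht_dominated x; rewrite thE; apply: bsum_cvg hB. Qed.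

Lemma theta_char_th (s t x : C) :
  theta_char (1 / 2 + s) (1 / 2 + t) x tau =
  epi (s ^+ 2 * tau + 2 * s * (x + 1 / 2 + t)) * th (x + s * tau + t).
Proof.
apply: cvgC_lim; apply: eq_cvgC (cvgCZ _ (th_cvg _)) => n.
rewrite bsumE mulr_sumr; apply: eq_bigr => i _; rewrite -epiD; congr epi.
by field.
Qed.

Lemma th_reindex (c : C) x y (s : int -> int) (k : nat) :
  injective s -> (forall m, exists2 m', m = s m' & (absz m' <= absz m + k)%N) ->
  (forall m, tht x m = c * tht y (s m)) -> th x = c * th y.
Proof.
move=> injs hs h; have [B B0 hB] := tht_dominated y.
rewrite !thE -(clim_reindex B0 hB injs hs).
rewrite (_ : tht x = fun m => c * (tht y \o s) m); last by apply/funext.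
apply: cvgC_lim.
have hc : cvgC (bsum (tht y \o s)) (clim (bsum (tht y \o s))).
  have := @bsum_cvg _ (B * 4 ^+ k) (tht y \o s); apply.
    by rewrite mulr_ge0 // exprn_ge0.
  move=> m /=; apply: le_trans (hB _) _; rewrite -mulrA ler_wpM2l //.
  have [m' /injs <- hm'] := hs (s m).
  have e (j : nat) : (1 / 4 : R) ^+ j = (4 ^+ j)^-1 by rewrite mul1r exprVn.
  rewrite !e ler_pdivlMr ?exprn_gt0 // mulrC ler_pdivrMr ?exprn_gt0 // -exprD.
  by rewrite ler_eXn2l ?ltr1n // addnC.
by apply: eq_cvgC (cvgCZ c hc) => n; rewrite /bsum mulr_sumr.
Qed.

Lemma thD1 x : th (x + 1) = - th x.
Proof.
rewrite -mulN1r; apply: (@th_reindex _ _ _ id 0) => // [m|m].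
  by exists m; rewrite ?addn0.
rewrite /tht -epi1 -epiD -[RHS](epiDz m); congr epi; by field.
Qed.

Lemma thDtau x : th (x + tau) = - epi (- tau - 2 * x) * th x.
Proof.
rewrite -mulN1r -epi1 -epiD.
apply: (@th_reindex _ _ _ (fun m => m + 1) 1) => // [m1 m2|m|m].
- exact: addIr.
- by exists (m - 1); rewrite ?subrK //; lia.
rewrite /tht -epiD -[RHS](epiDz (-1)); congr epi.
by rewrite !intrD (_ : (-1)%:~R = -1) //; field.
Qed.

Lemma thN x : th (- x) = - th x.
Proof.
rewrite -[RHS]mulN1r -epi1.
apply: (@th_reindex _ _ _ (fun m => - m - 1) 1) => // [m1 m2|m|m].
- by move=> h; lia.
- by exists (- m - 1); lia.
rewrite /tht -epiD -[RHS](epiDz m); congr epi.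
by rewrite intrB rmorphN /=; field.
Qed.

Lemma th0 : th 0 = 0.
Proof.
have h : th 0 *+ 2 = 0 by rewrite mulr2n -{2}oppr0 thN subrr.
by apply/eqP; move/eqP: h; rewrite mulrn_eq0.
Qed.

(** The two sums are theta_3(2x, 2 tau) and theta_2(2x, 2 tau). Extension by 0 lets both run over
    the same boxes of integers. *)
Definition even_part x (u : int) : C :=
  if odd (absz u) then 0 else epi (u%:~R ^+ 2 * tau / 2 + 2 * u%:~R * x).
Definition odd_part x (u : int) : C :=
  if odd (absz u) then epi (u%:~R ^+ 2 * tau / 2 + 2 * u%:~R * x) else 0.
Definition thA x := clim (bsum (even_part x)).
Definition thB x := clim (bsum (odd_part x)).

Lemma halftau_gt0 : 0 < complex.Im (tau / 2).
Proof.
rewrite (_ : tau / 2 = (complex.Re tau / 2) +i* (complex.Im tau / 2)) ?divr_gt0 //.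
have n2 : (2 : C) != 0 by rewrite pnatr_eq0.
apply: (mulfI n2); rewrite mul2C mulrC divfK //; case: tau => a b /=.
by apply/eqP; rewrite eq_complex /=; apply/andP; split; apply/eqP; field.
Qed.

Lemma parts_dominated x : exists B, [/\ 0 <= B,
  dominated absz B (fun u => epi (u%:~R ^+ 2 * tau / 2 + 2 * u%:~R * x)),
  dominated absz B (even_part x) & dominated absz B (odd_part x)].
Proof.
have [B B0 hB] := gauss_dominated (2 * x) 0 halftau_gt0; exists B.
have h : dominated absz B (fun u => epi (u%:~R ^+ 2 * tau / 2 + 2 * u%:~R * x)).
  move=> u; apply: le_trans (hB u); rewrite le_eqVlt; apply/orP; left.
  by apply/eqP; congr (nrm (epi _)); ring.
by split => // u; rewrite /even_part /odd_part; case: ifP => // _;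
  rewrite nrm0 mulr_ge0 // exprn_ge0 ?divr_ge0.
Qed.

Lemma even_or_odd (u : int) : (exists j, u = 2 * j) \/ (exists j, u = 2 * j + 1).
Proof.
have [h|h] : (u %% 2)%Z = 0 \/ (u %% 2)%Z = 1 by lia.
  by left; exists (u %/ 2)%Z; lia.
by right; exists (u %/ 2)%Z; lia.
Qed.

Lemma odd_abs_even (j : int) : odd (absz (2 * j)) = false.
Proof. by rewrite abszM /= mul2n odd_double. Qed.

Lemma odd_abs_odd (j : int) : odd (absz (2 * j + 1)) = true.
Proof.
have [h|h] : absz (2 * j + 1) = (absz j).*2.+1 \/ absz (2 * j + 1) = (absz (j + 1)).*2.+1 by lia.
  by rewrite h /= odd_double.
by rewrite h /= odd_double.
Qed.

(* Expand both theta series and pass to the indices u = m + n + 1, v = m - n,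
   which run over the pairs of integers of opposite parity. *)
Lemma th_add x y : th (x + y) * th (x - y) = thA x * thB y - thB x * thA y.
Proof.
have [B2 [B20 hy1 hy2 hy3]] := parts_dominated y.
have [B3 [B30 hz1 hz2 hz3]] := parts_dominated x.
pose G (k : int * int) := even_part x k.1 * odd_part y k.2 - odd_part x k.1 * even_part y k.2.
have hG : dominated w2 (B3 * B2) G.
  case=> u v; rewrite /G /= /w2 /= exprD.
  have -> : B3 * B2 * ((1 / 4) ^+ `|u| * (1 / 4) ^+ `|v|) =
    (B3 * (1 / 4) ^+ `|u|) * (B2 * (1 / 4) ^+ `|v|) by ring.
  have := hz2 u; have := hz3 u; have := hy2 v; have := hy3 v.
  have pos B k : 0 <= B -> 0 <= B * (1 / 4) ^+ k.
    by move=> ?; rewrite mulr_ge0 // exprn_ge0 ?divr_ge0.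
  rewrite /even_part /odd_part; case: ifP => _; case: ifP => _;
    rewrite ?(mul0r, mulr0) ?subr0 ?sub0r ?nrmN ?nrm0 => *;
    first [by apply: nrmM_le | by apply: mulr_ge0; apply: pos].
pose h (k : int * int) : int * int := (k.1 + k.2 + 1, k.1 - k.2).
have hF m k : tht (x + y) m * tht (x - y) k = G (h (m, k)).
  rewrite /G /h /even_part /odd_part /=.
  have [[j hj]|[j hj]] := even_or_odd (m - k).
    have -> : m + k + 1 = 2 * (j + k) + 1 by lia.
    rewrite hj odd_abs_odd odd_abs_even mul0r sub0r -[RHS]mulN1r -epi1 -!epiD.
    rewrite -[RHS](epiDz (j + k)); congr epi.
    have -> : m = 2 * j + k by lia.
    by rewrite !(intrD, intrB, intrM, rmorphN); field.
  have -> : m + k + 1 = 2 * (j + k + 1) by lia.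
  rewrite hj odd_abs_odd odd_abs_even mul0r subr0 -!epiD.
  rewrite -[RHS](epiDz (j + k + 1)); congr epi.
  have -> : m = 2 * j + 1 + k by lia.
  by rewrite !(intrD, intrB, intrM, rmorphN); field.
have injh : injective h by case=> [m k] [m' k'] [] ? ?; congr pair; lia.
pose b2 n := [seq (u, v) | u <- box n, v <- box n].
have ub n : uniq (b2 n) by apply: allpairs_uniq; rewrite ?uniq_box // => -[? ?] [].
have mb n u v : ((u, v) \in b2 n) = (absz u <= n)%N && (absz v <= n)%N.
  apply/allpairsP/andP => [[[u' v']] /= []|[h1 h2]].
    by rewrite !mem_box => ? ? [-> ->].
  by exists (u, v); rewrite !mem_box.
have cAB : cvgC (fun n => bsum (even_part x) n * bsum (odd_part y) n -
    bsum (odd_part x) n * bsum (even_part y) n) (thA x * thB y - thB x * thA y).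
  exact: cvgCB (cvgCM (bsum_cvg B30 hz2) (bsum_cvg B20 hy3))
               (cvgCM (bsum_cvg B30 hz3) (bsum_cvg B20 hy2)).
apply: (cvgC_unique (cvgCM (th_cvg _) (th_cvg _))).
apply: (@cvgC_sqz _ _ _ _ (1 / 2) (B3 * B2 * 9 *+ 2) _ _ cAB); first lra.
move=> n.
have -> : bsum (tht (x + y)) n * bsum (tht (x - y)) n = \sum_(k <- map h (b2 n)) G k.
  rewrite big_map /bsum big_distrlr big_allpairs; apply: eq_bigr => m _.
  by apply: eq_bigr => k _; apply: hF.
have -> : bsum (even_part x) n * bsum (odd_part y) n -
    bsum (odd_part x) n * bsum (even_part y) n = \sum_(k <- b2 n) G k.
  rewrite /bsum !big_distrlr big_allpairs -sumrB; apply: eq_bigr => m _.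
  by rewrite -sumrB.
(* [G] vanishes on pairs of equal parity. A pair of opposite parity with [|u| + |v| < n] comes from
   [m = (u + v - 1) / 2] and [k = (u - v - 1) / 2], both in the box of radius [n]. *)
apply: sum_compare (tame_int2 R) hG _ _ _ _ _; rewrite ?mulr_ge0 ?map_inj_uniq //.
  case=> u v; rewrite /w2 /= => hw Guv.
  have par : odd (absz u) != odd (absz v).
    apply: contra_neq Guv; rewrite /G /even_part /odd_part /= => ->.
    by case: ifP => _; rewrite ?mul0r ?mulr0 ?subr0 ?oppr0.
  have [m [k [hu hv]]] : exists m k, u = m + k + 1 /\ v = m - k.
    move: par; have [[i ->]|[i ->]] := even_or_odd u;
      have [[j ->]|[j ->]] := even_or_odd v; rewrite ?odd_abs_odd ?odd_abs_even // => _.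
      by exists (i + j), (i - j - 1); lia.
    by exists (i + j), (i - j); lia.
  rewrite hu hv (map_f h (_ : (m, k) \in b2 n)) // mb; lia.
by case=> u v; rewrite /w2 /= => hw _; rewrite mb; lia.
Qed.

(** By [th_add] each product of two factors is a 2 x 2 minor of the vectors [(thA, thB)] at [x],
    [y], [u], [v]; this is the Plücker relation between the minors. *)
Lemma th_three x y u v :
  th (x + y) * th (x - y) * (th (u + v) * th (u - v)) =
  th (x + v) * th (x - v) * (th (u + y) * th (u - y)) -
  th (x + u) * th (x - u) * (th (v + y) * th (v - y)).
Proof. by rewrite !th_add; ring. Qed.

End Theta.

(** * Zeros of the theta function *)

Section ThetaZeros.
Variable R : realType.
Local Notation C := R[i].
Variable tau : C.
Hypothesis tau_gt0 : 0 < complex.Im tau.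
Implicit Types (x y : C) (m k : int).

Let p : C := epi (2 * tau).

Lemma nome_lt1 : nrm p < 1.
Proof.
rewrite /p; apply: epi_lt1; case: tau tau_gt0 => a b hb; rewrite mul2C /=.
by rewrite mulr_gt0.
Qed.

Definition qfact n : C := \prod_(j < n) (1 - p ^+ j.+1).

(* 1 / (p; p)_k, extended by 0 to k < 0 *)
Definition qfactV k : C := if k is Posz n then (qfact n)^-1 else 0.

Lemma nome_fact_neq0 n : 1 - p ^+ n.+1 != 0.
Proof.
rewrite subr_eq0; apply/eqP => h; have := congr1 (@nrm R) h.
rewrite nrm1 nrmX => h1; have := nome_lt1; have h0 := nrm_ge0 p.
move=> hlt; have : nrm p ^+ n.+1 < 1 by rewrite exprn_ilt1.
by rewrite -h1 ltxx.
Qed.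

Lemma qfactS n : qfact n.+1 = qfact n * (1 - p ^+ n.+1).
Proof. by rewrite /qfact big_ord_recr. Qed.

Lemma qfact_neq0 n : qfact n != 0.
Proof. by apply/prodf_neq0 => i _; apply: nome_fact_neq0. Qed.

(** Extension by 0 makes the recursion valid for all integers: at [k = 0] the factor is
    [1 - p^0]. *)
Lemma qfactV_rec k : qfactV (k - 1) = (1 - epi (2 * k%:~R * tau)) * qfactV k.
Proof.
case: k => [[|n]|n].
- by rewrite mulr0 mul0r epi0 subrr mul0r.
- have -> : Posz n.+1 - 1 = Posz n by lia.
  have -> : 2 * (Posz n.+1)%:~R * tau = n.+1%:R * (2 * tau) by rewrite -pmulrn; ring.
  rewrite epiMn -/p /= qfactS invfM mulrCA divff ?mulr1 //.
  exact: nome_fact_neq0.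
- have -> : Negz n - 1 = Negz n.+1 by lia.
  by rewrite /= mulr0.
Qed.

(** The Gaussian binomial coefficient of [2n] over [n + m] in base [p], which vanishes for
    [|m| > n]. *)
Definition jtp_coef n m : C := qfact n.*2 * (qfactV (n%:Z - m) * qfactV (n%:Z + m)).

Lemma jtp_coef_supp n m : jtp_coef n m != 0 -> (absz m <= n)%N.
Proof.
apply: contraNleq => h; rewrite /jtp_coef.
have [h1|h1] : (n%:Z - m < 0) \/ (n%:Z + m < 0) by lia.
  by case: (n%:Z - m) h1 => // k _; rewrite /= mul0r mulr0.
by case: (n%:Z + m) h1 => // k _; rewrite /= !mulr0.
Qed.

Definition jtp_sum x n : C := bsum (fun m => tht tau x m * jtp_coef n m) n.

Lemma thtS x m : tht tau x (m + 1) = - (epi (2 * m%:~R * tau) * p * epi (2 * x)) * tht tau x m.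
Proof.
rewrite /tht -mulN1r -epi1 /p -!epiD -[RHS](epiDz 0); congr epi.
by rewrite intrD; field.
Qed.

(** Coefficientwise form of the multiplication by [(1 - p^n / Z) (1 - Z p^(n+1))] with
    [Z = epi (2 * x)]: two steps of the q-Pascal rule, from row [2n] to row [2n + 2]. *)
Lemma jtp_coef_rec x n m :
  tht tau x m * jtp_coef n.+1 m =
  (1 + p ^+ n.*2.+1) * (tht tau x m * jtp_coef n m)
  - epi (- (2 * x)) * p ^+ n * (tht tau x (m + 1) * jtp_coef n (m + 1))
  - epi (2 * x) * p ^+ n.+1 * (tht tau x (m - 1) * jtp_coef n (m - 1)).
Proof.
pose E := epi (2 * m%:~R * tau); have E0 : E != 0 by exact: epi_neq0.
pose z := epi (2 * x); have z0 : z != 0 by exact: epi_neq0.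
have p0 : p != 0 by exact: epi_neq0.
have eD (j : int) : epi (2 * (j + m)%:~R * tau) = epi (2 * j%:~R * tau) * E.
  by rewrite /E -epiD; congr epi; rewrite intrD; ring.
have eB (j : int) : epi (2 * (j - m)%:~R * tau) = epi (2 * j%:~R * tau) / E.
  by rewrite /E -epiB; congr epi; rewrite intrB; ring.
have en (j : nat) : epi (2 * (Posz j)%:~R * tau) = p ^+ j.
  by rewrite /p -epiMn; congr epi; rewrite -pmulrn; ring.
have tm : tht tau x (m - 1) = - (z^-1 * E^-1) * tht tau x m.
  have := thtS x (m - 1); rewrite subrK => ->; rewrite -/z.
  have -> : epi (2 * (m - 1)%:~R * tau) = E / p.
    by rewrite /E /p -epiB; congr epi; rewrite intrB; ring.
  by field; rewrite E0 z0 p0.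
rewrite tm thtS -/E -/z epiN -/z /jtp_coef.
set a := qfactV (n.+1%:Z - m); set b := qfactV (n.+1%:Z + m).
have a1 : qfactV (n%:Z - m) = (1 - p ^+ n.+1 / E) * a.
  by rewrite -en -eB -qfactV_rec; congr qfactV; lia.
have b1 : qfactV (n%:Z + m) = (1 - p ^+ n.+1 * E) * b.
  by rewrite -en -eD -qfactV_rec; congr qfactV; lia.
have -> : n%:Z - (m - 1) = n.+1%:Z - m by lia.
have -> : n%:Z + (m + 1) = n.+1%:Z + m by lia.
have -> : qfactV (n%:Z - (m + 1)) = (1 - p ^+ n / E) * qfactV (n%:Z - m).
  by rewrite -en -eB -qfactV_rec; congr qfactV; lia.
have -> : qfactV (n%:Z + (m - 1)) = (1 - p ^+ n * E) * qfactV (n%:Z + m).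
  by rewrite -en -eD -qfactV_rec; congr qfactV; lia.
rewrite -/a -/b a1 b1 doubleS !qfactS !exprS -addnn exprD.
move: (p ^+ n) (qfact _) (tht _ _ _) => X Y t; clear -E0 z0.
by field; rewrite E0 z0.
Qed.

Lemma jtp_sum_rec x n : jtp_sum x n.+1 =
  jtp_sum x n * ((1 - epi (- (2 * x)) * p ^+ n) * (1 - epi (2 * x) * p ^+ n.+1)).
Proof.
(* The coefficients vanish for [|m| > n], so a box of radius [n + 2] still contains their support
   after a shift by one. *)
have key (c : int) : absz c = 1%N ->
    \sum_(m <- box n.+2) tht tau x (m + c) * jtp_coef n (m + c) = jtp_sum x n.
  move=> hc; rewrite /jtp_sum /bsum.
  rewrite -(big_map (fun m => m + c) xpredT (fun m => tht tau x m * jtp_coef n m)).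
  apply: eq_sum_support; rewrite ?uniq_box //.
    by rewrite map_inj_uniq ?uniq_box // => i j /addIr.
  move=> m; rewrite mulf_eq0 negb_or => /andP[_ /jtp_coef_supp hm].
  rewrite mem_box hm; apply/mapP; exists (m - c); rewrite ?subrK //.
  by rewrite mem_box; lia.
have supp n1 n2 : (n1 <= n2)%N -> jtp_sum x n1 = \sum_(m <- box n2) tht tau x m * jtp_coef n1 m.
  move=> h12; apply: eq_sum_support; rewrite ?uniq_box // => m.
  rewrite mulf_eq0 negb_or => /andP[_ /jtp_coef_supp hm].
  by rewrite !mem_box hm (leq_trans hm).
rewrite (supp _ n.+2) //.
under eq_bigr do rewrite jtp_coef_rec.
rewrite !sumrB -!mulr_sumr (key 1) // (key (- 1)) // -supp; last by lia.
have e : epi (- (2 * x)) * epi (2 * x) = 1 by rewrite -epiD addNr epi0.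
rewrite !exprS -addnn exprD.
have -> : forall S z w X : C, z * w = 1 -> (1 + p * (X * X)) * S - z * X * S - w * (p * X) * S =
    S * ((1 - z * X) * (1 - w * (p * X))).
  move=> S z w X h; have -> : S * ((1 - z * X) * (1 - w * (p * X))) =
    (1 + (z * w) * p * (X * X)) * S - z * X * S - w * (p * X) * S by ring.
  by rewrite h mul1r.
  by [].
exact: e.
Qed.

Lemma qfact_cvg : exists2 P, P != 0 &
  exists D, forall n, nrm (qfact n - P) <= D * nrm p ^+ n.
Proof.
have [||l [_ h2 h3]] := @cvg_prod _ qfact (fun n => 1 - p ^+ n.+1) (nrm p) 1 (nrm_lt1 nome_lt1).
- exact: qfactS.
- move=> n; rewrite mul1r -nrmX addrAC subrr add0r nrmN exprS nrmM.
  by rewrite ler_piMl ?nrm_ge0 // ltW // nome_lt1.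
- exists l; last exact: h2.
  by apply: h3 => [n|]; rewrite ?nome_fact_neq0 // /qfact big_ord0 oner_eq0.
Qed.

Lemma qfactV_cvg : exists2 P, P != 0 &
  exists D, forall n : nat, nrm (qfactV n - P) <= D * nrm p ^+ n.
Proof.
have [||l [_ h2 h3]] := @cvg_prod _ (fun n : nat => qfactV n)
  (fun n => (1 - p ^+ n.+1)^-1) (nrm p) (1 - nrm p)^-1 (nrm_lt1 nome_lt1).
- by move=> n; rewrite /= qfactS invfM.
- move=> n; have h := nome_fact_neq0 n.
  have -> : (1 - p ^+ n.+1)^-1 - 1 = (1 - p ^+ n.+1)^-1 * p ^+ n.+1 by field.
  have hp := nome_lt1; have hp0 := nrm_ge0 p.
  have hx : nrm p ^+ n.+1 <= nrm p by rewrite exprS ler_piMr // exprn_ile1 // ltW.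
  apply: nrmM_le.
    rewrite nrmV lef_pV2 ?posrE ?subr_gt0 ?nrm_gt0 //.
    have := nrmD (1 - p ^+ n.+1) (p ^+ n.+1); rewrite subrK nrm1 nrmX; lra.
  by rewrite nrmX exprS ler_piMl ?exprn_ge0 // ltW.
- exists l; last exact: h2.
  apply: h3 => [n|]; first by rewrite invr_eq0 nome_fact_neq0.
  by rewrite /= /qfact big_ord0 invr1 oner_eq0.
Qed.

(** The indices [2n], [n - m] and [n + m] are all at least [n - |m|], hence the rate. Its loss in
    [|m|] is compensated later by the decay of the theta terms. *)
Lemma jtp_coef_rate : exists2 K, K != 0 & exists D,
  0 <= D /\ forall n m, (absz m <= n)%N -> nrm (jtp_coef n m - K) <= D * nrm p ^+ (n - absz m).
Proof.
have [P P0 [D1 h1]] := qfact_cvg; have [V V0 [D2 h2]] := qfactV_cvg.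
exists (P * (V * V)); first by rewrite !mulf_neq0.
have D10 : 0 <= D1 by have := h1 0%N; rewrite expr0 mulr1; apply: le_trans (nrm_ge0 _).
have D20 : 0 <= D2 by have := h2 0%N; rewrite expr0 mulr1; apply: le_trans (nrm_ge0 _).
have hp := nome_lt1; have hp0 := nrm_ge0 p.
have V20 := nrm_ge0 V; have P20 := nrm_ge0 P.
have ub (l : C) (u : nat -> C) D : 0 <= D -> (forall n, nrm (u n - l) <= D * nrm p ^+ n) ->
    forall n, nrm (u n) <= nrm l + D.
  move=> DD0 h n; have := nrmD l (u n - l); rewrite addrC subrK => h3.
  apply: le_trans h3 _; rewrite lerD2l; apply: le_trans (h n) _.
  by rewrite ler_piMr // exprn_ile1 // ltW.
have u2 := ub _ _ _ D20 h2.
have mono (D : R) i j : 0 <= D -> (i <= j)%N -> D * nrm p ^+ j <= D * nrm p ^+ i.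
  by move=> DD0 hij; rewrite ler_wpM2l // ler_wiXn2l // ltW.
have M0 : 0 <= nrm V + D2 by rewrite addr_ge0.
move: (nrm V + D2) M0 u2 => M M0 u2.
exists (D1 * (M * M) + nrm P * (D2 * M) + nrm P * (nrm V * D2)); split.
  by rewrite !addr_ge0 // !mulr_ge0.
move=> n m hm.
have [a ha] : exists a : nat, n%:Z - m = a by exists (absz (n%:Z - m)); clear -hm; lia.
have [b hb] : exists b : nat, n%:Z + m = b by exists (absz (n%:Z + m)); clear -hm; lia.
have i1 : (n - absz m <= n.*2)%N by clear; lia.
have i2 : (n - absz m <= a)%N by clear -ha hm; lia.
have i3 : (n - absz m <= b)%N by clear -hb hm; lia.
rewrite /jtp_coef ha hb.
set r := nrm p ^+ _; have r0 : 0 <= r by rewrite exprn_ge0.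
have k1 : nrm (qfact n.*2 - P) <= D1 * r by apply: le_trans (h1 _) _; apply: mono.
have k2 : nrm (qfactV a - V) <= D2 * r by apply: le_trans (h2 _) _; apply: mono.
have k3 : nrm (qfactV b - V) <= D2 * r by apply: le_trans (h2 _) _; apply: mono.
move: (qfact _) (qfactV a) (qfactV b) (u2 a) (u2 b) k1 k2 k3 => X Y Z uy uz k1 k2 k3.
have -> : X * (Y * Z) - P * (V * V) = (X - P) * (Y * Z) + P * ((Y - V) * Z) + P * (V * (Z - V)) by ring.
apply: le_trans (nrmD _ _) _; apply: le_trans (lerD (nrmD _ _) (lexx _)) _.
rewrite [leRHS]mulrDl [in leRHS]mulrDl; apply: lerD; first apply: lerD.
- by rewrite mulrAC; apply: nrmM_le => //; apply: nrmM_le.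
- by rewrite -!mulrA nrmM ler_wpM2l // (mulrC M) mulrA; apply: nrmM_le.
- by rewrite -!mulrA nrmM ler_wpM2l // nrmM ler_wpM2l.
Qed.

Lemma jtp_limit x : exists2 K, K != 0 & cvgC (jtp_sum x) (K * th tau x).
Proof.
have [K K0 [D [D0 hD]]] := jtp_coef_rate; exists K => //.
have [B B0 hB] := tht_dominated tau_gt0 x.
(* Of the bound [(1/4)^|m|] for a theta term, one factor [(1/2)^|m|] combines with [|p|^(n - |m|)]
   into at most [r^n]; the other is summed over [m]. *)
pose r := Num.max (nrm p) (1 / 2).
have r1 : nrm p <= r by rewrite le_max lexx.
have r2 : 1 / 2 <= r by rewrite le_max lexx orbT.
have hr : 0 <= r < 1.
  by rewrite (le_trans (nrm_ge0 p) r1) gt_max nome_lt1; lra.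
apply: (@cvgC_sqz _ _ _ _ r (B * D * 3) hr _ (cvgCZ K (th_cvg tau_gt0 x))) => n.
rewrite /jtp_sum /bsum mulr_sumr -sumrB; apply: le_trans (nrm_sum _ _ _) _.
apply: le_trans (_ : \sum_(m <- box n) B * D * r ^+ n * (1 / 2) ^+ absz m <= _).
  rewrite big_seq [leRHS]big_seq; apply: ler_sum => m; rewrite mem_box => hm.
  have -> : tht tau x m * jtp_coef n m - K * tht tau x m = tht tau x m * (jtp_coef n m - K) by ring.
  apply: le_trans (nrmM_le (hB m) (hD n m hm)) _.
  rewrite -(subnK hm) exprD addnK.
  have e4 : (1 / 4 : R) ^+ absz m = (1 / 2) ^+ absz m * (1 / 2) ^+ absz m.
    by rewrite -exprMn; congr (_ ^+ _); field.
  have i1 : (1 / 2) ^+ absz m <= r ^+ absz m.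
    by rewrite lerXn2r // nnegrE; [lra | case/andP: hr].
  have i2 : nrm p ^+ (n - absz m) <= r ^+ (n - absz m).
    by rewrite lerXn2r ?nnegrE ?nrm_ge0 //; case/andP: hr.
  have j1 : 0 <= (1 / 2 : R) ^+ absz m by rewrite exprn_ge0 ?divr_ge0.
  have j2 : 0 <= nrm p ^+ (n - absz m) by rewrite exprn_ge0 ?nrm_ge0.
  rewrite e4.
  have -> : B * ((1 / 2) ^+ absz m * (1 / 2) ^+ absz m) * (D * nrm p ^+ (n - absz m)) =
    (B * D * (1 / 2) ^+ absz m) * (nrm p ^+ (n - absz m) * (1 / 2) ^+ absz m) by ring.
  have -> : B * D * (r ^+ (n - absz m) * r ^+ absz m) * (1 / 2) ^+ absz m =
    (B * D * (1 / 2) ^+ absz m) * (r ^+ (n - absz m) * r ^+ absz m) by ring.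
  by rewrite ler_wpM2l ?mulr_ge0 // ler_pM.
rewrite -mulr_sumr [leRHS]mulrAC ler_wpM2l ?tame_int ?uniq_box //.
by rewrite !mulr_ge0 // exprn_ge0 //; case/andP: hr.
Qed.

(* By the Jacobi triple product, in the form of the limit of its finite version. *)
Lemma th_zero x : th tau x = 0 -> exists m k : int, x = m%:~R + k%:~R * tau.
Proof.
move=> hx; have [K K0 hK] := jtp_limit x; rewrite hx mulr0 in hK.
pose v n := (1 - epi (- (2 * x)) * p ^+ n) * (1 - epi (2 * x) * p ^+ n.+1).
pose z1 := nrm (epi (- (2 * x))); pose z2 := nrm (epi (2 * x)).
have hp := nome_lt1; have hp0 := nrm_ge0 p.
have [||l [hl _ hl0]] := @cvg_prod _ (jtp_sum x) v (nrm p) (z1 + z2 + z1 * z2) (nrm_lt1 nome_lt1).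
- exact: jtp_sum_rec.
- move=> n; rewrite /v.
  have -> : (1 - epi (- (2 * x)) * p ^+ n) * (1 - epi (2 * x) * p ^+ n.+1) - 1 =
    - (epi (- (2 * x)) * p ^+ n) - epi (2 * x) * p ^+ n.+1 +
     epi (- (2 * x)) * p ^+ n * (epi (2 * x) * p ^+ n.+1) by ring.
  apply: le_trans (nrmD _ _) _; apply: le_trans (lerD (nrmB _ _) (lexx _)) _.
  rewrite nrmN (nrmM (epi _ * _)) (nrmM (epi (- (2 * x)))) (nrmM (epi (2 * x))) -/z1 -/z2 !nrmX.
  have a1 : 0 <= z1 := nrm_ge0 _; have a2 : 0 <= z2 := nrm_ge0 _.
  have t0 : 0 <= nrm p ^+ n by rewrite exprn_ge0.
  have t1 : nrm p ^+ n.+1 <= nrm p ^+ n by rewrite ler_wiXn2l // ltW.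
  have t2 : nrm p ^+ n.+1 <= 1 by rewrite exprn_ile1 // ltW.
  have t3 : 0 <= nrm p ^+ n.+1 by rewrite exprn_ge0.
  have h1 : z2 * nrm p ^+ n.+1 <= z2 * nrm p ^+ n by rewrite ler_wpM2l.
  have h2 : (z1 * nrm p ^+ n) * (z2 * nrm p ^+ n.+1) <= z1 * z2 * nrm p ^+ n.
    by rewrite mulrACA [leLHS]mulrA ler_piMr // !mulr_ge0.
  by rewrite !mulrDl; apply: lerD => //; apply: lerD.
have l0 : l = 0 by apply: cvgC_unique hl hK.
(* If no factor vanishes, the infinite product is non-zero, since it starts from the single non-zero
   term [m = 0]. A vanishing factor places [x] on the lattice by [epi_eq1]. *)
have [hv|hv] := pselect (forall n, v n != 0).
  have : l != 0.
    apply: hl0 => //; rewrite /jtp_sum bsumE big_ord1 mulf_neq0 ?epi_neq0 //.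
    by rewrite /jtp_coef /qfactV /= !mulf_neq0 ?invr_eq0 ?qfact_neq0.
  by rewrite l0 eqxx.
have [n /negP] : exists n, ~ (v n != 0).
  by apply: contrapT => h; apply: hv => n; apply: contrapT => hn; apply: h; exists n.
rewrite negbK mulf_eq0 => /orP[] /eqP/eqP; rewrite subr_eq0 eq_sym => /eqP.
  rewrite /p -epiMn -epiD => h.
  have [|k hk] := @epi_eq1 R (- x + n%:R * tau).
    by rewrite -[RHS]h; congr epi; ring.
  by exists (- k), n%:Z; rewrite rmorphN /= -hk -pmulrn; ring.
rewrite /p -epiMn -epiD => h.
have [|k hk] := @epi_eq1 R (x + n.+1%:R * tau).
  by rewrite -[RHS]h; congr epi; ring.
by exists k, (- (n.+1)%:Z); rewrite rmorphN /= -hk -pmulrn; ring.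
Qed.

End ThetaZeros.

(** * Partial fractions for theta functions *)

Section ThetaLattice.
Variable R : realType.
Local Notation C := R[i].
Variable tau : C.
Hypothesis tau_gt0 : 0 < complex.Im tau.
Local Notation th := (th tau).
Implicit Types (x y a b c d : C).

Lemma thDn x n : th (x + n%:R) = (-1) ^+ n * th x.
Proof.
elim: n => [|n IH]; first by rewrite addr0 mul1r.
by rewrite -natr1 addrA thD1 // IH exprS mulN1r mulNr.
Qed.

Lemma thDntau x n :
  th (x + n%:R * tau) = (-1) ^+ n * epi (- (n%:R ^+ 2 * tau) - 2 * n%:R * x) * th x.
Proof.
elim: n => [|n IH]; first by rewrite mul0r addr0 expr0n mulr0 !mul0r oppr0 addr0 epi0 !mul1r.
rewrite -natr1 mulrDl mul1r addrA thDtau // IH (exprS (- 1)).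
have -> : - ((n%:R + 1) ^+ 2 * tau) - 2 * (n%:R + 1) * x =
  (- tau - 2 * (x + n%:R * tau)) + (- (n%:R ^+ 2 * tau) - 2 * n%:R * x) by ring.
by rewrite (epiD (- tau - _)); ring.
Qed.

Definition in_lattice x := exists m k : int, x = m%:~R + k%:~R * tau.

Lemma in_latticeB x y : in_lattice x -> in_lattice y -> in_lattice (x - y).
Proof.
by move=> [m [k ->]] [m' [k' ->]]; exists (m - m'), (k - k'); rewrite !intrB; ring.
Qed.

Lemma th_eq0P x : th x = 0 <-> in_lattice x.
Proof.
split; first exact: th_zero.
have nat_case y n k : th y = 0 -> th (y + n%:R + k%:R * tau) = 0.
  by move=> h; rewrite thDntau thDn h !mulr0.
have neg_case y n k : th y = 0 -> th (y - n%:R - k%:R * tau) = 0.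
  move=> h; have := nat_case (- y) n k; rewrite thN // h oppr0 => /(_ erefl) h'.
  by apply: oppr_inj; rewrite -thN // oppr0 -[RHS]h'; congr th; ring.
move=> [m [k ->]]; have h0 := th0 tau_gt0.
case: m => m; case: k => k; rewrite ?NegzE ?rmorphN /= -?pmulrn.
- by have := nat_case _ m k h0; rewrite add0r.
- have := nat_case _ m 0%N h0; rewrite mul0r addr0 add0r => h.
  by have := neg_case _ 0%N k.+1 h; rewrite subr0 mulNr.
- have := neg_case _ m.+1 0%N h0; rewrite mul0r subr0 sub0r => h.
  by have := nat_case _ 0%N k h; rewrite addr0.
- by have := neg_case _ m.+1 k.+1 h0; rewrite sub0r mulNr.
Qed.

Lemma lattice_re (m1 m2 k1 k2 : R) :
  m1%:C + k1%:C * tau = m2%:C + k2%:C * tau -> m1 = m2 /\ k1 = k2.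
Proof.
case: tau tau_gt0 => a b /= hb /eqP; rewrite eq_complex /= => /andP[/eqP h1 /eqP h2].
have k12 : k1 = k2 by apply: (mulIf (lt0r_neq0 hb)); move: h2; rewrite !mul0r !add0r !addr0.
by split => //; move: h1; rewrite k12 => /addIr.
Qed.

Lemma natrC (n : nat) : (n%:R : C) = (n%:R)%:C.
Proof. by rewrite rmorph_nat. Qed.
Lemma intrC (k : int) : (k%:~R : C) = (k%:~R)%:C.
Proof. by rewrite rmorph_int. Qed.

Lemma th_torsion_neq0 (n c1 c2 : nat) : (c1 < n)%N -> (c2 < n)%N ->
  (c1 != 0)%N || (c2 != 0)%N -> th ((c1%:R * tau + c2%:R) / n%:R) != 0.
Proof.
move=> h1 h2 h; apply/eqP => /th_eq0P[m [k e]].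
have n0 : (n%:R : C) != 0 by rewrite pnatr_eq0; lia.
have : (c2%:R)%:C + (c1%:R)%:C * tau = (m * n)%:~R%:C + (k * n)%:~R%:C * tau.
  rewrite -!natrC -!intrC !intrM -!pmulrn.
  by apply: (mulIf (invr_neq0 n0)); rewrite addrC e; field.
move=> /lattice_re[e2 e1].
have {}e2 : Posz c2 = m * n by apply/eqP; rewrite -(eqr_int R) -e2 pmulrn.
have {}e1 : Posz c1 = k * n by apply/eqP; rewrite -(eqr_int R) -e1 pmulrn.
move: h; rewrite -!lt0n => h.
have aux (j : nat) (i : int) : (j < n)%N -> Posz j = i * n -> j = 0%N.
  move=> hj e3; have : i = 0 by nia.
  by move=> i0; move: e3; rewrite i0 mul0r => -[].
by move: h; rewrite (aux _ _ h1 e1) (aux _ _ h2 e2).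
Qed.

(** Up to the factor th'(0), the sum of the residues at [xs] of the quotient with zeros [ys] and
    poles [xs], an elliptic function when both lists have the same length and the same sum. *)
Definition pf_sum (xs ys : seq C) :=
  \sum_(a <- xs) (\prod_(b <- ys) th (a - b)) / \prod_(b <- xs | b != a) th (a - b).

Lemma pf_sum_perm xs xs' ys : perm_eq xs xs' -> pf_sum xs ys = pf_sum xs' ys.
Proof.
move=> h; rewrite /pf_sum (perm_big _ h); apply: eq_bigr => a _.
by congr (_ / _); apply: perm_big.
Qed.

Lemma pf_sum_cancel a xs ys : a \notin xs -> {in xs, forall b, th (b - a) != 0} ->
  pf_sum (a :: xs) (a :: ys) = pf_sum xs ys.
Proof.
move=> ha h; rewrite /pf_sum big_cons big_cons subrr th0 // !mul0r add0r.
rewrite big_seq [RHS]big_seq; apply: eq_bigr => b hb; rewrite !big_cons.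
have ab : a != b by apply: contraNneq ha => ->.
rewrite ab invfM mulrACA -[RHS]mul1r; congr (_ * _).
by rewrite divff // h.
Qed.

(** For fixed [c + d], the functions [th (x - c) * th (x - d)] of [x] lie in a two-dimensional
    space. The identity expands one of them in two members that vanish at [b] and at [a]; centred at
    [(c + d) / 2] it is [th_three]. *)
Lemma th_interpolate x a b c d :
  th (a - b) * th (a + b - (c + d)) * (th (x - c) * th (x - d)) =
  th (a - c) * th (a - d) * (th (x - b) * th (x - (c + d - b))) -
  th (b - c) * th (b - d) * (th (x - a) * th (x - (c + d - a))).
Proof.
pose s := (c + d) / 2; pose t := (c - d) / 2.
have := th_three tau_gt0 (x - s) t (a - s) (b - s).
rewrite (_ : x - s + t = x - d); last by rewrite /s /t; field.
rewrite (_ : x - s - t = x - c); last by rewrite /s /t; field.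
rewrite (_ : a - s + t = a - d); last by rewrite /s /t; field.
rewrite (_ : a - s - t = a - c); last by rewrite /s /t; field.
rewrite (_ : b - s + t = b - d); last by rewrite /s /t; field.
rewrite (_ : b - s - t = b - c); last by rewrite /s /t; field.
rewrite (_ : x - s + (b - s) = x - (c + d - b)); last by rewrite /s; field.
rewrite (_ : x - s - (b - s) = x - b); last by rewrite /s; field.
rewrite (_ : x - s + (a - s) = x - (c + d - a)); last by rewrite /s; field.
rewrite (_ : x - s - (a - s) = x - a); last by rewrite /s; field.
rewrite (_ : a - s + (b - s) = a + b - (c + d)); last by rewrite /s; field.
rewrite (_ : a - s - (b - s) = a - b); last by rewrite /s; field.
by move=> h; rewrite mulrC (mulrC (th (a - b))) (mulrC (th (x - c))) h; ring.
Qed.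

(* Partial fractions for theta functions: three-term interpolation of
   th(x - c) th(x - d) at two of the points reduces the number of points. *)
Lemma pf_sum0 xs ys : uniq xs -> {in xs &, forall a b, a != b -> th (a - b) != 0} ->
  size xs = size ys -> xs != [::] -> \sum_(a <- xs) a = \sum_(b <- ys) b ->
  pf_sum xs ys = 0.
Proof.
have [n] := ubnP (size xs); elim: n xs ys => // n IH [//|a [|b xs]] [|c [|d ys]] //=.
  move=> _ _ _ _ _; rewrite !big_seq1 => ->.
  by rewrite /pf_sum !big_seq1 subrr th0 ?mul0r.
rewrite !ltnS => hsz.
(* Interpolation at [a'] and [b'] replaces the zeros [c], [d]. It can be solved when
   [th (a' + b' - (c + d))] is non-zero, so the two points have to be chosen. *)
have step a' b' xs' : perm_eq (a :: b :: xs) (a' :: b' :: xs') -> uniq (a :: b :: xs) ->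
    {in a :: b :: xs &, forall a b, a != b -> th (a - b) != 0} ->
    size (a :: b :: xs) = size (c :: d :: ys) ->
    \sum_(a <- a :: b :: xs) a = \sum_(b <- c :: d :: ys) b ->
    th (a' + b' - (c + d)) != 0 -> pf_sum (a :: b :: xs) (c :: d :: ys) = 0.
  move=> hp u h hs hsum hD; rewrite (pf_sum_perm _ hp).
  have u' : uniq (a' :: b' :: xs') by rewrite -(perm_uniq hp).
  have {}h : {in a' :: b' :: xs' &, forall a b, a != b -> th (a - b) != 0}.
    by move=> i j hi hj; apply: h; rewrite (perm_mem hp).
  have hs' : size xs' = size ys.
    by move: hs; rewrite (perm_size hp) /= => -[].
  have hsz' : ((size xs').+1 < n)%N.
    by rewrite hs'; move: hs => /= [<-].
  have {}hsum : a' + (b' + \sum_(x <- xs') x) = c + (d + \sum_(y <- ys) y).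
    by move: hsum; rewrite (perm_big _ hp) !big_cons.
  have /and3P[ha hb ux] := u'.
  have ab : a' != b' by apply: contraNneq ha => ->; rewrite mem_head.
  have Dab : th (a' - b') != 0 by apply: h; rewrite ?inE ?eqxx ?orbT.
  (* The new zero [a'] cancels the pole [a']. Its partner [c + d - a'] preserves the sum of the
     zeros, so the induction hypothesis applies with one point fewer. *)
  have r1 : pf_sum (a' :: b' :: xs') (a' :: c + d - a' :: ys) = 0.
    rewrite pf_sum_cancel //.
      apply: IH => //=; try by rewrite hs'.
      - exact/andP.
      - by move=> i j hi hj; apply: h; rewrite inE ?hi ?hj orbT.
      - rewrite !big_cons; apply: (addrI a'); rewrite hsum; ring.
    by move=> i hi; apply: h; rewrite ?inE ?eqxx //; [rewrite -in_cons hi orbT | apply: contraNneq ha => <-].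
  have r2 : pf_sum (a' :: b' :: xs') (b' :: c + d - b' :: ys) = 0.
    have hp2 : perm_eq (a' :: b' :: xs') (b' :: a' :: xs') by rewrite (perm_catCA [:: a'] [:: b'] xs').
    have hb' : b' \notin a' :: xs' by rewrite inE negb_or eq_sym ab.
    rewrite (pf_sum_perm _ hp2) pf_sum_cancel //.
      apply: IH => //=; try by rewrite hs'.
      - by apply/andP; split => //; apply: contra ha => ha'; rewrite inE ha' orbT.
      - by move=> i j hi hj; apply: h; rewrite (perm_mem hp2) inE ?hi ?hj orbT.
      - rewrite !big_cons; apply: (addrI b'); rewrite addrCA hsum; ring.
    move=> i hi; apply: h; rewrite ?inE ?eqxx ?orbT //.
      by move: hi; rewrite !inE => /orP[->|->]; rewrite ?orbT.
    by apply: contraNneq hb' => <-.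
  apply: (mulfI Dab); apply: (mulfI hD).
  have -> : th (a' + b' - (c + d)) * (th (a' - b') * pf_sum (a' :: b' :: xs') (c :: d :: ys)) =
     th (a' - c) * th (a' - d) * pf_sum (a' :: b' :: xs') (b' :: c + d - b' :: ys) -
     th (b' - c) * th (b' - d) * pf_sum (a' :: b' :: xs') (a' :: c + d - a' :: ys).
    rewrite /pf_sum !mulr_sumr -sumrB; apply: eq_bigr => x _.
    rewrite ![\prod_(b <- _ :: _ :: ys) _]big_cons ![\prod_(b <- _ :: ys) _]big_cons.
    have := th_interpolate x a' b' c d.
    move: (\prod_(_ <- _) _) (\prod_(_ <- _ | _) _)^-1 => p1 p2 hx.
    rewrite (_ : _ * (_ * _) = (th (a' - b') * th (a' + b' - (c + d)) * (th (x - c) * th (x - d))) * (p1 * p2)).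
      by rewrite hx; ring.
    by ring.
  by rewrite r1 r2 !mulr0 subrr.
move=> u h hs _ hsum.
(* For two points the sum condition is [a + b = c + d]: interpolation is impossible, but the two
   terms cancel because [th] is odd. *)
case: xs ys hsz step u h hs hsum => [|e xs] [|f ys] //= hsz step u h hs hsum.
  have e1 : b - c = - (a - d).
    by move: hsum; rewrite !big_cons !big_nil !addr0 => hs2; apply: (addrI a); rewrite addrA hs2; ring.
  have e2 : b - d = - (a - c).
    by move: hsum; rewrite !big_cons !big_nil !addr0 => hs2; apply: (addrI a); rewrite addrA hs2; ring.
  have ab : a != b by move: u; rewrite inE andbT.
  rewrite /pf_sum !big_cons !big_nil eqxx ab (eq_sym b) ab eqxx /= !addr0 !mulr1.
  have -> : b - a = - (a - b) by ring.
  rewrite e1 e2 !thN //; field.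
  by apply: h; rewrite ?inE ?eqxx ?orbT.
(* From three points on, if neither the pair [a], [b] nor the pair [a], [e] could be used, [b - e]
   would be a lattice point, against the separation of the points. *)
have [/eqP z1|nz] := boolP (th (a + b - (c + d)) == 0); last exact: (step a b (e :: xs)).
apply: (step a e (b :: xs)) => //.
  by rewrite perm_cons (perm_catCA [:: b] [:: e] xs).
apply/eqP => z2.
have be : th (b - e) != 0.
  apply: h; rewrite ?inE ?eqxx ?orbT //.
  by case/and3P: u => _; rewrite inE negb_or => /andP[].
move/eqP: be; apply; apply/th_eq0P.
have -> : b - e = (a + b - (c + d)) - (a + e - (c + d)) by ring.
by apply: in_latticeB; apply/th_eq0P.
Qed.

End ThetaLattice.

(** * Elliptic functions summed over torsion points *)

Section EllipticSums.
Variable R : realType.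
Local Notation C := R[i].
Variable tau : C.
Hypothesis tau_gt0 : 0 < complex.Im tau.
Local Notation th := (th tau).
Implicit Types (x y xi : C).

(** Products over [n + 1] consecutive integers ending at [k]. Moving this window up by one trades
    its lowest element for the translate by the antiperiod, at the cost of a sign. [P] will serve to
    omit 0. *)
Lemma cyclic_prod (n k : nat) (P : pred int) (f : int -> C) :
  P (k.+1%:Z) -> P (k.+1%:Z - n.+1%:Z) -> f k.+1%:Z = - f (k.+1%:Z - n.+1%:Z) ->
  \prod_(i <- [seq k.+1%:Z - j%:Z | j <- iota 0 n.+1] | P i) f i =
  - \prod_(i <- [seq k%:Z - j%:Z | j <- iota 0 n.+1] | P i) f i.
Proof.
move=> h1 h2 hf.
have -> : [seq k.+1%:Z - j%:Z | j <- iota 0 n.+1] =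
    k.+1%:Z :: [seq k%:Z - j%:Z | j <- iota 0 n].
  rewrite /= subr0 -[1%N]addn0 iotaDl -map_comp; congr (_ :: _).
  by apply: eq_map => j /=; lia.
have -> : [seq k%:Z - j%:Z | j <- iota 0 n.+1] =
    rcons [seq k%:Z - j%:Z | j <- iota 0 n] (k.+1%:Z - n.+1%:Z).
  rewrite -addn1 iotaD add0n map_cat /= cats1; congr rcons; lia.
by rewrite big_cons big_rcons /= h1 h2 hf mulNr mulrC.
Qed.

(** This is [pf_sum0] at the points [x + k / N]: by antiperiodicity of [th], all factors other than
    the displayed quotient combine into a non-zero constant independent of [k]. *)
Lemma th_divn_sum0 (n : nat) x : (forall k : nat, th (x + k%:R / n.+1%:R) != 0) ->
  \sum_(k < n.+1) th (x + k%:R / n.+1%:R - n.+1%:R * x) / th (x + k%:R / n.+1%:R) = 0.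
Proof.
move=> hx; set N := n.+1; have N0 : (N%:R : C) != 0 by rewrite pnatr_eq0.
pose pt (k : nat) : C := x + k%:R / N%:R.
pose L (k : nat) := [seq k%:Z - j%:Z | j <- iota 0 N].
pose f (i : int) := th (x + i%:~R / N%:R).
pose g (i : int) := th (i%:~R / N%:R).
have anti (y : C) (i : int) : th (y + i%:~R / N%:R) = - th (y + (i - N%:Z)%:~R / N%:R).
  rewrite -thD1 //; congr th; rewrite intrB -pmulrn; by field.
have gN i : g i = - g (i - N%:Z) by have := anti 0 i; rewrite !add0r.
have g0 (i : int) : i != 0 -> (absz i < N)%N -> g i != 0.
  move=> i0 hi; have key (j : nat) : (0 < j < N)%N -> th (j%:R / N%:R) != 0.
    move=> /andP[j0 jN]; have := @th_torsion_neq0 R tau tau_gt0 N 0 j.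
    by rewrite mul0r add0r; apply => //; lia.
  rewrite /g; case: i i0 hi => i i0 hi.
    by rewrite -pmulrn key //; lia.
  by rewrite NegzE rmorphN /= mulNr thN // oppr_eq0 -pmulrn key //; lia.
have fk k : \prod_(i <- L k) f i = (-1) ^+ k * \prod_(i <- L 0%N) f i.
  elim: k => [|k IH]; first by rewrite mul1r.
  by rewrite /L cyclic_prod ?IH ?exprS ?mulN1r ?mulNr //; apply: anti.
have gk k : (k < N)%N ->
    \prod_(i <- L k | i != 0) g i = (-1) ^+ k * \prod_(i <- L 0%N | i != 0) g i.
  elim: k => [|k IH] hk; first by rewrite mul1r.
  rewrite /L cyclic_prod //; first by rewrite IH ?(ltnW hk) // exprS mulN1r mulNr.
  - by lia.
have f00 : \prod_(i <- L 0%N) f i != 0.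
  rewrite prodf_seq_neq0; apply/allP => i /mapP[j]; rewrite mem_iota => /andP[_ hj] ->.
  have [->|j0] := eqVneq j 0%N; first by have := hx 0%N.
  rewrite /f; have := anti x (N - j)%:Z.
  have -> : (N - j)%:Z - N%:Z = 0%:Z - j%:Z by lia.
  by move=> h; have := hx (N - j)%N; rewrite pmulrn h oppr_eq0.
have g00 : \prod_(i <- L 0%N | i != 0) g i != 0.
  rewrite prodf_seq_neq0; apply/allP => i /mapP[j]; rewrite mem_iota => /andP[_ hj] ->.
  by apply/implyP => h; apply: g0 => //; lia.
have injpt : injective pt.
  move=> i j /addrI/(mulIf (invr_neq0 N0)) /eqP.
  by rewrite eqr_nat => /eqP.
have dpt i j : pt i - pt j = (i%:Z - j%:Z)%:~R / N%:R.
  by rewrite /pt intrB -!pmulrn; field.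
pose xs := [seq pt k | k <- iota 0 N].
(* Zeros at all [j / N] with [0 <= j < N] would give a full window product. Replacing [j = 0] by
   [N x] leaves the quotient [th (pt k - N x) / th (pt k)] and makes the sums of zeros and poles
   agree. *)
pose ys := N%:R * x :: [seq j%:R / N%:R | j <- iota 1 n].
have xsP (a : C) : a \in xs -> exists2 i, (i < N)%N & a = pt i.
  by case/mapP=> i; rewrite mem_iota => /andP[_ hi] ->; exists i.
have h : pf_sum tau xs ys = 0.
  apply: pf_sum0 => //.
  - by rewrite map_inj_uniq ?iota_uniq.
  - move=> a b /xsP[i hi ->] /xsP[j hj ->] hij.
    rewrite dpt; apply: g0; last by lia.
    by apply: contra hij => /eqP e; apply/eqP; congr pt; lia.
  - by rewrite /= !size_map !size_iota.
  - have -> : \sum_(b <- ys) b = N%:R * x + \sum_(j <- iota 1 n) j%:R / N%:R.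
      by rewrite /ys big_cons big_map.
    rewrite /xs big_map big_split; congr (_ + _).
      by rewrite big_const_seq count_predT size_iota iter_addr addr0 mulr_natl.
    by rewrite -[iota 0 N]/(0%N :: iota 1 n) big_cons /= mul0r add0r.
have pk k : (k < N)%N -> (\prod_(b <- ys) th (pt k - b)) / \prod_(b <- xs | b != pt k) th (pt k - b)
   = (\prod_(i <- L 0%N) f i / \prod_(i <- L 0%N | i != 0) g i) *
     (th (pt k - N%:R * x) / th (pt k)).
  move=> hk.
  have -> : \prod_(b <- xs | b != pt k) th (pt k - b) = \prod_(i <- L k | i != 0) g i.
    rewrite /xs /L !big_map; apply: eq_big => j; last by rewrite dpt.
    by rewrite (inj_eq injpt) subr_eq0 eqz_nat eq_sym.
  have -> : \prod_(b <- ys) th (pt k - b) =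
      th (pt k - N%:R * x) / th (pt k) * \prod_(i <- L k) f i.
    rewrite /ys /L big_cons /N /= !big_cons !big_map -/N mulrA.
    have -> : f (k%:Z - 0%:Z) = th (pt k) by rewrite /f subr0 /pt pmulrn.
    rewrite divfK ?hx //; congr (_ * _); apply: eq_bigr => j _.
    by rewrite /f /pt intrB -!pmulrn; congr th; field.
  rewrite fk gk //; have s0 : (-1) ^+ k != 0 :> C by rewrite expf_neq0 // oppr_eq0 oner_eq0.
  by field; rewrite g00 s0 hx.
move: h; rewrite /pf_sum big_map -[iota 0 N]/(index_iota 0 N) big_mkord.
under eq_bigr => k _ do rewrite pk //.
rewrite -mulr_sumr => /eqP; rewrite !mulf_eq0 invr_eq0 (negbTE f00) (negbTE g00) /=.
by move/eqP.
Qed.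

Lemma periodic_sum (V : nmodType) (N : nat) (F : nat -> V) d :
  (forall k, F (k + N)%N = F k) -> \sum_(k < N) F (k + d)%N = \sum_(k < N) F k.
Proof.
move=> hF; elim: d => [|d IH]; first by apply: eq_bigr => k _; rewrite addn0.
case: N hF IH => [|N] hF IH; first by rewrite !big_ord0.
rewrite -IH big_ord_recr [RHS]big_ord_recl /= addrC; congr (_ + _).
  by rewrite addnS -addSn addnC hF add0n.
by apply: eq_bigr => i _; rewrite addnS.
Qed.

Definition elliptic (f : C -> C) := forall x, f (x + 1) = f x /\ f (x + tau) = f x.

Lemma elliptic_ratio a b c : a + b = c ->
  elliptic (fun x => th (x + a) * th (x + b) / (th (x + c) * th x)).
Proof.
move=> <- x; split.
  by rewrite !(addrAC x 1) !thD1 // !mulrNN.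
rewrite !(addrAC x tau) !thDtau //.
pose E (y : C) : C := - epi (- tau - 2 * (x + y)).
have E0 y : E y != 0 by rewrite oppr_eq0 epi_neq0.
have hE : E a * E b = E (a + b) * E 0.
  by rewrite /E !mulrNN -!epiD; congr epi; ring.
have -> : - epi (- tau - 2 * x) = E 0 by rewrite /E addr0.
rewrite -!/(E _).
have -> : E a * th (x + a) * (E b * th (x + b)) = E a * E b * (th (x + a) * th (x + b)) by ring.
have -> : E (a + b) * th (x + (a + b)) * (E 0 * th x) = E (a + b) * E 0 * (th (x + (a + b)) * th x) by ring.
rewrite hE -mulf_div divff ?mul1r //; exact: mulf_neq0.
Qed.

Section Torsion.
Variables (n : nat) (zeta : C).
Local Notation N := n.+2.

(* The points at which the denominators of W are evaluated. *)
Definition xb (b1 b2 : nat) : C := (zeta + b1%:R * tau + b2%:R) / N%:R.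

Hypothesis xb_neq0 : forall b1 b2, th (xb b1 b2) != 0.

Let N0 : (N%:R : C) != 0. Proof. by rewrite pnatr_eq0. Qed.

(* Commutation character of I_(b1,b2) and I_(c1,c2). *)
Definition tw (c1 c2 b1 b2 : nat) : C :=
  epi (2 / N%:R * (b1%:R * c2%:R - b2%:R * c1%:R)).

Definition tsum c1 c2 (f : C -> C) :=
  \sum_(b1 < N) \sum_(b2 < N) tw c1 c2 b1 b2 * f (xb b1 b2).

Lemma periodic_sum2 (V : nmodType) (F : nat -> nat -> V) d1 d2 :
  (forall b1 b2, F (b1 + N)%N b2 = F b1 b2) -> (forall b1 b2, F b1 (b2 + N)%N = F b1 b2) ->
  \sum_(b1 < N) \sum_(b2 < N) F (b1 + d1)%N (b2 + d2)%N = \sum_(b1 < N) \sum_(b2 < N) F b1 b2.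
Proof.
move=> h1 h2; rewrite (periodic_sum (N := N) (F := fun b1 => \sum_(b2 < N) F b1 (b2 + d2)%N)).
  by apply: eq_bigr => b1 _; apply: periodic_sum.
by move=> k; apply: eq_bigr => b2 _; rewrite h1.
Qed.

Lemma twD c1 c2 b1 b2 d1 d2 :
  tw c1 c2 (b1 + d1) (b2 + d2) = tw c1 c2 b1 b2 * tw c1 c2 d1 d2.
Proof. by rewrite /tw -epiD !natrD; congr epi; ring. Qed.

Lemma twDN1 c1 c2 b1 b2 : tw c1 c2 (b1 + N) b2 = tw c1 c2 b1 b2.
Proof.
rewrite /tw -[RHS](epiDz c2%:Z) natrD -pmulrn; congr epi; field.
by rewrite -natrD pnatr_eq0.
Qed.

Lemma twDN2 c1 c2 b1 b2 : tw c1 c2 b1 (b2 + N) = tw c1 c2 b1 b2.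
Proof.
rewrite /tw -[RHS](epiDz (- c1%:Z)) natrD rmorphN /= -pmulrn; congr epi; field.
by rewrite -natrD pnatr_eq0.
Qed.

Lemma xbD b1 b2 d1 d2 : xb (b1 + d1) (b2 + d2) = xb b1 b2 + (d1%:R * tau + d2%:R) / N%:R.
Proof. by rewrite /xb !natrD; field; rewrite -natrD pnatr_eq0. Qed.

Lemma tsum_shift c1 c2 d1 d2 f : elliptic f ->
  tw c1 c2 d1 d2 * tsum c1 c2 (fun x => f (x + (d1%:R * tau + d2%:R) / N%:R)) = tsum c1 c2 f.
Proof.
move=> hf; rewrite /tsum -(@periodic_sum2 _ (fun b1 b2 => tw c1 c2 b1 b2 * f (xb b1 b2)) d1 d2).
- rewrite mulr_sumr; apply: eq_bigr => b1 _; rewrite mulr_sumr; apply: eq_bigr => b2 _.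
  by rewrite twD xbD mulrA (mulrC (tw _ _ d1 d2)).
- move=> b1 b2; rewrite twDN1 -[b2]addn0 xbD addn0 addr0 mulrC.
  by rewrite mulrAC divff // mul1r (hf _).2 mulrC.
- move=> b1 b2; rewrite twDN2 -[b1]addn0 xbD addn0 mul0r add0r divff //.
  by rewrite (hf _).1.
Qed.

(** The character is alternating, so [P] and its translate by the point of [c] have equal twisted
    sums. By [h], so do [Q] and its translate by the point of [d], whereas [tsum_shift] relates
    these by a factor different from 1. *)
Lemma tsum_eq0 c1 c2 d1 d2 (P Q : C -> C) (k1 k2 : C) :
  elliptic P -> elliptic Q -> k1 != 0 -> tw c1 c2 d1 d2 != 1 ->
  (forall b1 b2, let x := xb b1 b2 in
     k1 * (Q x - Q (x + (d1%:R * tau + d2%:R) / N%:R)) =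
     k2 * (P x - P (x + (c1%:R * tau + c2%:R) / N%:R))) ->
  tsum c1 c2 Q = 0.
Proof.
move=> eP eQ k10 htw h.
have tB (f g : C -> C) : tsum c1 c2 (fun x => f x - g x) = tsum c1 c2 f - tsum c1 c2 g.
  rewrite /tsum -sumrB; apply: eq_bigr => b1 _; rewrite -sumrB.
  by apply: eq_bigr => b2 _; rewrite mulrBr.
have tZ k (f : C -> C) : tsum c1 c2 (fun x => k * f x) = k * tsum c1 c2 f.
  rewrite /tsum mulr_sumr; apply: eq_bigr => b1 _; rewrite mulr_sumr.
  by apply: eq_bigr => b2 _; rewrite mulrCA.
have tcc : tw c1 c2 c1 c2 = 1.
  by rewrite /tw (mulrC c1%:R) subrr mulr0 epi0.
have := tsum_shift c1 c2 c1 c2 eP; rewrite tcc mul1r => hP.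
have hQ := tsum_shift c1 c2 d1 d2 eQ.
set S := tsum c1 c2 Q in hQ *.
set S' := tsum c1 c2 (fun x => Q (x + _)) in hQ.
have : k1 * (S - S') = 0.
  rewrite -tB -tZ.
  transitivity (tsum c1 c2 (fun x => k2 * (P x - P (x + (c1%:R * tau + c2%:R) / N%:R)))).
    by rewrite /tsum; apply: eq_bigr => b1 _; apply: eq_bigr => b2 _; rewrite h.
  by rewrite tZ tB hP subrr mulr0.
move/eqP; rewrite mulf_eq0 (negbTE k10) /= subr_eq0 => /eqP e.
move: hQ; rewrite -e => /eqP; rewrite -subr_eq0 -{2}[S]mul1r -mulrBl mulf_eq0.
by rewrite subr_eq0 (negbTE htw) /= => /eqP.
Qed.

Definition quot a c x := th (x + (c + a)) * th (x - a) / (th (x + c) * th x).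

Lemma quot_elliptic a c : elliptic (quot a c).
Proof. by apply: elliptic_ratio; rewrite addrK. Qed.

(** By [main], the difference on the left is [- th (2 * x + c + d) * th d * th (c + a) * th a] over
    a denominator symmetric in [c] and [d]. Exchanging [(a, c)] with [(y, d)] changes the constants
    only. *)
Lemma quot_exchange (a y c d x : C) :
  th x != 0 -> th (x + c) != 0 -> th (x + d) != 0 -> th (x + (c + d)) != 0 ->
  th y * th (d + y) * th c * (quot a c x - quot a c (x + d)) =
  th a * th (c + a) * th d * (quot y d x - quot y d (x + c)).
Proof.
move=> h1 h2 h3 h4; rewrite /quot.
have main (u v w : C) : th (x + (v + u)) * th (x - u) * (th (x + w + v) * th (x + w)) -
    th (x + w + (v + u)) * th (x + w - u) * (th (x + v) * th x) =
    - (th (2 * x + v + w) * th w * (th (v + u) * th u)).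
  have := th_three tau_gt0 (x + v / 2) (u + v / 2) (x + w + v / 2) (v / 2).
  rewrite (_ : x + v / 2 + (u + v / 2) = x + (v + u)); last by field.
  rewrite (_ : x + v / 2 - (u + v / 2) = x - u); last by field.
  rewrite (_ : x + w + v / 2 + v / 2 = x + w + v); last by field.
  rewrite (_ : x + w + v / 2 - v / 2 = x + w); last by field.
  rewrite (_ : x + v / 2 + v / 2 = x + v); last by field.
  rewrite (_ : x + v / 2 - v / 2 = x); last by field.
  rewrite (_ : x + w + v / 2 + (u + v / 2) = x + w + (v + u)); last by field.
  rewrite (_ : x + w + v / 2 - (u + v / 2) = x + w - u); last by field.
  rewrite (_ : x + v / 2 + (x + w + v / 2) = 2 * x + v + w); last by field.
  rewrite (_ : x + v / 2 - (x + w + v / 2) = - w); last by field.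
  rewrite (_ : v / 2 + (u + v / 2) = v + u); last by field.
  rewrite (_ : v / 2 - (u + v / 2) = - u); last by field.
  by move=> ->; rewrite !thN //; ring.
have m1 := main a c d; have m2 := main y d c.
have e1 : x + c + d = x + (c + d) by ring.
have e2 : x + d + c = x + (c + d) by ring.
have e3 : 2 * x + d + c = 2 * x + c + d by ring.
move: m1 m2; rewrite e1 e2 e3 => m1 m2.
have -> : th (x + (c + a)) * th (x - a) / (th (x + c) * th x) -
   th (x + d + (c + a)) * th (x + d - a) / (th (x + (c + d)) * th (x + d)) =
  (th (x + (c + a)) * th (x - a) * (th (x + (c + d)) * th (x + d)) -
    th (x + d + (c + a)) * th (x + d - a) * (th (x + c) * th x)) /
  (th (x + c) * th x * th (x + (c + d)) * th (x + d)).
  by field; rewrite h1 h2 h3 h4.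
have -> : th (x + (d + y)) * th (x - y) / (th (x + d) * th x) -
   th (x + c + (d + y)) * th (x + c - y) / (th (x + (c + d)) * th (x + c)) =
  (th (x + (d + y)) * th (x - y) * (th (x + (c + d)) * th (x + c)) -
    th (x + c + (d + y)) * th (x + c - y) * (th (x + d) * th x)) /
  (th (x + c) * th x * th (x + (c + d)) * th (x + d)).
  by field; rewrite h1 h2 h3 h4.
by rewrite m1 m2; ring.
Qed.

End Torsion.

End EllipticSums.

(** * Unitarity of the weights *)

Section Unitarity.
Variable R : realType.
Local Notation C := R[i].
Variable tau : C.
Hypothesis tau_gt0 : 0 < complex.Im tau.
Local Notation th := (th tau).
Variables (n : nat) (zeta : C).
Local Notation N := n.+2.
Local Notation xz := (xb tau n zeta).
Hypothesis xb_neq0 : forall b1 b2, th (xz b1 b2) != 0.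
Implicit Types (x y xi : C).

Let N0 : (N%:R : C) != 0. Proof. by rewrite pnatr_eq0. Qed.

(* N W_(b1,b2)(xi). *)
Definition wgt (b1 b2 : nat) xi : C :=
  epi (2 * (b1%:R / N%:R * xi)) * (th (xz b1 b2 + xi) / th (xz b1 b2)).

Lemma xbDN1 b1 b2 : xz (b1 + N) b2 = xz b1 b2 + tau.
Proof. by rewrite /xb natrD; field; rewrite -natrD pnatr_eq0. Qed.

Lemma xbDN2 b1 b2 : xz b1 (b2 + N) = xz b1 b2 + 1.
Proof. by rewrite /xb natrD; field; rewrite -natrD pnatr_eq0. Qed.

Lemma wgtDN1 b1 b2 xi : wgt (b1 + N) b2 xi = wgt b1 b2 xi.
Proof.
rewrite /wgt xbDN1.
rewrite (addrAC _ tau) !thDtau // natrD.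
have -> : epi (2 * ((b1%:R + N%:R) / N%:R * xi)) =
    epi (2 * (b1%:R / N%:R * xi)) * epi (2 * xi).
  by rewrite -epiD; congr epi; field; rewrite -natrD pnatr_eq0.
have -> : - tau - 2 * (xz b1 b2 + xi) = (- tau - 2 * xz b1 b2) - 2 * xi by ring.
rewrite (epiB _ (2 * xi)); have e0 := epi_neq0 (- tau - 2 * xz b1 b2).
have e1 := epi_neq0 (2 * xi); by field; rewrite e0 e1 xb_neq0.
Qed.

Lemma wgtDN2 b1 b2 xi : wgt b1 (b2 + N) xi = wgt b1 b2 xi.
Proof.
rewrite /wgt xbDN2.
rewrite (addrAC _ 1) !thD1 //; by field.
Qed.

Lemma wgt0 b1 b2 : wgt b1 b2 0 = 1.
Proof. by rewrite /wgt !mulr0 epi0 addr0 mul1r divff. Qed.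

(** The coefficient of I_c (x) I_c^{-1} in the product of the unnormalised R_12 at [xi] and R_21 at
    [- xi]. *)
Definition wgt_conv c1 c2 xi :=
  \sum_(b1 < N) \sum_(b2 < N)
    tw R n c1 c2 b1 b2 * (wgt (b1 + c1) (b2 + c2) xi * wgt b1 b2 (- xi)).

Lemma wgt_convE c1 c2 xi : wgt_conv c1 c2 xi =
  epi (2 * (c1%:R / N%:R * xi)) *
  tsum tau n zeta c1 c2 (quot tau xi ((c1%:R * tau + c2%:R) / N%:R)).
Proof.
rewrite /tsum mulr_sumr; apply: eq_bigr => b1 _; rewrite mulr_sumr.
apply: eq_bigr => b2 _; rewrite /wgt /quot xbD [RHS]mulrCA; congr (_ * _).
have -> : epi (2 * ((b1 + c1)%:R / N%:R * xi)) =
    epi (2 * (c1%:R / N%:R * xi)) / epi (2 * (b1%:R / N%:R * - xi)).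
  by rewrite -epiB natrD; congr epi; ring.
have := xb_neq0 (b1 + c1) (b2 + c2); rewrite xbD addrA.
have := xb_neq0 b1 b2; have := epi_neq0 (2 * (b1%:R / N%:R * - xi)).
by move=> h1 h2 h3; field; rewrite h1 h2 h3.
Qed.

Lemma epi_frac_neq1 c : (0 < c < N)%N -> epi (2 / N%:R * c%:R) != 1 :> C.
Proof.
move=> /andP[c0 cN]; apply/eqP => h; have [|k hk] := @epi_eq1 R (c%:R / N%:R).
  by rewrite -[RHS]h; congr epi; ring.
have : (c%:R : C) = (k * N)%:~R by rewrite intrM -pmulrn -hk divfK.
rewrite pmulrn => /eqP; rewrite eqr_int => /eqP hc.
case: k {hk} hc => k; rewrite ?NegzE ?mulNr -PoszM.
  by case: k => [|k] []; rewrite ?mulSn; lia.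
by rewrite mulSn; lia.
Qed.

Lemma wgt_conv_eq0 c1 c2 xi : (c1 < N)%N -> (c2 < N)%N -> (c1 != 0)%N || (c2 != 0)%N ->
  wgt_conv c1 c2 xi = 0.
Proof.
move=> h1 h2 h; rewrite wgt_convE.
(* The commutation character is non-degenerate: one of the unit vectors (1,0) and (0,1) pairs
   non-trivially with [(c1, c2)]. *)
have [d1 [d2 [htw hd d1N d2N]]] : exists d1 d2, [/\ tw R n c1 c2 d1 d2 != 1,
    (d1 != 0)%N || (d2 != 0)%N, (d1 < 2)%N & (d2 < 2)%N].
  have [c10|c10] := eqVneq c1 0%N.
    exists 1%N, 0%N; split=> //; rewrite /tw c10 mulr0 subr0 mul1r epi_frac_neq1 //.
    by move: h; rewrite c10 /=; lia.
  exists 0%N, 1%N; split=> //; rewrite /tw mul0r sub0r mul1r mulrN epiN.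
  by rewrite invr_eq1 epi_frac_neq1 //; lia.
set gam := (_ + _) / _; pose del : C := (d1%:R * tau + d2%:R) / N%:R.
(* The parameter [y] is free. With [- (del / 2)], both [th y] and [th (del + y)] are [th (del / 2)]
   up to sign, and this is non-zero because [del / 2] is a non-trivial 2N-torsion point. *)
pose y := - (del / 2).
have hy : th (del / 2) != 0.
  have := @th_torsion_neq0 R tau tau_gt0 (2 * N) d1 d2.
  rewrite (_ : _ / (2 * N)%:R = del / 2).
    by apply => //; lia.
  by rewrite natrM /del; field; rewrite -natrD pnatr_eq0.
rewrite (@tsum_eq0 _ _ _ _ c1 c2 d1 d2 (quot tau y del) _
  (th y * th (del + y) * th gam) (th xi * th (gam + xi) * th del)) ?mulr0 //.
- exact: quot_elliptic.
- exact: quot_elliptic.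
- have -> : del + y = del / 2 by rewrite /y; field.
  by rewrite /y thN // !mulf_neq0 // ?oppr_eq0 // th_torsion_neq0.
- move=> b1 b2; apply: quot_exchange => //.
  + by have := xb_neq0 (b1 + c1) (b2 + c2); rewrite xbD.
  + by have := xb_neq0 (b1 + d1) (b2 + d2); rewrite xbD.
  + by have := xb_neq0 (b1 + c1 + d1) (b2 + c2 + d2); rewrite !xbD addrA.
Qed.

(** For fixed [b] the points are [x + k / N] with [N x = zeta + b tau]. Removing [b tau] from the
    argument of [th] produces a character of [k] that cancels the one in the sum, and [th_divn_sum0]
    remains. *)
Lemma wgt_col_sum0 b : \sum_(k < N) epi (2 / N%:R * (b%:R * k%:R)) * wgt b k (- zeta) = 0.
Proof.
pose x := (zeta + b%:R * tau) / N%:R.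
have hx (k : nat) : xz b k = x + k%:R / N%:R by rewrite /xb /x; field; rewrite -natrD pnatr_eq0.
have hz : zeta = N%:R * x - b%:R * tau by rewrite /x; field; rewrite -natrD pnatr_eq0.
pose K := epi (2 * (b%:R / N%:R * - zeta)) * ((-1) ^+ b *
  epi (- (b%:R ^+ 2 * tau) - 2 * b%:R * (x - N%:R * x))).
have hk (k : 'I_N) : epi (2 / N%:R * (b%:R * k%:R)) * wgt b k (- zeta) =
    K * (th (x + k%:R / N%:R - N%:R * x) / th (x + k%:R / N%:R)).
  rewrite /wgt hx (_ : x + k%:R / N%:R - zeta = x + k%:R / N%:R - N%:R * x + b%:R * tau).
    rewrite thDntau // /K.
    have -> : epi (- (b%:R ^+ 2 * tau) - 2 * b%:R * (x + k%:R / N%:R - N%:R * x)) =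
      epi (- (b%:R ^+ 2 * tau) - 2 * b%:R * (x - N%:R * x)) / epi (2 / N%:R * (b%:R * k%:R)).
      by rewrite -epiB; congr epi; field; rewrite -natrD pnatr_eq0.
    have := epi_neq0 (2 / N%:R * (b%:R * k%:R)).
    have := xb_neq0 b k; rewrite hx => h1 h2.
    by field; rewrite h1 h2.
  by rewrite {1}hz; ring.
under eq_bigr do rewrite hk.
by rewrite -mulr_sumr th_divn_sum0 ?mulr0 // => k; rewrite -hx.
Qed.

(** The terms [wgt_conv 0 c] with [c] non-zero vanish and can be added at no cost; the total then
    factors through the column sums of [wgt_col_sum0]. *)
Lemma wgt_conv00_zeta : wgt_conv 0 0 (- zeta) = 0.
Proof.
transitivity (\sum_(c < N) wgt_conv 0 c (- zeta)).
  rewrite big_ord_recl [X in _ + X]big1 ?addr0 // => i _.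
  by rewrite wgt_conv_eq0 //= ?ltn_ord //; exact: (ltn_ord (lift ord0 i)).
rewrite /wgt_conv exchange_big; apply: big1 => b1 _; rewrite exchange_big.
apply: big1 => b2 _.
pose F (k : nat) := epi (2 / N%:R * (b1%:R * k%:R)) * wgt b1 k (- zeta).
transitivity (epi (- (2 / N%:R * (b1%:R * b2%:R))) * wgt b1 b2 (- - zeta) *
    \sum_(c < N) F (c + b2)%N).
  rewrite mulr_sumr; apply: eq_bigr => c _; rewrite /F addn0 (addnC c).
  rewrite (_ : epi (2 / N%:R * (b1%:R * (b2 + c)%:R)) =
      tw R n 0 c b1 b2 * epi (2 / N%:R * (b1%:R * b2%:R))).
    rewrite epiN; have := epi_neq0 (2 / N%:R * (b1%:R * b2%:R)) => h; field; exact: epi_neq0.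
  by rewrite /tw -epiD natrD; congr epi; ring.
rewrite periodic_sum ?wgt_col_sum0 ?mulr0 // => k; rewrite /F wgtDN2.
rewrite -[in RHS](epiDz b1) natrD -pmulrn; congr (epi _ * _); field.
by rewrite -natrD pnatr_eq0.
Qed.

Hypothesis zeta_neq0 : th zeta != 0.

Lemma wgt_conv00 xi : wgt_conv 0 0 xi =
  N%:R ^+ 2 * (th (zeta + xi) * th (zeta - xi)) / th zeta ^+ 2.
Proof.
pose X := \sum_(b1 < N) \sum_(b2 < N) thA tau (xz b1 b2) / th (xz b1 b2) ^+ 2.
pose Y := \sum_(b1 < N) \sum_(b2 < N) thB tau (xz b1 b2) / th (xz b1 b2) ^+ 2.
have conv x : wgt_conv 0 0 x = X * thB tau x - Y * thA tau x.
  rewrite /X /Y !mulr_suml -sumrB; apply: eq_bigr => b1 _.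
  rewrite !mulr_suml -sumrB; apply: eq_bigr => b2 _.
  rewrite /tw !mulr0 subr0 mulr0 epi0 mul1r !addn0 /wgt.
  have -> : epi (2 * (b1%:R / N%:R * - x)) = (epi (2 * (b1%:R / N%:R * x)))^-1.
    by rewrite -epiN; congr epi; ring.
  have h1 := epi_neq0 (2 * (b1%:R / N%:R * x)); have h2 := xb_neq0 b1 b2.
  transitivity (th (xz b1 b2 + x) * th (xz b1 b2 - x) / th (xz b1 b2) ^+ 2).
    by field; rewrite h1 h2.
  by rewrite th_add //; ring.
have c0 : wgt_conv 0 0 0 = N%:R ^+ 2.
  rewrite /wgt_conv; transitivity (\sum_(b1 < N) \sum_(b2 < N) (1 : C)).
    apply: eq_bigr => b1 _; apply: eq_bigr => b2 _.
    by rewrite /tw !mulr0 subr0 mulr0 epi0 oppr0 !wgt0 !mul1r.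
  by rewrite sumr_const card_ord sumr_const card_ord -mulrnA natrM expr2.
have c1 := wgt_conv00_zeta; rewrite conv in c1; rewrite conv in c0.
have tz : th zeta ^+ 2 = thA tau zeta * thB tau 0 - thB tau zeta * thA tau 0.
  by rewrite -th_add // addr0 subr0.
have tz' : th (- zeta) ^+ 2 = thA tau (- zeta) * thB tau 0 - thB tau (- zeta) * thA tau 0.
  by rewrite -th_add // addr0 subr0.
have tx : th (zeta + xi) * th (zeta - xi) =
    thA tau (- zeta) * thB tau xi - thB tau (- zeta) * thA tau xi.
  rewrite -th_add //; have -> : - zeta + xi = - (zeta - xi) by ring.
  have -> : - zeta - xi = - (zeta + xi) by ring.
  by rewrite !thN // mulrNN mulrC.
have z2 : th zeta ^+ 2 = th (- zeta) ^+ 2 by rewrite thN // sqrrN.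
have z0 : th zeta ^+ 2 != 0 by rewrite expf_neq0.
apply: (mulIf z0); rewrite divfK // conv tx -c0 z2 tz'.
move: c1 => /eqP; rewrite subr_eq0 => /eqP c1.
move: (thA tau (- zeta)) (thB tau (- zeta)) (thA tau 0) (thB tau 0) (thA tau xi) (thB tau xi) c1.
move=> a b a0 b0 a' b' c1.
apply/eqP; rewrite -subr_eq0; apply/eqP.
(* A Plücker relation again: the difference of the two sides is a multiple of the value at [- zeta],
   which is 0. *)
transitivity ((X * b - Y * a) * (b0 * a' - b' * a0)); first by ring.
by rewrite c1 subrr mul0r.
Qed.

End Unitarity.

(** * Belavin's R-matrix *)

Section TensorLegLemmas.
Variables (K : pzRingType) (N : nat).
Implicit Types (X Y : 'M[K]_(N * N)) (A B : 'M[K]_N).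

Lemma swap_legsK : involutive (@swap_legs N).
Proof.
by move=> k; case: (mxtens_indexP k) => i j; rewrite /swap_legs !mxtens_indexK.
Qed.

Lemma flipM X Y : flip (X *m Y) = flip X *m flip Y.
Proof.
apply/matrixP => i j; rewrite !mxE [LHS](reindex_inj (inv_inj swap_legsK)) /=.
by apply: eq_bigr => k _; rewrite !mxE.
Qed.

Lemma flipK : involutive (@flip K N).
Proof. by move=> X; apply/matrixP => i j; rewrite !mxE !swap_legsK. Qed.

Lemma flipZ a X : flip (a *: X) = a *: flip X.
Proof. by apply/matrixP => i j; rewrite !mxE. Qed.

Lemma flip_sum (I : Type) (s : seq I) (P : pred I) (F : I -> 'M[K]_(N * N)) :
  flip (\sum_(i <- s | P i) F i) = \sum_(i <- s | P i) flip (F i).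
Proof.
apply: (big_morph (@flip K N)) => [X Y|]; first by apply/matrixP => i j; rewrite !mxE.
by apply/matrixP => i j; rewrite !mxE.
Qed.

Lemma flip1 : flip (1%:M : 'M[K]_(N * N)) = 1%:M.
Proof. by apply/matrixP => i j; rewrite !mxE (inj_eq (inv_inj swap_legsK)). Qed.

Lemma flip_leg1 A : flip (leg1 A) = leg2 A.
Proof.
apply/matrixP => i j; rewrite !mxE !mxtens_indexK /= !mulr_natr mulr_natl.
by [].
Qed.

Lemma flip_leg2 A : flip (leg2 A) = leg1 A.
Proof. by rewrite -flip_leg1 flipK. Qed.

(** The entries need not commute: in each product one factor comes from the identity matrix. *)
Lemma leg1M A B : leg1 (A *m B) = leg1 A *m leg1 B.
Proof.
apply/matrixP => i j; rewrite [RHS]mxE.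
rewrite (reindex (@mxtens_index N N)) /=; last first.
  by exists (@mxtens_unindex N N) => k _; rewrite ?mxtens_indexK ?mxtens_unindexK.
transitivity (\sum_(k < N) \sum_(l < N)
    leg1 A i (mxtens_index (k, l)) * leg1 B (mxtens_index (k, l)) j); last first.
  by rewrite pair_bigA; apply: eq_bigr => -[].
rewrite [LHS]mxE [X in X * _]mxE mulr_suml; apply: eq_bigr => k _.
rewrite (bigD1 (mxtens_unindex i).2) //= big1 ?addr0 => [|l hl].
  by rewrite !mxE !mxtens_indexK /= eqxx mulr1 mulrA.
by rewrite !mxE !mxtens_indexK /= eq_sym (negbTE hl) mulr0 mul0r.
Qed.

Lemma leg2M A B : leg2 (A *m B) = leg2 A *m leg2 B.
Proof. by rewrite -!flip_leg1 leg1M flipM. Qed.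

Lemma leg1_1 : leg1 (1%:M : 'M[K]_N) = 1%:M.
Proof.
apply/matrixP => i j; rewrite !mxE -natrM mulnb; congr (nat_of_bool _)%:R.
rewrite -xpair_eqE -!surjective_pairing.
by rewrite (can_eq (@mxtens_unindexK N N)).
Qed.

Lemma leg2_1 : leg2 (1%:M : 'M[K]_N) = 1%:M.
Proof. by rewrite -flip_leg1 leg1_1 flip1. Qed.

End TensorLegLemmas.

Section Tensors.
Variables (K : comPzRingType) (N : nat).
Implicit Types (A B : 'M[K]_N).

Lemma flip_tens A B : flip (A *t B) = B *t A.
Proof. by apply/matrixP => i j; rewrite !mxE !mxtens_indexK mulrC. Qed.

Lemma tensZl (a : K) A B : (a *: A) *t B = a *: (A *t B).
Proof. by apply/matrixP => i j; rewrite !mxE mulrA. Qed.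

Lemma tensZr (a : K) A B : A *t (a *: B) = a *: (A *t B).
Proof. by apply/matrixP => i j; rewrite !mxE mulrCA. Qed.

End Tensors.

Section Belavin.
Variable R : realType.
Local Notation C := R[i].
Variables (n : nat).
Local Notation N := n.+2.

Let N0 : (N%:R : C) != 0. Proof. by rewrite pnatr_eq0. Qed.

Definition om : C := epi (2 / N%:R).
Local Notation g := (gmx R N).
Local Notation h := (hmx R N).
Local Notation I a b := (Imx R N a b).

Lemma omN : om ^+ N = 1.
Proof. by rewrite /om -epiMn (_ : N%:R * _ = 2) ?epi2 // mulrC divfK. Qed.

Lemma om_neq0 : om != 0. Proof. exact: epi_neq0. Qed.

Lemma omX k : om ^+ k = epi (2 / N%:R * k%:R).
Proof. by rewrite /om -epiMn mulrC. Qed.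

Lemma om_mod k : om ^+ (k %% N) = om ^+ k.
Proof. by rewrite {2}(divn_eq k N) exprD mulnC exprM omN expr1n mul1r. Qed.

Lemma gX k : g ^+ k = \matrix_(i, j) (om ^+ (i.+1 * k) *+ (i == j)).
Proof.
elim: k => [|k IH]; first by apply/matrixP => i j; rewrite !mxE muln0 expr0.
rewrite exprSr IH -mulmxE; apply/matrixP => i j; rewrite !mxE.
rewrite (bigD1 i) //= big1 ?addr0 => [|l hl].
  by rewrite !mxE eqxx mulr1n mulrnAr -exprD mulnS addnC.
by rewrite !mxE eq_sym (negbTE hl) mul0r.
Qed.

Lemma hX k : h ^+ k = \matrix_(i, j) ((i + k) %% N == j)%N%:R.
Proof.
elim: k => [|k IH].
  by apply/matrixP => i j; rewrite !mxE addn0 modn_small.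
rewrite exprSr IH -mulmxE; apply/matrixP => i j; rewrite !mxE.
have hl : ((i + k) %% N < N)%N by rewrite ltn_mod.
rewrite (bigD1 (Ordinal hl)) //= big1 ?addr0 => [|l hl'].
  by rewrite !mxE eqxx mul1r /= -addn1 modnDml addn1 addnS.
rewrite !mxE; case: eqP => [e|]; last by rewrite mul0r.
by move/eqP: hl'; case; apply: val_inj.
Qed.

Lemma gN : g ^+ N = 1.
Proof.
by rewrite gX; apply/matrixP => i j; rewrite !mxE mulnC exprM omN expr1n.
Qed.

Lemma hN : h ^+ N = 1.
Proof.
by rewrite hX; apply/matrixP => i j; rewrite !mxE modnDr modn_small.
Qed.

Lemma hg : h * g = om *: (g * h).
Proof.
rewrite -!mulmxE; apply/matrixP => i j; rewrite !mxE.
rewrite (bigD1 j) //= big1 ?addr0 => [|l hl]; last first.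
  by rewrite !mxE (negbTE hl) mulr0.
rewrite (bigD1 i) //= big1 ?addr0 => [|l hl]; last first.
  by rewrite !mxE eq_sym (negbTE hl) mul0r.
rewrite !mxE !eqxx -/om; case: eqP => [e|]; last by rewrite mul0r !mulr0.
by rewrite mul1r mulr1 -e exprS om_mod.
Qed.

Lemma unit_root_unit (k : nat) (x : 'M[C]_N) : x ^+ k.+1 = 1 -> x \is a GRing.unit.
Proof. by move=> e; rewrite -(unitrX_pos x (ltn0Sn k)) e unitr1. Qed.

Lemma gU : g \is a GRing.unit. Proof. exact: unit_root_unit gN. Qed.
Lemma hU : h \is a GRing.unit. Proof. exact: unit_root_unit hN. Qed.

Lemma hgX a b : h ^+ a * g ^+ b = om ^+ (a * b) *: (g ^+ b * h ^+ a).
Proof.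
have h1 b' : h * g ^+ b' = om ^+ b' *: (g ^+ b' * h).
  elim: b' => [|b' IH]; first by rewrite !expr0 mulr1 mul1r scale1r.
  rewrite (exprSr g) (exprSr om) mulrA IH -scalerAl -(mulrA _ h) hg.
  by rewrite -scalerAr scalerA (mulrA (g ^+ b')).
elim: a => [|a IH]; first by rewrite !expr0 mulr1 mul1r scale1r.
rewrite (exprS h) -(mulrA h) IH -scalerAr (mulrA h) h1 -scalerAl scalerA -exprD.
by rewrite mulSn addnC -(mulrA (g ^+ b) h).
Qed.

Lemma ImxE a b : I a b = g ^+ b * h ^+ a. Proof. by []. Qed.

Lemma ImxU a b : I a b \is a GRing.unit.
Proof. by rewrite ImxE unitrMl ?unitrX ?gU ?hU. Qed.

Lemma ImxDl b1 b2 c1 c2 :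
  I (b1 + c1) (b2 + c2) = om ^- (b2 * c1) *: (I c1 c2 * I b1 b2).
Proof.
rewrite !ImxE (addnC b1) (addnC b2) (exprD g) (exprD h).
have -> : g ^+ c2 * h ^+ c1 * (g ^+ b2 * h ^+ b1) = g ^+ c2 * (h ^+ c1 * g ^+ b2) * h ^+ b1.
  by rewrite !mulrA.
rewrite hgX -scalerAr -scalerAl scalerA (mulnC c1) mulVf ?scale1r ?expf_neq0 ?om_neq0 //.
by rewrite !mulrA.
Qed.

Lemma ImxDr b1 b2 c1 c2 :
  I (b1 + c1) (b2 + c2) = om ^- (b1 * c2) *: (I b1 b2 * I c1 c2).
Proof. by rewrite (addnC b1) (addnC b2) ImxDl mulnC. Qed.

Lemma Imx0 : I 0 0 = 1. Proof. by rewrite ImxE !expr0 mulr1. Qed.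

Lemma ImxDN1 a b : I (a + N) b = I a b.
Proof. by rewrite !ImxE (exprD h) hN mulr1. Qed.

Lemma ImxDN2 a b : I a (b + N) = I a b.
Proof. by rewrite !ImxE (exprD g) gN mulr1. Qed.

(** The two quotients are multiples of [I c1 c2] and of its inverse; their reordering phases
    multiply to the character [tw]. *)
Lemma Imx_conv b1 b2 c1 c2 :
  (I (b1 + c1) (b2 + c2) *m invmx (I b1 b2)) *t (invmx (I (b1 + c1) (b2 + c2)) *m I b1 b2) =
  tw R n c1 c2 b1 b2 *: (I c1 c2 *t invmx (I c1 c2)).
Proof.
have -> : I (b1 + c1) (b2 + c2) *m invmx (I b1 b2) = om ^- (b2 * c1) *: I c1 c2.
  by rewrite ImxDl -[invmx _]/(_^-1) mulmxE -scalerAl mulrK ?ImxU.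
have -> : invmx (I (b1 + c1) (b2 + c2)) *m I b1 b2 = om ^+ (b1 * c2) *: invmx (I c1 c2).
  rewrite -[invmx (I (b1 + c1) _)]/(_^-1) -[invmx (I c1 c2)]/(_^-1) mulmxE.
  apply: (mulrI (ImxU (b1 + c1) (b2 + c2))); rewrite mulrA mulrV ?ImxU // mul1r ImxDr.
  rewrite -scalerAr -scalerAl scalerA divff ?scale1r ?expf_neq0 ?om_neq0 //.
  by rewrite mulrK ?ImxU.
rewrite tensZl tensZr scalerA; congr (_ *: _).
rewrite !omX -epiN -epiD /tw; congr epi; rewrite !natrM; ring.
Qed.

(** [h * g] is what [amx] becomes when it is moved through the conjugation by g^{1/2} (see
    [a_gh]). *)
Lemma Imx_shift_conj a b :
  (h * g) * I a b = (om ^+ b * om ^- a) *: (I a b * (h * g)).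
Proof.
have hgh : g * h ^+ a = om ^- a *: (h ^+ a * g).
  by rewrite -[g]expr1 hgX muln1 scalerA mulVf ?scale1r ?expf_neq0 ?om_neq0.
have -> : (h * g) * I a b = h * g ^+ b * (g * h ^+ a).
  by rewrite ImxE -!mulrA; congr (_ * _); rewrite !mulrA -exprS exprSr.
rewrite hgh -[h]expr1 hgX mul1n -scalerAl -scalerAr scalerA expr1.
by congr (_ *: _); rewrite ImxE -!mulrA; congr (_ * _); rewrite !mulrA -exprS exprSr.
Qed.

Variables (tau zeta : C).
Hypothesis tau_gt0 : 0 < complex.Im tau.
Local Notation th := (th tau).
Hypothesis xb_neq0 : forall b1 b2, th (xb tau n zeta b1 b2) != 0.
Hypothesis zeta_neq0 : th zeta != 0.
Local Notation wz := (wgt tau n zeta).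

Definition belavin xi : 'M[C]_(N * N) :=
  \sum_(a1 < N) \sum_(a2 < N) wz a1 a2 xi *: (I a1 a2 *t invmx (I a1 a2)).

Lemma tens11 : (1 : 'M[C]_N) *t (1 : 'M[C]_N) = 1%:M.
Proof. exact: leg1_1. Qed.

(** The summands are periodic mod N, which allows the substitution a = b + c. The coefficient of I_c
    (x) I_c^{-1} is then [wgt_conv], and only c = 0 survives. *)
Lemma belavin_unitarity xi : belavin xi *m flip (belavin (- xi)) =
  (N%:R ^+ 2 * (th (zeta + xi) * th (zeta - xi)) / th zeta ^+ 2) *: 1%:M.
Proof.
have -> : flip (belavin (- xi)) =
    \sum_(b1 < N) \sum_(b2 < N) wz b1 b2 (- xi) *: (invmx (I b1 b2) *t I b1 b2).
  rewrite /belavin flip_sum; apply: eq_bigr => b1 _; rewrite flip_sum.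
  by apply: eq_bigr => b2 _; rewrite flipZ flip_tens.
pose F b1 b2 c1 c2 := (tw R n c1 c2 b1 b2 * (wz (b1 + c1) (b2 + c2) xi * wz b1 b2 (- xi))) *:
  (I c1 c2 *t invmx (I c1 c2)).
transitivity (\sum_(b1 < N) \sum_(b2 < N) \sum_(c1 < N) \sum_(c2 < N) F b1 b2 c1 c2).
  rewrite mulmx_sumr; apply: eq_bigr => b1 _; rewrite mulmx_sumr; apply: eq_bigr => b2 _.
  pose G a1 a2 := (wz a1 a2 xi * wz b1 b2 (- xi)) *:
     ((I a1 a2 *m invmx (I b1 b2)) *t (invmx (I a1 a2) *m I b1 b2)).
  transitivity (\sum_(a1 < N) \sum_(a2 < N) G a1 a2).
    rewrite /belavin mulmx_suml; apply: eq_bigr => a1 _; rewrite mulmx_suml.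
    apply: eq_bigr => a2 _; rewrite -scalemxAl -scalemxAr scalerA /G.
    by rewrite tensmx_mul.
  rewrite -(@periodic_sum2 n _ G b1 b2).
  - apply: eq_bigr => c1 _; apply: eq_bigr => c2 _.
    rewrite /G /F (addnC c1) (addnC c2) Imx_conv scalerA.
    by congr (_ *: _); ring.
  - by move=> a1 a2; rewrite /G (wgtDN1 tau_gt0 xb_neq0 a1 a2) (ImxDN1 a1 a2).
  - by move=> a1 a2; rewrite /G (wgtDN2 tau_gt0 xb_neq0 a1 a2) (ImxDN2 a1 a2).
transitivity (\sum_(c1 < N) \sum_(c2 < N) wgt_conv tau n zeta c1 c2 xi *: (I c1 c2 *t invmx (I c1 c2))).
  transitivity (\sum_(b1 < N) \sum_(c1 < N) \sum_(c2 < N) \sum_(b2 < N) F b1 b2 c1 c2).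
    apply: eq_bigr => b1 _; rewrite exchange_big; apply: eq_bigr => c1 _.
    by rewrite exchange_big.
  rewrite exchange_big; apply: eq_bigr => c1 _; rewrite exchange_big; apply: eq_bigr => c2 _.
  rewrite /wgt_conv scaler_suml; apply: eq_bigr => b1 _; rewrite scaler_suml.
  by apply: eq_bigr => b2 _.
pose H (c1 c2 : nat) := wgt_conv tau n zeta c1 c2 xi *: (I c1 c2 *t invmx (I c1 c2)).
have H0 c1 c2 : (c1 < N)%N -> (c2 < N)%N -> (c1 != 0)%N || (c2 != 0)%N -> H c1 c2 = 0.
  by move=> *; rewrite /H wgt_conv_eq0 ?scale0r.
transitivity (H 0%N 0%N).
  rewrite (bigD1 ord0) //= [X in _ + X]big1 ?addr0 => [|i hi].
    by rewrite (bigD1 ord0) //= big1 ?addr0 // => i hi; apply: H0.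
  by apply: big1 => j _; apply: H0 => //; apply/orP; left.
rewrite /H wgt_conv00 // Imx0 -[invmx _]/(_^-1) invr1.
by rewrite tens11.
Qed.

Lemma wgt_qp a b xi : wz a b (xi + 1 + tau) =
  om ^+ a * om ^- b * epi (- tau - 2 * xi - 2 * zeta / N%:R) * wz a b xi.
Proof.
rewrite /wgt !addrA thDtau // thD1 // !omX -epiN.
have -> : epi (2 * (a%:R / N%:R * (xi + 1 + tau))) =
   epi (2 / N%:R * a%:R) * epi (2 * (a%:R / N%:R * tau)) * epi (2 * (a%:R / N%:R * xi)).
  by rewrite -!epiD; congr epi; ring.
have -> : epi (- tau - 2 * (xb tau n zeta a b + xi + 1)) =
   epi (- (2 * (a%:R / N%:R * tau))) * epi (- (2 / N%:R * b%:R)) *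
   epi (- tau - 2 * xi - 2 * zeta / N%:R).
  rewrite -!epiD -[RHS](epiDz (-1)); congr epi.
  by rewrite rmorphN /= /xb; field; rewrite -natrD pnatr_eq0.
rewrite (epiN (2 * (a%:R / N%:R * tau))).
have h1 := epi_neq0 (2 * (a%:R / N%:R * tau)).
have h2 := xb_neq0 a b.
by field; rewrite h1 h2.
Qed.

(** The phase acquired by each weight is inverse to that of its matrix under conjugation by [h * g],
    so only a scalar common to all terms is left. *)
Lemma belavin_qp xi :
  leg1 (h * g) *m belavin (xi + 1 + tau) =
  epi (- tau - 2 * xi - 2 * zeta / N%:R) *: (belavin xi *m leg1 (h * g)).
Proof.
rewrite /belavin mulmx_suml mulmx_sumr scaler_sumr; apply: eq_bigr => a _.
rewrite mulmx_suml mulmx_sumr scaler_sumr; apply: eq_bigr => b _.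
rewrite -scalemxAr -scalemxAl /leg1 !tensmx_mul mul1mx mulmx1 scalerA wgt_qp.
rewrite !mulmxE Imx_shift_conj tensZl scalerA; congr (_ *: _).
have ha : om ^+ a != 0 by rewrite expf_neq0 ?om_neq0.
have hb : om ^+ b != 0 by rewrite expf_neq0 ?om_neq0.
by field; rewrite ha hb.
Qed.

End Belavin.

(** * Genericity and the quasi-periodicity of the R-matrix *)

Section GenericLemmas.
Variable R : realType.
Local Notation C := R[i].
Local Open Scope classical_set_scope.

Lemma countableU2 (A B : set C) : countable A -> countable B -> countable (A `|` B).
Proof.
move=> hA hB; have -> : A `|` B = \bigcup_(b in [set: bool]) (if b then A else B).
  apply/seteqP; split=> x; first by case=> h; [exists true | exists false].
  by case=> -[] _ h; [left | right].
by apply: bigcup_countable => [|[]] //; apply: countableP.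
Qed.

Lemma countable_image (f : C -> C) (A : set C) : countable A -> countable (f @` A).
Proof. by move=> hA; apply: sub_countable hA; apply: card_image_le. Qed.

Lemma generic1_and (P Q : C -> Prop) : generic1 P -> generic1 Q ->
  generic1 (fun x => P x /\ Q x).
Proof.
move=> [D cD hD] [E cE hE]; exists (D `|` E); first exact: countableU2.
by move=> x h; split; [apply: hD | apply: hE] => k; apply: h; [left | right].
Qed.

Lemma generic1_sub (P Q : C -> Prop) : (forall x, P x -> Q x) -> generic1 P -> generic1 Q.
Proof. by move=> h [D cD hD]; exists D => // x /hD/h. Qed.

Lemma generic1_comp (P : C -> Prop) (f g : C -> C) : cancel f g ->
  generic1 P -> generic1 (P \o f).
Proof.
move=> fg [D cD hD]; exists (g @` D); first exact: countable_image.
by move=> x h; apply: hD => k; apply: h; exists (f x).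
Qed.

Lemma generic2_and (P Q : C -> C -> Prop) : generic2 P -> generic2 Q ->
  generic2 (fun x y => P x y /\ Q x y).
Proof.
move=> [D [E [cD cE h]]] [D' [E' [cD' cE' h']]].
exists (D `|` D'), (E `|` E'); split; try exact: countableU2.
move=> x y hx hy hxy; split.
  by apply: h => k; [apply: hx | apply: hy | apply: hxy]; left.
by apply: h' => k; [apply: hx | apply: hy | apply: hxy]; right.
Qed.

Lemma generic2_sub (P Q : C -> C -> Prop) : (forall x y, P x y -> Q x y) ->
  generic2 P -> generic2 Q.
Proof.
by move=> h [D [E [cD cE h']]]; exists D, E; split => // x y ? ? ?; apply/h/h'.
Qed.

Lemma generic2_shift (P : C -> C -> Prop) s t : generic2 P ->
  generic2 (fun x y => P (x + s) (y + t)).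
Proof.
move=> [D [E [cD cE h]]].
exists (((fun x => x - s) @` D) `|` ((fun x => x - t) @` D)), ((fun x => x - (s - t)) @` E).
split; try exact: countable_image; first by apply: countableU2; apply: countable_image.
move=> x y hx hy hxy; apply: h => k.
- by apply: hx; left; exists (x + s) => //; rewrite addrK.
- by apply: hy; right; exists (y + t) => //; rewrite addrK.
- by apply: hxy; exists (x + s - (y + t)) => //; ring.
Qed.

Lemma generic2_swap (P : C -> C -> Prop) : generic2 P -> generic2 (fun x y => P y x).
Proof.
move=> [D [E [cD cE h]]]; exists D, (-%R @` E); split => //; first exact: countable_image.
by move=> x y hx hy hxy; apply: h => // k; apply: hxy; exists (y - x) => //; rewrite opprB.
Qed.

Lemma generic2_fst (P : C -> Prop) : generic1 P -> generic2 (fun x _ => P x).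
Proof.
by move=> [D cD h]; exists D, set0; split => [||x y hx _ _]; [exact: cD | exact: countable0 | exact: h].
Qed.

Lemma generic2_diff (P : C -> Prop) : generic1 P -> generic2 (fun x y => P (x - y)).
Proof.
by move=> [D cD h]; exists set0, D; split => [||x y _ _ hx]; [exact: countable0 | exact: cD | exact: h].
Qed.

(** Source of the exceptional sets of the R-matrix: a vanishing factor of an infinite product and a
    zero of theta are both conditions of this form over a countable index set. *)
Lemma generic_epi_neq1 (S : countType) (f : S -> C) :
  generic1 (fun x => forall s, epi (2 * x + f s) != 1).
Proof.
pose D := \bigcup_(s in [set: S]) \bigcup_(k in [set: int]) [set (k%:~R - f s / 2 : C)].
exists D.
  apply: bigcup_countable => [|s _]; first exact: countableP.
  by apply: bigcup_countable => [|k _]; [exact: countableP | exact: countable1].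
move=> x hx s; apply/eqP => h; apply: hx.
have [|k hk] := @epi_eq1 R (x + f s / 2).
  by rewrite -[RHS]h; congr epi; field.
by exists s => //; exists k => //=; rewrite -hk addrK.
Qed.

End GenericLemmas.

Section GenericProducts.
Variable R : realType.
Local Notation C := R[i].
Variables (p Q sp sq : C).
Hypothesis (hp : epi sp = p) (hQ : epi sq = Q) (p1 : nrm p < 1) (Q1 : nrm Q < 1).

Definition good (x : C) := pochhammer x Q != 0 /\ pochhammer2 x p Q != 0.

Lemma generic_good (a : C) : generic1 (fun x => good (epi (2 * x + a))).
Proof.
apply: generic1_sub (generic_epi_neq1 (fun ml : nat * nat => a + ml.1%:R * sp + ml.2%:R * sq)).
move=> x h; have {}h m l : 1 - epi (2 * x + a) * p ^+ m * Q ^+ l != 0.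
  by rewrite subr_eq0 eq_sym -hp -hQ -!epiMn -!epiD -!addrA addrA; have := h (m, l); rewrite /= !addrA.
split; first by apply: poch_neq0 => // m; have := h 0%N m; rewrite expr0 mulr1.
exact: (poch2_cvg_neq0 _ p1 Q1).2.
Qed.

Lemma generic_goodN (a : C) : generic1 (fun x => good (epi (a - 2 * x))).
Proof.
apply: generic1_sub (generic1_comp (@opprK C) (generic_good a)) => x /=.
by rewrite mulrN addrC.
Qed.

End GenericProducts.

Lemma mul_invmx_comm (K : fieldType) (m : nat) (k : K) (X Y : 'M[K]_m) :
  k != 0 -> X \in unitmx -> Y *m X = k *: (X *m Y) ->
  Y *m invmx X = k^-1 *: (invmx X *m Y).
Proof.
move=> k0 uX e; apply: (scalerI k0); rewrite scalerA divff // scale1r.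
apply: (can_inj (mulmxK uX)); rewrite -scalemxAl mulmxKV // -mulmxA e.
by rewrite -scalemxAr mulmxA mulVmx // mul1mx.
Qed.

(** * Unitarity and quasi-periodicity of the normalised R-matrix *)

Section RhatProperties.
Variable R : realType.
Local Notation C := R[i].
Variables (n : nat) (gh : 'M[C]_n.+2) (zeta tau : C).
Local Notation N := n.+2.
Local Notation g := (gmx R N).
Local Notation h := (hmx R N).
Local Notation a := (amx gh).
Hypothesis tau_gt0 : 0 < complex.Im tau.
Hypothesis zeta_gt0 : 0 < complex.Im zeta.
Hypothesis hW : W_defined N zeta tau.
Hypothesis hgh : gh *m gh = g.

Local Notation th := (th tau).

Let N0 : (N%:R : C) != 0. Proof. by rewrite pnatr_eq0. Qed.

Lemma xb_neq0 b1 b2 : th (xb tau n zeta b1 b2) != 0.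
Proof.
have key (c1 c2 : 'I_N) : th (xb tau n zeta c1 c2) != 0.
  have := hW c1 c2; rewrite theta_char_th // mulf_eq0 negb_or => /andP[_].
  by congr (th _ != 0); rewrite /xb; field; rewrite -natrD pnatr_eq0.
have l1 : (b1 %% N < N)%N by rewrite ltn_mod.
have l2 : (b2 %% N < N)%N by rewrite ltn_mod.
have := key (Ordinal l1) (Ordinal l2) => /=; apply: contra => /eqP/(th_eq0P tau_gt0) z.
apply/eqP/th_eq0P => //.
rewrite (_ : xb tau n zeta (b1 %% N) (b2 %% N) = xb tau n zeta b1 b2 -
    ((b2 %/ N)%:Z%:~R + (b1 %/ N)%:Z%:~R * tau)).
  by apply: in_latticeB; [exact: z | exists (b2 %/ N)%:Z, (b1 %/ N)%:Z].
have dec (b : nat) : (b%:R : C) = (b %/ N)%:R * N%:R + (b %% N)%:R.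
  by rewrite -natrM -natrD -divn_eq.
rewrite -!pmulrn /xb (dec b1) (dec b2).
by move: ((b1 %% N)%:R) ((b2 %% N)%:R) => r1 r2; field; rewrite -natrD pnatr_eq0.
Qed.

(** If [zeta] were [m + k tau], then [xb b1 b2] would be a lattice point for [b1 = -k] and [b2 = -m]
    modulo N. *)
Lemma zeta_neq0 : th zeta != 0.
Proof.
apply/eqP => /th_eq0P [//|m [k e]].
have lat (i : int) : exists (b : nat) (j : int), i + b%:Z = j * N%:Z.
  have [hi|hi] : 0 <= i \/ i <= 0 by lia.
    by exists (absz i * n.+1)%N, i; rewrite PoszM gez0_abs //; lia.
  by exists (absz i), 0; lia.
have [b2 [j2 e2]] := lat m; have [b1 [j1 e1]] := lat k.
have /eqP := xb_neq0 b1 b2; apply; apply/th_eq0P => //; exists j2, j1.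
have f1 : (k%:~R : C) + b1%:R = j1%:~R * N%:R by rewrite pmulrn -intrD e1 intrM.
have f2 : (m%:~R : C) + b2%:R = j2%:~R * N%:R by rewrite pmulrn -intrD e2 intrM.
rewrite /xb e; apply: (mulIf N0); rewrite divfK //.
rewrite mulrDl -f2 mulrAC -f1; ring.
Qed.

Lemma WE xi a1 a2 : W N zeta tau xi a1 a2 = N%:R^-1 * wgt tau n zeta a1 a2 xi.
Proof.
rewrite /W /wgt !theta_char_th //; congr (_ * _).
have -> : xi + zeta / N%:R + a1%:R / N%:R * tau + a2%:R / N%:R = xb tau n zeta a1 a2 + xi.
  by rewrite /xb; field; rewrite -natrD pnatr_eq0.
have -> : zeta / N%:R + a1%:R / N%:R * tau + a2%:R / N%:R = xb tau n zeta a1 a2.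
  by rewrite /xb; field; rewrite -natrD pnatr_eq0.
rewrite -mulf_div -epiB; congr (epi _ * _); ring.
Qed.

Definition pref xi : C :=
  tauN N zeta (zeta / 2 - xi) * (epi ((2 / N%:R - 2) * xi) * kappa_inv N zeta tau xi *
   (th zeta / th (xi + zeta))) * N%:R^-1.

Definition dressed xi : 'M[C]_(N * N) :=
  (gh *t gh) *m belavin n tau zeta xi *m (invmx gh *t invmx gh).

Lemma RhatE xi : Rhat gh zeta tau xi = pref xi *: dressed xi.
Proof.
rewrite /Rhat /Rmx /Rtilde /dressed.
rewrite -scalemxAr -scalemxAl scalerA.
have -> : \sum_(a1 < N) \sum_(a2 < N) W N zeta tau xi a1 a2 *: (Imx R N a1 a2 *t invmx (Imx R N a1 a2))
   = N%:R^-1 *: belavin n tau zeta xi.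
  rewrite /belavin scaler_sumr; apply: eq_bigr => a1 _; rewrite scaler_sumr.
  by apply: eq_bigr => a2 _; rewrite WE scalerA.
by rewrite -scalemxAr -scalemxAl scalerA /pref.
Qed.

Lemma ghU : gh \in unitmx.
Proof.
have : gh *m gh \in unitmx by rewrite hgh; exact: gU.
by rewrite unitmx_mul => /andP[].
Qed.

Lemma aU : a \in unitmx.
Proof. by rewrite /amx !unitmx_mul ghU /= andbT; exact: hU. Qed.

Lemma a_gh : a *m gh = gh *m (h *m g).
Proof. by rewrite /amx -!mulmxA hgh. Qed.

Lemma gh_a : invmx gh *m a = (h *m g) *m invmx gh.
Proof.
apply: (can_inj (mulmxK ghU)).
by rewrite -(mulmxA (invmx gh)) a_gh mulKmx ?ghU // mulmxKV ?ghU.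
Qed.

Lemma dressed_qp xi : leg1 a *m dressed (xi + 1 + tau) =
  epi (- tau - 2 * xi - 2 * zeta / N%:R) *: (dressed xi *m leg1 a).
Proof.
rewrite /dressed !mulmxA.
have -> : leg1 a *m (gh *t gh) = (gh *t gh) *m leg1 (h *m g).
  by rewrite /leg1 !tensmx_mul a_gh mul1mx mulmx1.
have e : (invmx gh *t invmx gh) *m leg1 a = leg1 (h *m g) *m (invmx gh *t invmx gh).
  by rewrite /leg1 !tensmx_mul gh_a mul1mx mulmx1.
rewrite -(mulmxA _ (leg1 (h *m g))) (belavin_qp tau_gt0 xb_neq0).
rewrite -scalemxAr -scalemxAl; congr (_ *: _).
by rewrite -!mulmxA e !mulmxA.
Qed.

Lemma dressed_unitarity xi : dressed xi *m flip (dressed (- xi)) =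
  (N%:R ^+ 2 * (th (zeta + xi) * th (zeta - xi)) / th zeta ^+ 2) *: 1%:M.
Proof.
rewrite /dressed !flipM !flip_tens !mulmxA.
have e1 : (invmx gh *t invmx gh) *m (gh *t gh) = 1%:M.
  by rewrite tensmx_mul mulVmx ?ghU // -[_ *t _]/(leg1 _) leg1_1.
have e2 : (gh *t gh) *m (invmx gh *t invmx gh) = 1%:M.
  by rewrite tensmx_mul mulmxV ?ghU // -[_ *t _]/(leg1 _) leg1_1.
rewrite -(mulmxA _ (invmx gh *t invmx gh)) e1 mulmx1.
rewrite -(mulmxA _ (belavin _ _ _ _)) (belavin_unitarity tau_gt0 xb_neq0 zeta_neq0).
by rewrite -scalemxAr mulmx1 -scalemxAl e2.
Qed.

(** Conjugation by a (x) a multiplies the two factors of I (x) I^{-1} by inverse phases. *)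
Lemma Rhat_commute xi : leg1 a *m leg2 a *m Rhat gh zeta tau xi =
  Rhat gh zeta tau xi *m (leg1 a *m leg2 a).
Proof.
rewrite RhatE -scalemxAl -scalemxAr; congr (_ *: _).
have -> : leg1 a *m leg2 a = a *t a by rewrite /leg1 /leg2 tensmx_mul mul1mx mulmx1.
have e1 : (a *t a) *m (gh *t gh) = (gh *t gh) *m ((h *m g) *t (h *m g)).
  by rewrite !tensmx_mul a_gh.
have e2 : (invmx gh *t invmx gh) *m (a *t a) = ((h *m g) *t (h *m g)) *m (invmx gh *t invmx gh).
  by rewrite !tensmx_mul gh_a.
suff e3 : ((h *m g) *t (h *m g)) *m belavin n tau zeta xi =
    belavin n tau zeta xi *m ((h *m g) *t (h *m g)).
  rewrite /dressed; move: (a *t a) (gh *t gh) (invmx gh *t _) ((h *m g) *t (h *m g)) (belavin _ _ _ _) e1 e2 e3.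
  move=> X Y Z H B e1 e2 e3.
  by rewrite !mulmxA e1 -(mulmxA Y H) e3 -[RHS]mulmxA e2 !mulmxA.
rewrite /belavin mulmx_suml mulmx_sumr; apply: eq_bigr => i _.
rewrite mulmx_suml mulmx_sumr; apply: eq_bigr => j _.
rewrite -scalemxAr -scalemxAl !tensmx_mul; congr (_ *: _).
pose k := om R n ^+ j * om R n ^- i.
have k0 : k != 0 by rewrite mulf_neq0 ?invr_eq0 ?expf_neq0 ?om_neq0.
have e : (h *m g) *m Imx R N i j = k *: (Imx R N i j *m (h *m g)).
  by rewrite !mulmxE Imx_shift_conj.
have IU : Imx R N i j \in unitmx by exact: ImxU.
have e' : (h *m g) *m invmx (Imx R N i j) = k^-1 *: (invmx (Imx R N i j) *m (h *m g)).
  exact: mul_invmx_comm.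
by rewrite e e' tensZl tensZr scalerA divff // scale1r.
Qed.

Let p := epi (2 * tau).
Let Q := epi (2 * N%:R * zeta).

(** Collects all scalars of the quasi-periodicity: both prefactors, the quasi-period factor and the
    unitarity constant. The infinite products cancel by [kap_shift], the rest is a count of
    exponents. *)
Lemma pref_cancel : generic1 (fun xi =>
  pref (xi + 1 + tau) * pref (- xi) * epi (- tau - 2 * xi - 2 * zeta / N%:R) *
  (N%:R ^+ 2 * (th (zeta + xi) * th (zeta - xi)) / th zeta ^+ 2) = 1).
Proof.
have p1 : nrm p < 1 by exact: nome_lt1.
have Q1 : nrm Q < 1.
  apply: epi_lt1; rewrite (_ : 2 * N%:R * zeta = (2 * N)%:R * zeta); last by rewrite natrM.
  by case: (zeta) zeta_gt0 => x y /= hy; rewrite natrC /= mul0r addr0 mulr_gt0 // ltr0n.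
have gg := generic_good (erefl p) (erefl Q) p1 Q1.
have gn := generic_goodN (erefl p) (erefl Q) p1 Q1.
have gth (s : C) : generic1 (fun xi => th (s + xi) != 0).
  pose f (k : int) : C := 2 * s - 2 * k%:~R * tau.
  apply: generic1_sub (generic_epi_neq1 f) => xi hx; apply/eqP => /th_eq0P[//|m [k e]].
  have /eqP := hx k; apply; rewrite /f -[RHS](epi2z R m); congr epi.
  have -> : 2 * xi = 2 * (s + xi) - 2 * s by ring.
  by rewrite e; ring.
have gth2 : generic1 (fun xi => th (zeta - xi) != 0).
  exact: generic1_sub (generic1_comp (@opprK C) (gth zeta)).
(* The theta factors of the unitarity constant, then the eight arguments of [kap_shift] in their
   order there. *)
have big := generic1_and (gth zeta) (generic1_and gth2
  (generic1_and (gn (2 * N%:R * zeta - 2 * tau)) (generic1_and (gg (2 * zeta))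
  (generic1_and (gn 0) (generic1_and (gg (2 * tau + 2 * N%:R * zeta - 2 * zeta))
  (generic1_and (gg (2 * N%:R * zeta)) (generic1_and (gn (2 * zeta - 2 * tau))
  (generic1_and (gg (2 * tau)) (gn (2 * N%:R * zeta - 2 * zeta)))))))))).
apply: generic1_sub big => xi [t1 [t2 [h1 [h2 [h3 [h4 [h5 [h6 [h7 h8]]]]]]]]].
pose z := epi (2 * xi); pose q2 := epi (2 * zeta).
have hQ : pochhammer Q Q != 0.
  apply: poch_neq0 => // m; rewrite -exprS; apply/eqP => /eqP.
  rewrite subr_eq0 => /eqP e; have := congr1 (@nrm R) e; rewrite nrm1 nrmX => e1.
  by have : nrm Q ^+ m.+1 < 1; [rewrite exprn_ilt1 ?nrm_ge0 | rewrite -e1 ltxx].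
(* [z] is the square of the spectral parameter, so the sign in -p^{1/2} is invisible to the infinite
   products; it is felt only by [thD1] and by the fractional powers. *)
have zs : epi (2 * (xi + 1 + tau)) = p * z.
  by rewrite /p /z -epiD -[RHS](epiDz 1); congr epi; ring.
have zn : epi (2 * - xi) = z^-1 by rewrite /z -epiN; congr epi; ring.
have ks : kappa_inv N zeta tau (xi + 1 + tau) = kap p Q q2 (p * z).
  by rewrite /kappa_inv zs.
have kn : kappa_inv N zeta tau (- xi) = kap p Q q2 z^-1.
  by rewrite /kappa_inv zn.
have ts : tauN N zeta (zeta / 2 - (xi + 1 + tau)) =
    epi ((2 / N%:R - 2) * (zeta / 2 - (xi + 1 + tau))) * (Theta Q (q2 / (p * z)) / Theta Q (p * z)).
  rewrite /tauN -/Q; congr (_ * (Theta Q _ / Theta Q _)).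
    by rewrite -zs /q2 -epiB; congr epi; field.
  by rewrite -zs; congr epi; field.
have tn : tauN N zeta (zeta / 2 - - xi) =
    epi ((2 / N%:R - 2) * (zeta / 2 + xi)) * (Theta Q (q2 * z) / Theta Q z^-1).
  rewrite /tauN -/Q opprK; congr (_ * (Theta Q _ / Theta Q _)).
    by rewrite /q2 /z -epiD; congr epi; field.
  by rewrite -zn; congr epi; field.
have := @kap_shift R p Q q2 z p1 Q1 (epi_neq0 _) (epi_neq0 _) (epi_neq0 _) hQ.
have hall x : x \in [:: Q / (p * z); q2 * z; z^-1; p * Q / q2 * z; Q * z;
                     q2 / (p * z); p * z; Q / q2 / z] ->
     pochhammer x Q != 0 /\ pochhammer2 x p Q != 0.
  rewrite !inE => /or4P[/eqP->|/eqP->|/eqP->|/or4P[/eqP->|/eqP->|/eqP->|/orP[/eqP->|/eqP->]]].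
  - by move: h1; rewrite /good; congr (pochhammer _ Q != 0 /\ pochhammer2 _ p Q != 0);
      rewrite /Q /p /z -!epiD -epiB; congr epi; ring.
  - by move: h2; rewrite /good; congr (pochhammer _ Q != 0 /\ pochhammer2 _ p Q != 0);
      rewrite /q2 /z -!epiD; congr epi; ring.
  - by move: h3; rewrite /good; congr (pochhammer _ Q != 0 /\ pochhammer2 _ p Q != 0);
      rewrite /z -epiN; congr epi; ring.
  - by move: h4; rewrite /good; congr (pochhammer _ Q != 0 /\ pochhammer2 _ p Q != 0);
      rewrite /Q /p /q2 /z -!epiD -epiB -epiD; congr epi; ring.
  - by move: h5; rewrite /good; congr (pochhammer _ Q != 0 /\ pochhammer2 _ p Q != 0);
      rewrite /Q /z -!epiD; congr epi; ring.
  - by move: h6; rewrite /good; congr (pochhammer _ Q != 0 /\ pochhammer2 _ p Q != 0);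
      rewrite /q2 /p /z -!epiD -epiB; congr epi; ring.
  - by move: h7; rewrite /good; congr (pochhammer _ Q != 0 /\ pochhammer2 _ p Q != 0);
      rewrite /p /z -!epiD; congr epi; ring.
  - by move: h8; rewrite /good; congr (pochhammer _ Q != 0 /\ pochhammer2 _ p Q != 0);
      rewrite /Q /q2 /z -!epiB; congr epi; ring.
move=> /(_ hall) K.
rewrite /pref ks kn ts tn.
have -> : xi + 1 + tau + zeta = xi + zeta + 1 + tau by ring.
rewrite thDtau // thD1 // (addrC (- xi)) (addrC xi zeta).
have z0 := zeta_neq0.
set E1 := epi ((2 / N%:R - 2) * (zeta / 2 - (xi + 1 + tau))).
set E2 := epi ((2 / N%:R - 2) * (xi + 1 + tau)).
set E3 := epi ((2 / N%:R - 2) * (zeta / 2 + xi)).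
set E4 := epi ((2 / N%:R - 2) * - xi).
set E5 := epi (- tau - 2 * xi - 2 * zeta / N%:R).
set E6 := epi (- tau - 2 * (zeta + xi + 1)).
have E60 : E6 != 0 := epi_neq0 _.
(* The fractional powers contribute [(2 / N - 2) * zeta] in total. Its part [2 * zeta / N] cancels
   against [E5], and the rest is the exponent of [E6] up to an even integer. *)
have eE : E1 * E2 * E3 * E4 * E5 = E6.
  rewrite /E1 /E2 /E3 /E4 /E5 /E6 -!epiD -[RHS](epiDz 1); congr epi.
  by field; rewrite -natrD pnatr_eq0.
have -> : forall T1 T2 K1 K2 : C,
  E1 * T1 * (E2 * K1 * (th zeta / (- E6 * - th (zeta + xi)))) * N%:R^-1 *
  (E3 * T2 * (E4 * K2 * (th zeta / th (zeta - xi))) * N%:R^-1) * E5 *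
  (N%:R ^+ 2 * (th (zeta + xi) * th (zeta - xi)) / th zeta ^+ 2) =
  (E1 * E2 * E3 * E4 * E5) / E6 * (K1 * K2 * (T1 * T2)).
  by move=> T1 T2 K1 K2; field; rewrite E60 z0 t1 t2 -natrD pnatr_eq0.
by rewrite eE divff // mul1r (mulf_div (Theta Q (q2 / (p * z)))) K.
Qed.

(** Stated as a product equal to 1 rather than with an inverse of R_21(x^{-1}), whose existence is
    part of the conclusion. *)
Lemma Rhat_qp : generic1 (fun xi =>
  leg1 a *m Rhat gh zeta tau (xi + 1 + tau) *m leg1 (invmx a) *m
    flip (Rhat gh zeta tau (- xi)) = 1%:M).
Proof.
apply: generic1_sub pref_cancel => xi K.
rewrite !RhatE flipZ -!(scalemxAl, scalemxAr) dressed_qp -!scalemxAl.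
rewrite -(mulmxA (dressed xi)) -leg1M mulmxV ?aU // leg1_1 mulmx1.
rewrite dressed_unitarity !scalerA; set k := (X in X *: _).
suff -> : k = 1 by rewrite scale1r.
by rewrite -[RHS]K /k; ring.
Qed.

End RhatProperties.

(** * The exchange relations *)

Section ExchangeAlgebra.
Variable T : pzRingType.
Implicit Types r s x p l m v a b : T.

Lemma conj_exchange r s l1 l2 a b : b * a = 1 -> a * b = 1 ->
  a * r = r * a -> a * s = s * a ->
  r * l1 * l2 = l2 * l1 * s ->
  r * (a * (l1 * l2) * b) = (a * (l2 * l1) * b) * s.
Proof.
move=> ba ab ra sa e.
have sb : b * s = s * b.
  by rewrite -[b * s]mulr1 -ab mulrA -(mulrA b) -sa !mulrA ba mul1r.
by rewrite !mulrA -ra -!mulrA sb !mulrA -!(mulrA a) e !mulrA.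
Qed.

(** [x] and [y] stand for R_21(q^c w/z) and R^*_21(w/z). Since [a] acts on the first leg, it passes
    through [p2], and conjugating the relation turns [r] and [s] into inverses of [x] and [y]. *)
Lemma crossed_exchange r s x y l1 p2 a b : b * a = 1 -> a * b = 1 ->
  a * p2 = p2 * a -> b * p2 = p2 * b ->
  x * (a * r * b) = 1 -> (a * s * b) * y = 1 ->
  r * l1 * p2 = p2 * l1 * s ->
  (a * l1 * b) * p2 * y = x * p2 * (a * l1 * b).
Proof.
move=> ba ab ap bp hx hy e.
have key : (a * r * b) * ((a * l1 * b) * p2) = p2 * (a * l1 * b) * (a * s * b).
  have -> : a * r * b * (a * l1 * b * p2) = a * (r * (b * a) * l1 * (b * p2)) by rewrite !mulrA.
  have -> : p2 * (a * l1 * b) * (a * s * b) = p2 * a * (l1 * (b * a) * s * b) by rewrite !mulrA.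
  by rewrite ba !mulr1 bp -ap -!mulrA; congr (a * _); rewrite !mulrA e.
have : x * ((a * r * b) * ((a * l1 * b) * p2)) * y = x * (p2 * (a * l1 * b) * (a * s * b)) * y.
  by rewrite key.
by rewrite mulrA hx mul1r => ->; rewrite -!mulrA (mulrA a) (mulrA (a * s)) in hy *;
  rewrite !mulrA -(mulrA _ _ y) -!mulrA in hy *; rewrite hy mulr1 !mulrA.
Qed.

(** The crossed relations, multiplied by the inverses, become [v1 x21 p2 = p2 s21 v1] and
    [v2 x12 p1 = p1 s12 v2]. Both sides then reduce to [p2 p1 s12] times [s21 v1 v2] and [v2 v1 r21]
    respectively, which agree by the inverted form of [e2]. *)
Lemma reflection_exchange p1 p2 m1 m2 v1 v2 r12 r21 s12 s21 x12 x21 :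
  r12 * p1 * p2 = p2 * p1 * s12 ->
  r21 * m2 * m1 = m1 * m2 * s21 ->
  m1 * p2 * s21 = x21 * p2 * m1 ->
  m2 * p1 * s12 = x12 * p1 * m2 ->
  v1 * m1 = 1 -> m1 * v1 = 1 -> v2 * m2 = 1 -> m2 * v2 = 1 ->
  r12 * (p1 * v1) * x21 * (p2 * v2) = (p2 * v2) * x12 * (p1 * v1) * r21.
Proof.
move=> e1 e2 e3 e4 vm1 mv1 vm2 mv2.
have k1 : v1 * x21 * p2 = p2 * s21 * v1.
  rewrite -[LHS]mulr1 -mv1 -!mulrA (mulrA p2) (mulrA x21) (mulrA x21 p2) -e3.
  by rewrite !mulrA vm1 mul1r.
have k2 : v2 * x12 * p1 = p1 * s12 * v2.
  rewrite -[LHS]mulr1 -mv2 -!mulrA (mulrA p1) (mulrA x12) (mulrA x12 p1) -e4.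
  by rewrite !mulrA vm2 mul1r.
have k3 : s21 * v1 * v2 = v2 * v1 * r21.
  have : v2 * v1 * (r21 * m2 * m1) * (v1 * v2) = v2 * v1 * (m1 * m2 * s21) * (v1 * v2).
    by rewrite e2.
  have -> : v2 * v1 * (r21 * m2 * m1) * (v1 * v2) = v2 * v1 * r21 * (m2 * (m1 * v1) * v2).
    by rewrite !mulrA.
  have -> : v2 * v1 * (m1 * m2 * s21) * (v1 * v2) = v2 * (v1 * m1) * m2 * s21 * (v1 * v2).
    by rewrite !mulrA.
  by rewrite mv1 vm1 !mulr1 mv2 vm2 mulr1 mul1r mulrA.
have -> : r12 * (p1 * v1) * x21 * (p2 * v2) = r12 * p1 * (v1 * x21 * p2) * v2 by rewrite !mulrA.
have -> : p2 * v2 * x12 * (p1 * v1) * r21 = p2 * (v2 * x12 * p1) * v1 * r21 by rewrite !mulrA.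
rewrite k1 k2 !mulrA e1 -!mulrA; congr (p2 * (p1 * (s12 * _))).
by rewrite !mulrA.
Qed.

End ExchangeAlgebra.

Section FlippedProducts.
Variables (K : pzRingType) (N : nat).
Implicit Types (X : 'M[K]_(N * N)) (Y Z : 'M[K]_N).

Lemma flip_mul12 X Y Z : flip (X *m leg1 Y *m leg2 Z) = flip X *m leg2 Y *m leg1 Z.
Proof. by rewrite !flipM flip_leg1 flip_leg2. Qed.

Lemma flip_mul21 X Y Z : flip (X *m leg2 Y *m leg1 Z) = flip X *m leg1 Y *m leg2 Z.
Proof. by rewrite !flipM flip_leg1 flip_leg2. Qed.

Lemma flip_12mul X Y Z : flip (leg1 Y *m leg2 Z *m X) = leg2 Y *m leg1 Z *m flip X.
Proof. by rewrite !flipM flip_leg1 flip_leg2. Qed.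

Lemma flip_21mul X Y Z : flip (leg2 Y *m leg1 Z *m X) = leg1 Y *m leg2 Z *m flip X.
Proof. by rewrite !flipM flip_leg1 flip_leg2. Qed.

End FlippedProducts.

Section ScalarMatrices.
Variables (R : realType) (A : algType R[i]) (N : nat).
Local Notation K := R[i].
Implicit Types (X Y : 'M[K]_N) (Z : 'M[A]_N).

Lemma inAM m k l (X : 'M[K]_(m, k)) (Y : 'M[K]_(k, l)) :
  inA A (X *m Y) = inA A X *m inA A Y.
Proof. exact: map_mxM. Qed.

Lemma inA1 m : inA A (1%:M : 'M[K]_m) = 1%:M.
Proof. exact: map_mx1. Qed.

Lemma flip_inA (X : 'M[K]_(N * N)) : flip (inA A X) = inA A (flip X).
Proof. by apply/matrixP => i j; rewrite !mxE. Qed.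

Lemma leg1_inA X : leg1 (inA A X) = inA A (leg1 X).
Proof. by apply/matrixP => i j; rewrite !mxE rmorphM rmorph_nat. Qed.

Lemma leg2_inA X : leg2 (inA A X) = inA A (leg2 X).
Proof. by rewrite -!flip_leg1 leg1_inA flip_inA. Qed.

Lemma leg1_mul_leg2E (Y Z : 'M[A]_N) i j : (leg1 Y *m leg2 Z) i j =
  Y (mxtens_unindex i).1 (mxtens_unindex j).1 * Z (mxtens_unindex i).2 (mxtens_unindex j).2.
Proof.
rewrite mxE (bigD1 (mxtens_index ((mxtens_unindex j).1, (mxtens_unindex i).2))) //= big1 ?addr0.
  by rewrite !mxE !mxtens_indexK /= !eqxx mulr1 mul1r.
move=> k; rewrite -{1}[k]mxtens_unindexK (can_eq (@mxtens_indexK N N)) => hk.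
rewrite !mxE -!mulrA; case: eqP => [e1|]; last by rewrite mul0r mulr0.
case: eqP => [e2|]; last by rewrite mul0r !mulr0.
by move: hk; rewrite [mxtens_unindex k]surjective_pairing e2 -e1 eqxx.
Qed.

(** Operators on different legs commute only when their entries do; those of [inA A X] are scalars
    of the algebra. *)
Lemma leg_commute X Z : leg1 (inA A X) *m leg2 Z = leg2 Z *m leg1 (inA A X).
Proof.
apply: (can_inj (@flipK _ _)); rewrite [in RHS]flipM flip_leg1 flip_leg2.
apply/matrixP => i j; rewrite leg1_mul_leg2E mxE leg1_mul_leg2E !mxtens_indexK /= mxE.
by rewrite mulr_algl mulr_algr.
Qed.

Lemma leg_commute2 X Z : leg2 (inA A X) *m leg1 Z = leg1 Z *m leg2 (inA A X).
Proof.
have := congr1 (@flip _ _) (leg_commute X Z).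
by rewrite !flipM !flip_leg1 flip_leg2.
Qed.

End ScalarMatrices.

(** * Exchange relations between L^+ and L^- *)

Section Exchange.
Variables (R : realType) (n : nat).
Local Notation C := R[i].
Local Notation N := n.+2.
Variables (zeta tau c : C) (gh : 'M[C]_N) (A : algType C) (L : C -> 'M[A]_N).
Local Notation taus := (taustar zeta tau c).
Hypotheses (hp : 0 < complex.Im tau) (hps : 0 < complex.Im taus).
Hypothesis hgh : gh *m gh = gmx R N.
Local Notation a := (amx gh).
Local Notation Lm := (Lminus gh tau L).
Local Notation Lp := (fun x => Lplus zeta c L (x + c / 2 * zeta)).
Local Notation r12 := (Rh12 gh zeta tau A).
Local Notation r21 := (Rh21 gh zeta tau A).
Local Notation s12 := (Rhstar12 gh zeta tau c A).

Let a1 : 'M[A]_(N * N) := leg1 (inA A a).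
Let b1 : 'M[A]_(N * N) := leg1 (inA A (invmx a)).
Let a2 : 'M[A]_(N * N) := leg2 (inA A a).
Let b2 : 'M[A]_(N * N) := leg2 (inA A (invmx a)).

Let b1a1 : b1 *m a1 = 1%:M.
Proof. by rewrite /b1 /a1 -leg1M -inAM mulVmx ?(aU hgh) // inA1 leg1_1. Qed.
Let a1b1 : a1 *m b1 = 1%:M.
Proof. by rewrite /b1 /a1 -leg1M -inAM mulmxV ?(aU hgh) // inA1 leg1_1. Qed.
Let b2a2 : b2 *m a2 = 1%:M.
Proof. by rewrite -flip1 -b1a1 flipM !flip_leg1. Qed.
Let a2b2 : a2 *m b2 = 1%:M.
Proof. by rewrite -flip1 -a1b1 flipM !flip_leg1. Qed.

Let r12E x : r12 x = inA A (Rhat gh zeta tau x). Proof. by []. Qed.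
Let r21E x : r21 x = inA A (flip (Rhat gh zeta tau x)). Proof. by []. Qed.
Let flip_r12 x : flip (r12 x) = r21 x. Proof. by rewrite r12E flip_inA. Qed.
Let flip_r21 x : flip (r21 x) = r12 x. Proof. by rewrite -flip_r12 flipK. Qed.
Let s12E x : s12 x = inA A (Rhat gh zeta taus x). Proof. by []. Qed.

Let gl x y := r12 (x - y) *m leg1 (L x) *m leg2 (L y) =
    leg2 (L y) *m leg1 (L x) *m s12 (x - y).

Let qp t u := leg1 a *m Rhat gh zeta t (u + 1 + t) *m leg1 (invmx a) *m
    flip (Rhat gh zeta t (- u)) = 1%:M.

Lemma Lminus_exchange x y : gl (x + (1 + tau)) (y + (1 + tau)) ->
  r12 (x - y) *m leg1 (Lm x) *m leg2 (Lm y) = leg2 (Lm y) *m leg1 (Lm x) *m s12 (x - y).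
Proof.
rewrite /gl; have -> : x + (1 + tau) - (y + (1 + tau)) = x - y by ring.
move=> e.
pose l1 : 'M[A]_(N * N) := leg1 (L (x + (1 + tau))).
pose l2 : 'M[A]_(N * N) := leg2 (L (y + (1 + tau))).
have hm1 : leg1 (Lm x) = a1 * l1 * b1 by rewrite /Lminus -addrA !leg1M.
have hm2 : leg2 (Lm y) = a2 * l2 * b2 by rewrite /Lminus -addrA !leg2M.
have c1 : a1 * l2 = l2 * a1 := leg_commute _ _.
have c2 : b1 * l2 = l2 * b1 := leg_commute _ _.
have c3 : a1 * a2 = a2 * a1 := leg_commute _ _.
have c4 : b1 * a2 = a2 * b1 := leg_commute _ _.
have c5 : a1 * b2 = b2 * a1 := leg_commute _ _.
have c6 : b1 * b2 = b2 * b1 := leg_commute _ _.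
have c4b : b2 * a1 = a1 * b2 := leg_commute2 _ _.
have c7 : a2 * l1 = l1 * a2 := leg_commute2 _ _.
have c8 : b2 * l1 = l1 * b2 := leg_commute2 _ _.
(* The matrix [a] does not depend on the nome, so a (x) a commutes with the R-matrices on both sides
   of the relation. *)
have comm t : 0 < complex.Im t ->
    (a1 * a2) * inA A (Rhat gh zeta t (x - y)) = inA A (Rhat gh zeta t (x - y)) * (a1 * a2).
  move=> ht; rewrite -!mulmxE /a1 /a2 leg1_inA leg2_inA -inAM.
  by rewrite -!inAM (Rhat_commute zeta ht hgh).
have i1 : b1 * a1 = 1 := b1a1; have i2 : a1 * b1 = 1 := a1b1.
have i3 : b2 * a2 = 1 := b2a2; have i4 : a2 * b2 = 1 := a2b2.
have hb : (b1 * b2) * (a1 * a2) = 1.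
  by rewrite -mulrA (mulrA b2) c4b -!mulrA i3 mulr1 i1.
have ha : (a1 * a2) * (b1 * b2) = 1.
  by rewrite -mulrA (mulrA a2) -c4 -!mulrA i4 mulr1 i2.
have := conj_exchange hb ha (comm _ hp) (comm _ hps) e.
rewrite hm1 hm2 !mulmxE => e'.
have e12 : (a1 * l1 * b1) * (a2 * l2 * b2) = a1 * a2 * (l1 * l2) * (b1 * b2).
  rewrite -!mulrA; congr (_ * _); rewrite (mulrA b1) c4 -(mulrA a2) (mulrA b1 l2) c2.
  by rewrite -(mulrA l2) !mulrA c7.
have e21 : (a2 * l2 * b2) * (a1 * l1 * b1) = a1 * a2 * (l2 * l1) * (b1 * b2).
  rewrite c3 c6 -!mulrA; congr (_ * _); rewrite (mulrA b2) -c5 -(mulrA a1) (mulrA b2 l1) c8.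
  by rewrite -(mulrA l1) !mulrA c1.
by rewrite -mulrA e12 e21 e'.
Qed.

Lemma Lplus_Lminus_exchange x y : gl (x + (1 + tau)) (y + c * zeta) ->
  qp tau (x - y - c * zeta) -> qp taus (x - y) ->
  leg1 (Lm x) *m leg2 (Lp y) *m flip (s12 (y - x)) =
  r21 (c * zeta + y - x) *m leg2 (Lp y) *m leg1 (Lm x).
Proof.
have -> : Lp y = L (y + c * zeta) by rewrite /Lplus; congr L; field.
have hm1 : leg1 (Lm x) = a1 * leg1 (L (x + (1 + tau))) * b1 by rewrite /Lminus -addrA !leg1M.
move=> e q1 q2; rewrite hm1.
(* One argument, read twice: with nome p the quasi-period leaves the shift by [c * zeta], with nome
   p^* it absorbs that shift, as [tau] is [taus + c * zeta]. *)
have u1 : x + (1 + tau) - (y + c * zeta) = x - y - c * zeta + 1 + tau by ring.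
have u2 : x + (1 + tau) - (y + c * zeta) = x - y + 1 + taus by rewrite /taustar; ring.
apply: (crossed_exchange b1a1 a1b1 _ _ _ _ e); rewrite -?mulmxE.
- exact: leg_commute.
- exact: leg_commute.
- rewrite r21E r12E u1 /a1 /b1 !leg1_inA -!inAM; apply: etrans (inA1 A _); congr (inA _ _).
  (* The inverse is needed on the other side. The exchange of factors is made on complex matrices,
     where one-sided inverses are two-sided, before passing to [A]. *)
  by apply: mulmx1C; rewrite -[RHS]q1; congr (_ *m flip (Rhat _ _ _ _)); ring.
- rewrite !s12E u2 /a1 /b1 !leg1_inA flip_inA -!inAM; apply: etrans (inA1 A _); congr (inA _ _).
  by rewrite -[RHS]q2; congr (_ *m flip (Rhat _ _ _ _)); ring.
Qed.

Lemma frakT_exchange (Linv : C -> 'M[A]_N) x y :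
  let T := frakT zeta c L Linv in
  gl (x + c * zeta) (y + c * zeta) -> gl (y + (1 + tau)) (x + (1 + tau)) ->
  gl (x + (1 + tau)) (y + c * zeta) -> gl (y + (1 + tau)) (x + c * zeta) ->
  qp tau (x - y - c * zeta) -> qp taus (x - y) ->
  qp tau (y - x - c * zeta) -> qp taus (y - x) ->
  is_inverse_of (Linv x) (Lm x) -> is_inverse_of (Linv y) (Lm y) ->
  r12 (x - y) *m leg1 (T x) *m r21 (c * zeta + y - x) *m leg2 (T y) =
  leg2 (T y) *m r12 (c * zeta + x - y) *m leg1 (T x) *m r21 (y - x).
Proof.
move=> T g1 g2 g3 g4 q1 q2 q3 q4 [vx xv] [vy yv].
rewrite /T /frakT !leg1M !leg2M.
have lp z : Lplus zeta c L (z + c / 2 * zeta) = L (z + c * zeta) by rewrite /Lplus; congr L; field.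
have e1 : r12 (x - y) *m leg1 (Lp x) *m leg2 (Lp y) = leg2 (Lp y) *m leg1 (Lp x) *m s12 (x - y).
  have := g1; rewrite /gl !lp.
  by have -> : x + c * zeta - (y + c * zeta) = x - y by ring.
have e2 : r21 (y - x) *m leg2 (Lm y) *m leg1 (Lm x) = leg1 (Lm x) *m leg2 (Lm y) *m flip (s12 (y - x)).
  rewrite -flip_r12; apply: etrans (flip_21mul (s12 (y - x)) (Lm x) (Lm y)).
  by apply: etrans (esym (flip_mul12 _ _ _)) _; congr flip; apply: Lminus_exchange.
(* The crossed relation is used directly for [e3], and for [e4] with [x] and [y] interchanged and
   the legs swapped by [flip]. *)
have e3 := Lplus_Lminus_exchange g3 q1 q2.
have e4 : leg2 (Lm y) *m leg1 (Lp x) *m s12 (x - y) =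
    r12 (c * zeta + x - y) *m leg1 (Lp x) *m leg2 (Lm y).
  rewrite -flip_r21; apply: etrans (flip_mul21 (r21 (c * zeta + x - y)) (Lp x) (Lm y)).
  rewrite -[s12 (x - y)]flipK; apply: etrans (esym (flip_12mul _ _ _)) _.
  by congr flip; apply: Lplus_Lminus_exchange.
have i1 : leg1 (Linv x) *m leg1 (Lm x) = 1%:M by rewrite -leg1M vx leg1_1.
have i2 : leg1 (Lm x) *m leg1 (Linv x) = 1%:M by rewrite -leg1M xv leg1_1.
have i3 : leg2 (Linv y) *m leg2 (Lm y) = 1%:M by rewrite -leg2M vy leg2_1.
have i4 : leg2 (Lm y) *m leg2 (Linv y) = 1%:M by rewrite -leg2M yv leg2_1.
exact: (reflection_exchange e1 e2 e3 e4 i1 i2 i3 i4).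
Qed.

End Exchange.

Theorem theorem2 (R : realType) (N : nat) (zeta tau c : R[i])
    (ghalf : 'M[R[i]]_N) (A : algType R[i]) (L Linv : R[i] -> 'M[A]_N)
    (hN : (2 <= N)%N)
    (hq : 0 < complex.Im zeta) (hp : 0 < complex.Im tau)
    (hpstar : 0 < complex.Im (taustar zeta tau c))
    (hW : W_defined N zeta tau) (hWstar : W_defined N zeta (taustar zeta tau c))
    (hghalf_diag : is_diag_mx ghalf)
    (hghalf : ghalf *m ghalf = gmx R N)
    (hL : sl_relations ghalf zeta tau c L)
    (hLinv : generic1 (fun xi => is_inverse_of (Linv xi) (Lminus ghalf tau L xi))) :
  let T := frakT zeta c L Linv in
  generic2 (fun xi eta =>
    Rh12 ghalf zeta tau A (xi - eta) *m leg1 (T xi) *m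
      Rh21 ghalf zeta tau A (c * zeta + eta - xi) *m leg2 (T eta) =
    leg2 (T eta) *m Rh12 ghalf zeta tau A (c * zeta + xi - eta) *m
      leg1 (T xi) *m Rh21 ghalf zeta tau A (eta - xi)).
Proof.
case: N hN ghalf L Linv hW hWstar hghalf_diag hghalf hL hLinv => [|[|n]] // _ gh L Linv.
move=> hW hWs _ hgh [hL _] hinv T.
have G s t := generic2_shift s t hL.
have q1 := Rhat_qp hp hq hW hgh; have q2 := Rhat_qp hpstar hq hWs hgh.
have sh (P : R[i] -> Prop) s : generic1 P -> generic1 (fun x => P (x - s)).
  by move=> hP; have := generic1_comp (subrK s) hP.
(* The generic conditions are four instances of the relation for [L], the quasi-periodicity for each
   nome at both orders of the arguments, and the inverses of L^- at both points. *)
have big := generic2_and (G (c * zeta) (c * zeta)) (generic2_and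
  (generic2_swap (G (1 + tau) (1 + tau))) (generic2_and
  (G (1 + tau) (c * zeta)) (generic2_and
  (generic2_swap (G (1 + tau) (c * zeta))) (generic2_and
  (generic2_diff (sh _ (c * zeta) q1)) (generic2_and
  (generic2_diff q2) (generic2_and
  (generic2_swap (generic2_diff (sh _ (c * zeta) q1))) (generic2_and
  (generic2_swap (generic2_diff q2)) (generic2_and
  (generic2_fst hinv) (generic2_swap (generic2_fst hinv)))))))))).
apply: generic2_sub big => x y [g1 [g2 [g3 [g4 [p1 [p2 [p3 [p4 [v1 v2]]]]]]]]].
have := @frakT_exchange R n zeta tau c gh A L hp hpstar hgh Linv x y g1 g2 g3 g4.
by move=> /(_ p1 p2 p3 p4 v1 v2).
Qed.
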